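(* Let $D\subset\mathbb{C}^n$ be a bounded simply connected domain with smooth boundary and let $S$ be a positive closed $(s,s)$-current on $D$ with bounded mass. Then the current $\mathscr L^{\mathcal K_\theta^n}(S)$ is smooth, positive and of bidegree $(s,s)$. The family $\big(\mathscr L^{\mathcal K_\theta^n}(S)\big)_{0<|\theta|\ll1}$ converges to $S$ as $\theta\to0$ in the sense of currents. On a relatively compact open subset $D'$ of $D$, the restriction of $\mathscr L^{\mathcal K_\theta^n}(S)$ to $D'$ is a smooth positive closed $(s,s)$-current on $D'$ for all $\theta\in\mathbb{C}^*$ with $|\theta|\ll1$.
   Context: Conventions: $dd^c=\frac i\pi\partial\bar\partial$. On $\mathbb{C}^n\times\mathbb{C}^n$ with coordinates $(x,y)$ and projections $\pi_1(x,y)=x$, $\pi_2(x,y)=y$, let $u=\log|x-y|$. Fix a smooth convex increasing $\chi:\mathbb{R}\to\mathbb{R}_{\ge0}$ with $\chi(t)=0$ for $t\le-1$, $\chi(t)=t$ for $t\ge1$. For $\theta\in\mathbb{C}^*$, $u_\theta^{\mathcal K}=\chi(u-\log|\theta|)+\log|\theta|$ and $\mathcal K_\theta^n=dd^cu_\theta^{\mathcal K}\wedge(dd^cu)^{n-1}$, a smooth positive closed $(n,n)$-form supported in $\{e^{-1}|\theta|\le|x-y|\le e|\theta|\}$. The transform is defined by $\langle\mathscr L^{\mathcal K_\theta^n}(S),\varphi\rangle=\int_{D^2}\pi_1^*S\wedge\pi_2^*\varphi\wedge\mathcal K_\theta^n$ for smooth test $(n-s,n-s)$-forms $\varphi$ (compactly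 supported) on $D$; i.e. $\mathscr L^{\mathcal K_\theta^n}(S)=(\pi_2)_*(\pi_1^*S\wedge\mathcal K_\theta^n)=\int_{x\in D}S(x)\wedge\mathcal K_\theta^n(x,y)$. *)

(* Defs.v *)
From HB Require Import structures.
From mathcomp Require Import all_boot all_order all_algebra.
From mathcomp Require Import all_classical all_reals all_analysis.
From mathcomp Require Import complex.

Set Implicit Arguments.
Unset Strict Implicit.
Unset Printing Implicit Defensive.

Import Order.TTheory GRing.Theory Num.Theory numFieldNormedType.Exports.

Local Open Scope classical_set_scope.
Local Open Scope ring_scope.
Local Open Scope complex_scope.

(* A point z of C^n is stored as the pair (Re z, Im z) of real row vectors, so
   that C^n carries the topology and the real normed space structure of the
   library. *)
Notation "''CV[' R ]_ n" := ('rV[R]_n * 'rV[R]_n)%type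
  (at level 8, n at level 2, format "''CV[' R ]_ n").

(* (j, false) stands for dz_j (or for the real coordinate Re z_j), and
   (j, true) for its conjugate (or for Im z_j). *)
Notation gen n := ('I_n * bool)%type.

Section Coordinates.
Context {R : realType}.

Definition basev {n} (a : gen n) : 'CV[R]_n :=
  if a.2 then (0, delta_mx 0 a.1) else (delta_mx 0 a.1, 0).

(* The norm of the library on row vectors is the sup norm. *)
Definition eucl {n} (z : 'CV[R]_n) : R :=
  Num.sqrt (\sum_j (z.1 0 j ^+ 2 + z.2 0 j ^+ 2)).

Definition pairCV {n} (x y : 'CV[R]_n) : 'CV[R]_(n + n) :=
  (row_mx x.1 y.1, row_mx x.2 y.2).
Definition pr_x {n} (p : 'CV[R]_(n + n)) : 'CV[R]_n :=
  (lsubmx p.1, lsubmx p.2).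
Definition pr_y {n} (p : 'CV[R]_(n + n)) : 'CV[R]_n :=
  (rsubmx p.1, rsubmx p.2).

Definition pderivs {n} (l : seq (gen n)) (f : 'CV[R]_n -> R) : 'CV[R]_n -> R :=
  foldr (fun a g => 'D_(basev a) g) f l.

(* C^infinity on the open set U *)
Definition smooth_on {n} (U : set 'CV[R]_n) (f : 'CV[R]_n -> R) : Prop :=
  forall (l : seq (gen n)) z, U z ->
    {for z, continuous (pderivs l f)} /\
    forall a, derivable (pderivs l f) z (basev a).

Definition csmooth_on {n} (U : set 'CV[R]_n) (f : 'CV[R]_n -> R[i]) : Prop :=
  smooth_on U (fun z => complex.Re (f z)) /\
  smooth_on U (fun z => complex.Im (f z)).

Definition cpderiv {n} (a : gen n) (f : 'CV[R]_n -> R[i]) (z : 'CV[R]_n) : R[i] :=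
  'D_(basev a) (fun w => complex.Re (f w)) z +i*
  'D_(basev a) (fun w => complex.Im (f w)) z.

(* d/dz_j for a = (j, false) and d/d\bar z_j for a = (j, true) *)
Definition wirtinger {n} (a : gen n) (f : 'CV[R]_n -> R[i]) (z : 'CV[R]_n) : R[i] :=
  2^-1 * (cpderiv (a.1, false) f z +
          (-1) ^+ (~~ a.2) * 'i * cpderiv (a.1, true) f z).

(* Lebesgue integral over R^k as an iterated integral; below it is only used
   for continuous functions with compact support. *)
Fixpoint rint (k : nat) : ('rV[R]_k -> R) -> R :=
  if k is k'.+1 then fun f : 'rV[R]_(1 + k') -> R =>
    \int[@lebesgue_measure R]_t @rint k' (fun v => f (row_mx t%:M v))
  else fun f => f 0.

Definition cint {n} (f : 'CV[R]_n -> R[i]) : R[i] :=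
  rint (fun a => rint (fun b => complex.Re (f (a, b)))) +i*
  rint (fun a => rint (fun b => complex.Im (f (a, b)))).

End Coordinates.

Section Domains.
Context {R : realType} {n : nat}.
Implicit Types (D U : set 'CV[R]_n).

Definition is_domain D := [/\ open D, D !=set0 & connected D].

(* Path connectedness is part of is_domain: an open connected set has it. *)
Definition simply_connected D :=
  forall g : R -> 'CV[R]_n,
    {within `[0, 1], continuous g} -> g @` `[0, 1] `<=` D -> g 0 = g 1 ->
  exists H : R * R -> 'CV[R]_n,
    [/\ {within `[0, 1] `*` `[0, 1], continuous H},
        H @` (`[0, 1] `*` `[0, 1]) `<=` D,
        forall t : R, 0 <= t <= 1 -> H (0, t) = g t,
        forall t : R, 0 <= t <= 1 -> H (1, t) = g 0
      & forall s : R, 0 <= s <= 1 -> H (s, 0) = g 0 /\ H (s, 1) = g 0].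

Definition smooth_boundary D :=
  forall p, (closure D `\` interior D) p ->
  exists (U : set 'CV[R]_n) (rho : 'CV[R]_n -> R),
    [/\ open U, U p, smooth_on U rho,
        forall z, U z -> exists a : gen n, 'D_(basev a) rho z != 0
      & D `&` U = [set z | U z /\ rho z < 0]].

Definition relatively_compact_in (D' D : set 'CV[R]_n) :=
  compact (closure D') /\ closure D' `<=` D.

End Domains.

Section ExteriorAlgebra.
Context {R : realType} {n : nat}.

(* Complex covectors of C^n: lam I is the coefficient on the wedge of the
   generators in I, taken in the order
   dz_1, d\bar z_1, dz_2, d\bar z_2, ..., dz_n, d\bar z_n. *)
Definition cov := {ffun {set gen n} -> R[i]}.

Definition glt (a b : gen n) : bool := (a.1.*2 + a.2 < b.1.*2 + b.2)%N.

Definition inversions (I J : {set gen n}) : nat :=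
  #|[pred ab : gen n * gen n | [&& ab.1 \in I, ab.2 \in J & glt ab.2 ab.1]]|.

Definition wedge (lam mu : cov) : cov :=
  [ffun K : {set gen n} => \sum_(I in powerset K)
     (-1) ^+ inversions I (K :\: I) * lam I * mu (K :\: I)].

Definition cscale (c : R[i]) (lam : cov) : cov := [ffun I => c * lam I].

Definition cov1 : cov := [ffun I => (I == finset.set0)%:R].
Definition covg (a : gen n) : cov := [ffun I => (I == [set a]%SET)%:R].

Definition wedge_pow (lam : cov) (k : nat) : cov := iter k (wedge lam) cov1.

(* i alpha /\ \bar alpha, with alpha = \sum_j alpha_j dz_j *)
Definition ialpha (alpha : 'rV[R[i]]_n) : cov :=
  cscale 'i (wedge (\sum_j cscale (alpha 0 j) (covg (j, false)))
                   (\sum_j cscale ((alpha 0 j)^*) (covg (j, true)))).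

Definition strongly_positive (p : nat) (lam : cov) : Prop :=
  exists (m : nat) (c : 'I_m -> R) (alpha : 'I_m -> 'I_p -> 'rV[R[i]]_n),
    (forall k, 0 <= c k) /\
    lam = \sum_k cscale (c k)%:C (\big[wedge/cov1]_(j < p) ialpha (alpha k j)).

Definition of_bidegree (p q : nat) (lam : cov) : Prop :=
  forall I, lam I != 0 ->
    #|[pred a in I | ~~ a.2]| = p /\ #|[pred a in I | a.2]| = q.

End ExteriorAlgebra.
Arguments cov R n : clear implicits.

Definition dform (R : realType) (n : nat) := 'CV[R]_n -> cov R n.

Section Forms.
Context {R : realType} {n : nat}.
Implicit Types (U : set 'CV[R]_n) (phi psi : dform R n).

Definition fform (f : 'CV[R]_n -> R) : dform R n :=
  fun z => cscale (f z)%:C cov1.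

Definition smooth_form U phi := forall I, csmooth_on U (fun z => phi z I).

Definition fwedge phi psi : dform R n := fun z => wedge (phi z) (psi z).

Definition wirtinger_form (a : gen n) phi : dform R n :=
  fun z => [ffun I => wirtinger a (fun w => phi w I) z].

Definition del phi : dform R n :=
  fun z => \sum_j wedge (covg (j, false)) (wirtinger_form (j, false) phi z).
Definition delbar phi : dform R n :=
  fun z => \sum_j wedge (covg (j, true)) (wirtinger_form (j, true) phi z).
Definition dext phi : dform R n := fun z => del phi z + delbar phi z.
Definition ddc phi : dform R n :=
  fun z => cscale ('i / (pi : R)%:C) (del (delbar phi) z).

(* The generators being ordered as dz_1, d\bar z_1, ..., dz_n, d\bar z_n and
   dz /\ d\bar z being -2i times the area form, the volume form is
   (-2i)^-n times the product of all the generators. *)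
Definition form_int phi : R[i] :=
  (- (2 * 'i)) ^+ n * cint (fun z => phi z [set: gen n]%SET).

Definition supported_in (K : set 'CV[R]_n) phi := forall z, ~ K z -> phi z = 0.

(* Test forms on U, extended by 0 to C^n; they may mix bidegrees. *)
Definition test_form U phi :=
  smooth_form setT phi /\ exists K, [/\ compact K, K `<=` U & supported_in K phi].

End Forms.

Section Currents.
Context {R : realType} {n : nat}.
Implicit Types (U : set 'CV[R]_n) (T : dform R n -> R[i]).

(* A current on U is a functional on test forms on U; its values on other
   forms are irrelevant, and restriction to an open subset of U amounts to
   restricting the test forms. *)
Definition is_current U T :=
  (forall (c : R[i]) phi psi, test_form U phi -> test_form U psi ->
     T (fun z => cscale c (phi z) + psi z) = c * T phi + T psi) /\
  (forall K, compact K -> K `<=` U ->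
     exists (C : R) (m : nat), forall (phi : dform R n) (M : R),
       smooth_form setT phi -> supported_in K phi ->
       (forall (l : seq (gen n)) z I, (size l <= m)%N ->
          `|pderivs l (fun w => complex.Re (phi w I)) z| <= M /\
          `|pderivs l (fun w => complex.Im (phi w I)) z| <= M) ->
       `|T phi| <= (C * M)%:C).

(* bidegree (s, s), i.e. bidimension (n - s, n - s) *)
Definition current_bidegree U (s : nat) T :=
  forall p q (phi : dform R n), test_form U phi ->
    (forall z, of_bidegree p q (phi z)) ->
    ~ ((p + s = n)%N /\ (q + s = n)%N) -> T phi = 0.

(* Positivity in the sense of Lelong: test forms are pointwise in the convex
   cone generated by products of forms i alpha /\ \bar alpha. *)
Definition positive_current U (s : nat) T :=
  forall phi, test_form U phi ->
    (forall z, strongly_positive (n - s) (phi z)) -> 0 <= T phi.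

Definition closed_current U T :=
  forall phi, test_form U phi -> T (dext phi) = 0.

(* Up to the choice of a norm on covectors, this is the mass of T on U. *)
Definition bounded_mass U T :=
  exists M : R, forall phi, test_form U phi ->
    (forall z I, `|phi z I| <= 1) -> `|T phi| <= M%:C.

Definition smooth_current U T :=
  exists omega : dform R n, smooth_form U omega /\
    forall phi, test_form U phi -> T phi = form_int (fwedge omega phi).

Definition exhausting_cutoffs U (rho : nat -> 'CV[R]_n -> R) :=
  (forall k, smooth_on setT (rho k) /\ (forall z, 0 <= rho k z <= 1) /\
     exists K, [/\ compact K, K `<=` U & forall z, ~ K z -> rho k z = 0]) /\
  (forall K, compact K -> K `<=` U ->
     \forall k \near \oo, forall z, K z -> rho k z = 1).

(* A current of bounded mass on U has finite measures as coefficients, hence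
   integrates every bounded smooth form Phi on U, even without compact support:
   <T, Phi> is the limit of <T, rho_k Phi> for cutoffs rho_k increasing to the
   whole of U. *)
Definition pairing U T (Phi : dform R n) : R[i] :=
  xget 0 [set l : R[i] | forall rho, exhausting_cutoffs U rho ->
    (T (fun z => cscale (rho k z)%:C (Phi z)) : R[i]^o) @[k --> \oo]
      --> (l : R[i]^o)].

End Currents.

Section Transform.
Context {R : realType} {n : nat}.

Definition gl (a : gen n) : gen (n + n) := (lshift n a.1, a.2).
Definition gr (a : gen n) : gen (n + n) := (rshift n a.1, a.2).

(* pi_2^* phi; no sign occurs since gr is increasing *)
Definition pullback2 (phi : dform R n) : dform R (n + n) :=
  fun p => [ffun J : {set gen (n + n)} =>
    let I := gr @^-1: J in if gr @: I == J then phi (pr_y p) I else 0].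

(* Integration along the fibres of pi_1: no sign occurs since the generators of
   the x factor come before those of the y factor. *)
Definition pushforward1 (Omega : dform R (n + n)) : dform R n :=
  fun x => [ffun I : {set gen n} => (- (2 * 'i)) ^+ n *
    cint (fun y => Omega (pairCV x y) ((gl @: I) :|: (gr @: [set: gen n]%SET)))].

Definition convexifier (chi : R -> R) :=
  (forall k (t : R), derivable (derive1n k chi) t 1) /\
  [/\ convex_function [set: R^o] chi, {homo chi : s t / s <= t},
      forall t : R, 0 <= chi t,
      forall t : R, t <= -1 -> chi t = 0 & forall t : R, 1 <= t -> chi t = t].

Definition logmod (theta : R[i]) : R := ln (complex.Re `|theta|).

(* ln 0 = 0 in the library: the value of u on the diagonal is irrelevant *)
Definition u_ker (p : 'CV[R]_(n + n)) : R := ln (eucl (pr_x p - pr_y p)).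

(* On the diagonal u is -infinity, where chi vanishes. *)
Definition u_theta (chi : R -> R) (theta : R[i]) (p : 'CV[R]_(n + n)) : R :=
  if pr_x p == pr_y p then logmod theta
  else chi (u_ker p - logmod theta) + logmod theta.

(* dd^c u_theta vanishes near the diagonal, the only place where u is singular. *)
Definition K_theta (chi : R -> R) (theta : R[i]) : dform R (n + n) :=
  fun p => wedge (ddc (fform (u_theta chi theta)) p)
                 (wedge_pow (ddc (fform u_ker) p) n.-1).

(* <L(S), phi>, the integral over D x D of pi_1^* S /\ pi_2^* phi /\ K_theta.
   Here pi_1^* S evaluates a form on its integral along the fibres of pi_1, and
   the fibre D may be replaced by C^n since phi vanishes outside D. *)
Definition transform (chi : R -> R) (D : set 'CV[R]_n) (theta : R[i])
    (S : dform R n -> R[i]) : dform R n -> R[i] :=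
  fun phi => pairing D S
    (pushforward1 (fwedge (pullback2 phi) (K_theta chi theta))).

End Transform.

(* Main.v *)
(* Since [u] depends only on [s = |x - y|^2], both factors of the kernel are combinations of
   [beta = ddbar s] and of [tau = del s /\ delbar s], and [tau /\ tau = 0]; expanding, the
   kernel is a function of [s] times [beta ^ n], that is, times the product of all the
   [d(x_j - y_j)] and their conjugates. Integrating along the fibres therefore convolves the
   coefficients of [phi] with a nonnegative radial function [kern], supported in
   [|z| <= e |theta|] and of total mass 1, so that [<L(S), phi> = <S, kern * phi>].
   Convolution commutes with [d], preserves bidegrees and converges uniformly as
   [theta -> 0]. Approximating it uniformly by Riemann sums [sum_i w_i phi(y_i) kern(x - y_i)]
   gives positivity, and Fubini: [L(S)] is the form with coefficients
   [y |-> <S, kern(. - y) e_I>]. A current of bounded mass pairs with forms that are not compactly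
   supported in [D] because its finite mass cannot accumulate at the boundary. *)
From HB Require Import structures.
From mathcomp Require Import all_boot all_order all_algebra.
From mathcomp Require Import all_classical all_reals all_analysis.
From mathcomp Require Import complex ring lra zify measurable_realfun.
Require Import Defs.

Set Implicit Arguments.
Unset Strict Implicit.
Unset Printing Implicit Defensive.

Import Order.TTheory GRing.Theory Num.Theory numFieldNormedType.Exports.

Local Open Scope classical_set_scope.
Local Open Scope ring_scope.
Local Open Scope complex_scope.

Local Notation Re := complex.Re.
Local Notation Im := complex.Im.

(** * Exterior algebra of covectors *)

Section ExteriorRing.
Import boot.finset.
Context {R : realType} {n : nat}.
Implicit Types (I J K L : {set gen n}) (x y z : cov R n).

(** The integrals of the statement are iterated one-variable integrals, so linearity, monotonicity
    and the exchange with a functional all have to be earned. They are drawn from one property,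
    [rapprox]: for a given support radius and mesh, a single weighted sum with nonnegative weights
    and bounded total weight approximates the integrals of all functions at once, with an error
    governed by their modulus of continuity. The kernel is a multiple of chi''(log|z| - log|theta|)
    / |z|^(2n). Only chi'' survives because dd^c log|x - y| is degenerate in the radial direction,
    which cancels the chi' terms of the product; convexity makes the result nonnegative, and the
    mass is 1 because chi' rises from 0 to 1. [pairing] quantifies over all exhausting cutoffs, so
    its value is meaningful only once some exist. They are built by mollifying a truncated distance
    to the complement of D with the same kernel, at radii 1/(k+1). *)

Definition wsign I J : R[i] :=
  if [disjoint I & J]%B then (-1) ^+ inversions I J else 0.

Lemma setU_setD I K : I \subset K -> I :|: (K :\: I) = K.
Proof. by move=> IK; rewrite setDE setUIr setUCr setIT (setUidPr IK). Qed.

Lemma disjoint_setD I K : [disjoint I & K :\: I]%B.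
Proof. by rewrite -setI_eq0 setIDA [I :&: K]setIC -setIDA setDv setI0. Qed.

(** Extending the sign by 0 to overlapping pairs frees both indices; sums of this shape can be
    exchanged and regrouped, which the sum over subsets of [K] resists. *)
Lemma wedge_sumE x y K : wedge x y K =
  \sum_I \sum_J (if I :|: J == K then wsign I J * x I * y J else 0).
Proof.
rewrite ffunE big_mkcond /=; apply: eq_bigr => I _.
rewrite inE; case: ifPn => [IK|nIK].
- have -> : K :\: I = K :\: I :> {set gen n} by [].
  have e1 := setU_setD IK; have e2 := disjoint_setD I K.
  rewrite (bigD1 (K :\: I)) //= e1 eqxx /wsign e2 big1 ?addr0// => J /eqP Jn.
  case: eqP => // IJ; case: ifPn; rewrite ?mul0r // => dIJ.
  case: Jn; rewrite -IJ setDUl setDv set0U.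
  by apply/esym/setDidPl; rewrite disjoint_sym.
- rewrite big1 // => J _; case: eqP => // IJ; case/negP: nIK.
  by rewrite -IJ; apply: subsetUl.
Qed.

Lemma inversionsE I J : inversions I J = (\sum_(a in I) \sum_(b in J) glt b a)%N.
Proof.
rewrite /inversions -sum1_card pair_big_dep /= big_mkcond /= [RHS]big_mkcond /=.
apply: eq_bigr => -[a b] _ /=; rewrite !inE /=.
by do ! case: (_ \in _); case: (glt _ _).
Qed.

Lemma setU_diffl I J : [disjoint I & J]%B -> (I :|: J) :\: I = J.
Proof.
by move=> dIJ; rewrite setDUl setDv set0U; apply/setDidPl; rewrite disjoint_sym.
Qed.

Lemma big_disjointU (V : nmodType) I J (F : gen n -> V) : [disjoint I & J]%B ->
  \sum_(a in I :|: J) F a = \sum_(a in I) F a + \sum_(a in J) F a.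
Proof.
move=> dIJ; rewrite (big_setID I) /= setU_diffl //.
by have -> : (I :|: J) :&: I = I by apply/setIidPr; apply: subsetUl.
Qed.

Lemma inversionsUl I J L : [disjoint I & J]%B ->
  inversions (I :|: J) L = (inversions I L + inversions J L)%N.
Proof. by move=> dIJ; rewrite !inversionsE; apply: (@big_disjointU nat). Qed.

Lemma inversionsUr I J L : [disjoint J & L]%B ->
  inversions I (J :|: L) = (inversions I J + inversions I L)%N.
Proof.
move=> dJL; rewrite !inversionsE -big_split /=; apply: eq_bigr => a _.
exact: (@big_disjointU nat).
Qed.

Lemma disjointUl I J L :
  [disjoint I :|: J & L]%B = [disjoint I & L]%B && [disjoint J & L]%B.
Proof. by rewrite -!setI_eq0 setIUl setU_eq0. Qed.

(** The cocycle identity behind associativity: for pairwise disjoint sets both sides count the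
    inversions of the pairs (I, J), (I, L) and (J, L), and otherwise both vanish. *)
Lemma wsignA I J L : wsign I J * wsign (I :|: J) L = wsign J L * wsign I (J :|: L).
Proof.
rewrite /wsign disjointUl [[disjoint I & J :|: L]%B]disjoint_sym disjointUl.
rewrite [[disjoint J & I]%B]disjoint_sym [[disjoint L & I]%B]disjoint_sym.
case: (boolP [disjoint I & J]%B) => dIJ; case: (boolP [disjoint J & L]%B) => dJL;
  case: (boolP [disjoint I & L]%B) => dIL //=; rewrite ?mul0r ?mulr0//.
by rewrite inversionsUl // inversionsUr // !exprD; ring.
Qed.

Lemma sum_setU_collapse (G : {set gen n} -> R[i]) (F : {set gen n} -> {set gen n} -> R[i]) :
  \sum_A G A * (\sum_I \sum_J (if I :|: J == A then F I J else 0)) =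
  \sum_I \sum_J G (I :|: J) * F I J.
Proof.
under eq_bigr => A _ do rewrite mulr_sumr; rewrite exchange_big; apply: eq_bigr => I _.
under eq_bigr => A _ do rewrite mulr_sumr; rewrite exchange_big; apply: eq_bigr => J _ /=.
rewrite (bigD1 (I :|: J)) //= eqxx big1 ?addr0 // => A nA.
by rewrite eq_sym (negPf nA) mulr0.
Qed.

Lemma wedge_trilinE x y z K : wedge (wedge x y) z K =
  \sum_I \sum_J \sum_L (if I :|: J :|: L == K then
     wsign I J * wsign (I :|: J) L * (x I * y J * z L) else 0).
Proof.
rewrite wedge_sumE exchange_big /=.
under [RHS]eq_bigr => I _ do rewrite exchange_big /=.
rewrite [RHS]exchange_big /=; apply: eq_bigr => L _.
rewrite (eq_bigr (fun A => (if A :|: L == K then wsign A L * z L else 0) * wedge x y A)) => [|A _].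
  under eq_bigr => A _ do rewrite wedge_sumE.
  rewrite sum_setU_collapse; apply: eq_bigr => I _; apply: eq_bigr => J _.
  by case: ifP => _; rewrite ?mul0r //; ring.
by case: ifP => _; rewrite ?mul0r //; ring.
Qed.

Lemma wedge_trilinE' x y z K : wedge x (wedge y z) K =
  \sum_I \sum_J \sum_L (if I :|: J :|: L == K then
     wsign J L * wsign I (J :|: L) * (x I * y J * z L) else 0).
Proof.
rewrite wedge_sumE; apply: eq_bigr => I _.
rewrite (eq_bigr (fun A => (if I :|: A == K then wsign I A * x I else 0) * wedge y z A)) => [|A _].
  under eq_bigr => A _ do rewrite wedge_sumE.
  rewrite sum_setU_collapse; apply: eq_bigr => J _; apply: eq_bigr => L _; rewrite setUA.
  by case: ifP => _; rewrite ?mul0r //; ring.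
by case: ifP => _; rewrite ?mul0r.
Qed.

Lemma wedgeA x y z : wedge x (wedge y z) = wedge (wedge x y) z.
Proof.
apply/ffunP => K; rewrite wedge_trilinE wedge_trilinE'.
apply: eq_bigr => I _; apply: eq_bigr => J _; apply: eq_bigr => L _.
by rewrite wsignA.
Qed.

Lemma wedgeDl x y z : wedge (x + y) z = wedge x z + wedge y z.
Proof.
apply/ffunP => K; rewrite !ffunE -big_split /=; apply: eq_bigr => I _.
by rewrite !ffunE; ring.
Qed.

Lemma wedgeDr x y z : wedge z (x + y) = wedge z x + wedge z y.
Proof.
apply/ffunP => K; rewrite !ffunE -big_split /=; apply: eq_bigr => I _.
by rewrite !ffunE; ring.
Qed.

Lemma wedge_scalel c x y : wedge (cscale c x) y = cscale c (wedge x y).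
Proof.
apply/ffunP => K; rewrite !ffunE mulr_sumr; apply: eq_bigr => I _.
by rewrite !ffunE; ring.
Qed.

Lemma wedge_scaler c x y : wedge x (cscale c y) = cscale c (wedge x y).
Proof.
apply/ffunP => K; rewrite !ffunE mulr_sumr; apply: eq_bigr => I _.
by rewrite !ffunE; ring.
Qed.

Definition bas I : cov R n := [ffun J => (J == I)%:R].

Lemma wedge_basl I x K : wedge (bas I) x K =
  if I \subset K then (-1) ^+ inversions I (K :\: I) * x (K :\: I) else 0.
Proof.
rewrite ffunE; case: ifPn => IK; last first.
  rewrite big1 // => J; rewrite inE ffunE => JK; case: eqP => [JI|_].
    by rewrite -JI JK in IK.
  by rewrite mulr0 mul0r.
rewrite (bigD1 I) ?inE //= ffunE eqxx mulr1 big1 ?addr0 // => J /andP[_ /negPf nJ].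
by rewrite ffunE nJ mulr0 mul0r.
Qed.

Lemma inversions0 I : inversions I set0 = 0%N.
Proof. by rewrite inversionsE big1 // => a _; rewrite big_set0. Qed.

Lemma inversions0l I : inversions set0 I = 0%N.
Proof. by rewrite inversionsE big_set0. Qed.

Lemma wedge1l x : wedge cov1 x = x.
Proof.
apply/ffunP => K; have -> : cov1 = bas set0 :> cov R n by apply/ffunP => I; rewrite !ffunE.
by rewrite wedge_basl sub0set setD0 inversions0l mul1r.
Qed.

Lemma wedge1r x : wedge x cov1 = x.
Proof.
apply/ffunP => K; rewrite ffunE (bigD1 K) ?inE //= setDv inversions0 ffunE eqxx.
rewrite mul1r mulr1 big1 ?addr0 // => I; rewrite inE => /andP[IK nIK].
rewrite ffunE setD_eq0; case: (boolP (K \subset I)) => [KI|]; last by rewrite mulr0.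
by case/eqP: nIK; apply/eqP; rewrite eqEsubset IK.
Qed.

Lemma cov1_neq0 : cov1 != 0 :> cov R n.
Proof.
by apply/eqP => /ffunP /(_ set0); rewrite !ffunE eqxx => /eqP; rewrite oner_eq0.
Qed.

End ExteriorRing.

(* [cov] already carries the pointwise product of functions, hence the alias. *)
Definition ext (R : realType) (n : nat) : Type := cov R n.

HB.instance Definition _ (R : realType) (n : nat) := GRing.Zmodule.on (ext R n).

Section ExteriorAlgebraStructure.
Context {R : realType} {n : nat}.

HB.instance Definition _ := GRing.Zmodule_isNzRing.Build (ext R n)
  (@wedgeA R n) (@wedge1l R n) (@wedge1r R n)
  (fun x y z => @wedgeDl R n x y z) (fun x y z => @wedgeDr R n y z x) (@cov1_neq0 R n).

Lemma cscaleA (a b : R[i]) (x : ext R n) : cscale a (cscale b x) = cscale (a * b) x :> ext R n.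
Proof. by apply/ffunP => I; rewrite !ffunE mulrA. Qed.
Lemma cscale1 : left_id 1 (@cscale R n).
Proof. by move=> x; apply/ffunP => I; rewrite !ffunE mul1r. Qed.
Lemma cscaleDr (a : R[i]) (x y : ext R n) :
  cscale a (x + y) = (cscale a x : ext R n) + (cscale a y : ext R n).
Proof. by apply/ffunP => I; rewrite !ffunE mulrDr. Qed.
Lemma cscaleDl (x : ext R n) (a b : R[i]) :
  cscale (a + b) x = (cscale a x : ext R n) + (cscale b x : ext R n).
Proof. by apply/ffunP => I; rewrite !ffunE mulrDl. Qed.

HB.instance Definition _ := GRing.Zmodule_isLmodule.Build R[i] (ext R n)
  cscaleA cscale1 cscaleDr cscaleDl.

HB.instance Definition _ := GRing.Lmodule_isLalgebra.Build R[i] (ext R n)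
  (fun c x y => esym (wedge_scalel c x y)).
HB.instance Definition _ := GRing.Lalgebra_isAlgebra.Build R[i] (ext R n)
  (fun c x y => esym (wedge_scaler c x y)).

Lemma wedge_powE (x : ext R n) k : wedge_pow x k = x ^+ k.
Proof. by elim: k => [|k IH] //=; rewrite exprS /wedge_pow /= -/(wedge_pow x k) IH. Qed.
End ExteriorAlgebraStructure.

(** * Homogeneous covectors and graded commutativity *)

Section HomogeneousCovectors.
Import boot.finset.
Context {R : realType} {n : nat}.
Implicit Types (I J K L : {set gen n}) (x y z : ext R n).

Definition hom d x := forall K, x K != 0 -> #|K| = d.

Definition gx (a : gen n) : ext R n := covg a.

Lemma extM x y : x * y = wedge x y. Proof. by []. Qed.

Lemma extZE c x K : (c *: x) K = c * x K.
Proof. by rewrite [LHS](ffunE (fun I => c * x I)). Qed.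

Lemma hom_coef0 d x K : hom d x -> #|K| != d -> x K = 0.
Proof. by move=> hx; apply: contraNeq => /hx ->. Qed.

Lemma homM d e x y : hom d x -> hom e y -> hom (d + e) (x * y).
Proof.
move=> hx hy K; apply: contraNeq => Kde; rewrite extM ffunE big1 // => I; rewrite inE => IK.
case: (eqVneq #|I| d) => [Id|/(hom_coef0 hx)->]; last by rewrite mulr0 mul0r.
rewrite [y _](hom_coef0 hy) ?mulr0 //; apply: contra Kde => /eqP Kie.
by rewrite -Kie -Id cardsD (setIidPr IK) subnKC // subset_leq_card.
Qed.

Lemma homX d x k : hom d x -> hom (k * d) (x ^+ k).
Proof.
move=> hx; elim: k => [|k IH]; last by rewrite exprS mulSn; apply: homM.
move=> K; rewrite expr0 [1 in X in X -> _](_ : _ = cov1 :> cov R n) // ffunE.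
by case: (eqVneq K set0) => [->|_]; rewrite ?cards0 // eqxx.
Qed.

Lemma hom_sum (T : finType) (P : pred T) d (F : T -> ext R n) :
  (forall a, P a -> hom d (F a)) -> hom d (\sum_(a | P a) F a).
Proof.
move=> hF K; apply: contraNeq => Kd.
have -> : (\sum_(a | P a) F a) K = \sum_(a | P a) F a K by rewrite sum_ffunE.
by rewrite big1 // => a Pa; apply: hom_coef0 (hF _ Pa) _.
Qed.

Lemma homB d x y : hom d x -> hom d y -> hom d (x - y).
Proof.
move=> hx hy K; apply: contraNeq => Kd.
have -> : (x - y) K = x K - y K by rewrite !ffunE.
by rewrite (hom_coef0 hx) // (hom_coef0 hy) // subr0.
Qed.

Lemma homZ d c x : hom d x -> hom d (c *: x).
Proof.
move=> hx K; apply: contraNeq => Kd.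
by rewrite extZE (hom_coef0 hx) // mulr0.
Qed.

Lemma covg_bas a : covg a = bas [set a] :> cov R n.
Proof. by apply/ffunP => J; rewrite !ffunE. Qed.

Lemma hom_gx a : hom 1 (gx a).
Proof. by move=> K; rewrite ffunE; case: (eqVneq K [set a]) => [->|_]; rewrite ?cards1 // eqxx. Qed.

Lemma hom1E x : hom 1 x -> x = \sum_a x [set a] *: gx a.
Proof.
move=> hx; apply/ffunP => K; rewrite sum_ffunE.
under eq_bigr => a _ do
  rewrite extZE [gx a K]ffunE.
case: (boolP (#|K| == 1%N)) => [/cards1P[a ->]|K1].
  rewrite (bigD1 a) //= eqxx mulr1 big1 ?addr0 // => b ba.
  by rewrite eqEcard !cards1 sub1set inE eq_sym (negPf ba) mulr0.
rewrite (hom_coef0 hx K1) big1 // => a _; case: eqP => [Ka|_]; last by rewrite mulr0.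
by rewrite Ka cards1 in K1.
Qed.

Lemma glt_total (a b : gen n) : a != b -> glt a b = ~~ glt b a.
Proof.
move=> ab; rewrite /glt -leqNgt ltn_neqAle; case: eqP => //= e; case/eqP: ab.
case: a b e => [a ba] [b bb] /= e.
have e2 : ba = bb by move/(congr1 odd): e; rewrite !oddD !odd_double /=; case: ba bb => -[].
by rewrite e2 in e *; congr pair; apply/val_inj; apply: double_inj; apply/eqP; rewrite -(eqn_add2r bb) e.
Qed.

Lemma inversions11 (a b : gen n) : inversions [set a] [set b] = glt b a :> nat.
Proof. by rewrite inversionsE !big_set1. Qed.

Lemma wedge_bas I J : wedge (bas I) (bas J) = cscale (wsign I J) (bas (I :|: J)) :> cov R n.
Proof.
apply/ffunP => K; rewrite wedge_basl !ffunE /wsign; case: ifPn => [IK|nIK].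
  case: (eqVneq (K :\: I) J) => KIJ.
    have -> : K = I :|: J by rewrite -KIJ setU_setD.
    have dIJ : [disjoint I & J]%B by rewrite -KIJ disjoint_setD.
    by rewrite setU_diffl // dIJ eqxx.
  rewrite mulr0; case: ifPn => dIJ; rewrite ?mul0r //.
  case: (eqVneq K (I :|: J)) => [KE|]; last by rewrite mulr0.
  by rewrite KE setU_diffl ?eqxx in KIJ.
case: (eqVneq K (I :|: J)) => [KE|]; last by rewrite mulr0.
by rewrite KE subsetUl in nIK.
Qed.

Lemma gx_anticomm (a b : gen n) : gx a * gx b = - (gx b * gx a).
Proof.
rewrite !extM /gx !covg_bas !wedge_bas /wsign !inversions11 !disjoints1 !in_set1 [b == a]eq_sym.
case: (eqVneq a b) => [->|ab]; first by apply/ffunP => K; rewrite !ffunE /=; ring.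
rewrite /= (glt_total ab) [[set b] :|: _]setUC.
by case: (glt b a); apply/ffunP => K; rewrite !ffunE /= ?expr0 ?expr1; ring.
Qed.

Lemma hom1_anticomm x y : hom 1 x -> hom 1 y -> x * y = - (y * x).
Proof.
move=> /hom1E -> /hom1E ->; rewrite mulr_suml mulr_sumr -sumrN.
apply: eq_bigr => a _; rewrite mulr_sumr mulr_suml -sumrN.
apply: eq_bigr => b _; rewrite -2!scalerAl -2!scalerAr (gx_anticomm a b) !scalerN !scalerA.
by congr (- (_ *: _)); exact: mulrC.
Qed.

Lemma hom1_sqr0 x : hom 1 x -> x * x = 0.
Proof.
move=> hx; have /eqP := hom1_anticomm hx hx; rewrite -addr_eq0 => /eqP e.
have : (2 : R[i]) *: (x * x) = 0 by rewrite scaler_nat mulr2n.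
by move/(congr1 (fun z => 2^-1 *: z)); rewrite scalerA mulVf ?scale1r ?scaler0 // pnatr_eq0.
Qed.

(** Moving [z] past [x] and past [y] costs one sign each. *)
Lemma hom1_commM x y z : hom 1 x -> hom 1 y -> hom 1 z -> GRing.comm (x * y) z.
Proof.
move=> hx hy hz; have yz := hom1_anticomm hy hz; have xz := hom1_anticomm hx hz.
by rewrite /GRing.comm -mulrA yz mulrN [x * (z * y)]mulrA xz mulNr opprK -mulrA.
Qed.

End HomogeneousCovectors.

(** * Powers of sums of commuting elements of square zero *)

Section CommutingNilpotents.
Variables (A : pzRingType) (T : finType) (e : T -> A).
Hypothesis ecomm : forall j k, GRing.comm (e j) (e k).
Hypothesis esqr : forall j, e j * e j = 0.

Definition nsum (P : {set T}) := \sum_(j in P) e j.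

Lemma comm_nsum j P : GRing.comm (e j) (nsum P).
Proof. by apply: commr_sum => k _; apply: ecomm. Qed.

(** The binomial expansion stops after the term linear in [x]. *)
Lemma exprS_sqr0 (x y : A) m : GRing.comm x y -> x * x = 0 ->
  (x + y) ^+ m.+1 = y ^+ m.+1 + (x * y ^+ m) *+ m.+1.
Proof.
move=> cxy x0; elim: m => [|m IH]; first by rewrite !expr1 expr0 mulr1 addrC.
rewrite exprS IH mulrDl mulrDr mulrDr -exprS.
rewrite -mulrnAr mulrA mulrnAr x0 mul0r mul0rn addr0.
rewrite -mulrnAr [y * (x * _)]mulrA -cxy -mulrA mulrnAr -exprS.
by rewrite addrCA -mulrDr -mulrS.
Qed.

Lemma nsum_split j (P : {set T}) : j \in P -> nsum P = e j + nsum (P :\ j)%SET.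
Proof. by move=> jP; rewrite /nsum (big_setD1 j). Qed.

(** A product of m+1 factors chosen among m commuting elements repeats one of them, and each squares
    to 0. *)
Lemma nsum_nilp m (P : {set T}) : #|P| = m -> nsum P ^+ m.+1 = 0.
Proof.
elim: m P => [|m IH] P.
  by move/eqP; rewrite cards_eq0 => /eqP ->; rewrite /nsum big_set0 expr0n.
move=> Pm; have /set0Pn[j jP] : P != finset.set0 by rewrite -cards_eq0 Pm.
rewrite (nsum_split jP).
have Pj : #|(P :\ j)%SET| = m by have := cardsD1 j P; rewrite jP Pm add1n => -[].
rewrite exprS_sqr0 //; last exact: comm_nsum.
by rewrite exprS IH // mulr0 mulr0 mul0rn addr0.
Qed.

Lemma kill_exp (x y z : A) m : x * y = 0 -> GRing.comm y z -> x * (y + z) ^+ m = x * z ^+ m.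
Proof.
move=> xy cyz; elim: m => [|m IH] //.
by rewrite exprSr mulrA IH -mulrA mulrDr -commrX // mulrDr mulrA xy mul0r add0r -exprSr.
Qed.

(** Both sides are m! times the product of all [e i] with i in [P]. It is enough to split off two
    indices: the expression obtained in [step] is symmetric in them. *)
Lemma mul_nsum_swap (P : {set T}) m j k : #|P| = m.+1 -> j \in P -> k \in P ->
  e j * nsum P ^+ m = e k * nsum P ^+ m.
Proof.
case: m => [|m] Pm jP kP.
  by move/eqP: Pm => /cards1P[a Pa]; move: jP kP; rewrite Pa !inE => /eqP -> /eqP ->.
case: (eqVneq j k) => [->//|jk].
have step a b : a \in P -> b \in P -> a != b ->
  e a * nsum P ^+ m.+1 = e a * (e b * nsum ((P :\ a) :\ b)%SET ^+ m) *+ m.+1.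
  move=> aP bP ab; rewrite (nsum_split aP) kill_exp //; last exact: comm_nsum.
  have bPa : b \in (P :\ a)%SET by rewrite !inE eq_sym ab.
  rewrite (nsum_split bPa) exprS_sqr0 //; last exact: comm_nsum.
  rewrite [X in X + _](_ : _ = 0) ?add0r ?mulrnAr //.
  apply: nsum_nilp; have := cardsD1 b (P :\ a)%SET; have := cardsD1 a P.
  by rewrite aP bPa Pm !add1n => -[] <- [].
rewrite (step j k) // (step k j) // 1?eq_sym // !mulrA ecomm.
by rewrite finset.setDDl finset.setDDl finset.setUC.
Qed.

End CommutingNilpotents.

(** * The covectors d(x_j - y_j) and the coefficient read along the fibres *)

Section FibreCoefficient.
Import boot.finset.
Context {R : realType} {n : nat}.
Implicit Types (I J K : {set gen n}) (P Q : {set 'I_n}).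

Local Notation A := (ext R (n + n)).

Lemma gl_inj : injective (@gl n).
Proof.
move=> [a b] [c d] /eqP; rewrite xpair_eqE (inj_eq (@lshift_inj _ _)).
by case/andP => /eqP /= -> /eqP ->.
Qed.

Lemma gr_inj : injective (@gr n).
Proof.
move=> [a b] [c d] /eqP; rewrite xpair_eqE (inj_eq (@rshift_inj _ _)).
by case/andP => /eqP /= -> /eqP ->.
Qed.

Lemma preim_gr I : gr @^-1: (gr @: I) = I.
Proof. by apply/setP => a; rewrite inE mem_imset //; exact: gr_inj. Qed.

Lemma gl_gr a b : gl a != gr b :> gen (n + n).
Proof. by rewrite /gl /gr xpair_eqE eq_lrshift. Qed.

Lemma gl_notin_gr a I : (gl a \in gr @: I) = false.
Proof. by apply/imsetP => -[b _ /eqP]; rewrite (negPf (gl_gr _ _)). Qed.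

Lemma glt_gr (a b : gen n) : glt (gr a) (gr b) = glt a b.
Proof. by rewrite /glt /= !doubleD -!addnA ltn_add2l. Qed.

Lemma glt_grgl (a b : gen n) : glt (gr b) (gl a) = false.
Proof.
apply/negbTE; rewrite /glt /= -leqNgt doubleD -addnA; case: a b => [[a ha] ba] [[b hb] bb] /=.
apply: (@leq_trans (n.*2)); last exact: leq_addr.
case: ba => /=; last by rewrite addn0 leq_double ltnW.
by rewrite addn1 ltn_double.
Qed.

Lemma inversions_gl I J : inversions (gl @: I) (gl @: J) = inversions I J.
Proof.
rewrite !inversionsE big_imset /=; last by move=> ? ? _ _; apply: gl_inj.
by apply: eq_bigr => a _; rewrite big_imset //= => ? ? _ _; apply: gl_inj.
Qed.

Lemma inversions_gr I J : inversions (gr @: I) (gr @: J) = inversions I J.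
Proof.
rewrite !inversionsE big_imset /=; last by move=> ? ? _ _; apply: gr_inj.
apply: eq_bigr => a _; rewrite big_imset /=; last by move=> ? ? _ _; apply: gr_inj.
by apply: eq_bigr => b _; rewrite glt_gr.
Qed.

Lemma inversions_glgr I J : inversions (gl @: I) (gr @: J) = 0%N.
Proof.
rewrite inversionsE big1 // => a /imsetP[a' _ ->]; rewrite big1 // => b /imsetP[b' _ ->].
by rewrite glt_grgl.
Qed.

(** The pullback of the generator [a] under (x, y) -> x - y, that is, d(x_j - y_j) or its
    conjugate. *)
Definition eta (a : gen n) : A := gx (gl a) - gx (gr a).

Lemma hom_eta a : hom 1 (eta a).
Proof. by apply: homB; apply: hom_gx. Qed.
Arguments hom_eta : clear implicits.

Definition eta2 (j : 'I_n) : A := eta (j, false) * eta (j, true).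

Lemma hom_eta2 j : hom 2 (eta2 j).
Proof. by rewrite -[2%N]/(1 + 1)%N; apply: homM; apply: hom_eta. Qed.

Lemma eta2_comm1 j x : hom 1 x -> GRing.comm (eta2 j) x.
Proof. by move=> hx; apply: hom1_commM => //; apply: hom_eta. Qed.

Lemma eta2_comm j k : GRing.comm (eta2 j) (eta2 k).
Proof. by apply: commrM; apply: eta2_comm1; apply: hom_eta. Qed.

Lemma eta_eta2 j b : eta (j, b) * eta2 j = 0.
Proof.
case: b; last by rewrite /eta2 mulrA hom1_sqr0 ?mul0r //; apply: hom_eta.
rewrite -(eta2_comm1 j (hom_eta _)) /eta2 -mulrA hom1_sqr0 ?mulr0 //; exact: hom_eta.
Qed.

Lemma eta2_sqr j : eta2 j * eta2 j = 0.
Proof. by rewrite {1}/eta2 -mulrA eta_eta2 mulr0. Qed.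

Definition beta : A := \sum_j eta2 j.

Lemma betaE : beta = nsum eta2 [set: 'I_n].
Proof. by apply: eq_bigl => j; rewrite inE. Qed.

Lemma hom_beta : hom 2 beta.
Proof. by apply: hom_sum => j _; apply: hom_eta2. Qed.

Lemma beta_comm1 x : hom 1 x -> GRing.comm beta x.
Proof. by move=> hx; apply/commr_sym/commr_sum => j _; apply/commr_sym/eta2_comm1. Qed.

Lemma cardT_ord : #|[set: 'I_n]| = n.
Proof. by rewrite cardsT card_ord. Qed.

Lemma card_setT1 j : #|[set: 'I_n] :\ j| = n.-1.
Proof.
by have := cardT_ord; rewrite (cardsD1 j) finset.in_setT add1n => /(congr1 predn).
Qed.

(** [beta ^+ n] is a multiple of the product of all the [eta], hence is killed by each of them. In
    the computation, [eta a] kills the summand [eta2 j], and the n-th power of the n-1 remaining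
    summands vanishes. *)
Lemma eta_beta a : eta a * beta ^+ n = 0.
Proof.
case: a => j b; rewrite betaE (@nsum_split _ _ eta2 j _ (finset.in_setT _)).
rewrite kill_exp ?eta_eta2 //; last exact: comm_nsum eta2_comm _ _.
have := nsum_nilp eta2_comm eta2_sqr (card_setT1 j).
by rewrite prednK ?(leq_ltn_trans _ (ltn_ord j)) // => ->; rewrite mulr0.
Qed.

(** The products [eta2 j * beta ^+ m] are the same for all j, and they add up to [beta ^+ n]. *)
Lemma eta2_beta m j : n = m.+1 -> (eta2 j * beta ^+ m) *+ n = beta ^+ n.
Proof.
move=> nm; have -> : beta ^+ n = beta * beta ^+ m by rewrite -exprS -nm.
rewrite {2}/beta mulr_suml.
rewrite (eq_bigr (fun=> eta2 j * beta ^+ m)) ?sumr_const ?card_ord // => k _.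
by rewrite betaE (mul_nsum_swap eta2_comm eta2_sqr _ (finset.in_setT k) (finset.in_setT j)) ?cardT_ord.
Qed.

(** The mixed product kills both [eta2 j] and [eta2 k]; what remains of [beta] has n-2 summands, and
    its power n-1 is 0. *)
Lemma eta_off_beta m j k : n = m.+1 -> j != k ->
  eta (j, false) * eta (k, true) * beta ^+ m = 0.
Proof.
move=> nm jk; rewrite betaE (@nsum_split _ _ eta2 j _ (finset.in_setT _)).
have kj : k \in [set: 'I_n] :\ j by rewrite !inE eq_sym jk.
rewrite (nsum_split _ kj) addrA kill_exp.
- have c2 : #|[set: 'I_n] :\ j :\ k| = m.-1.
    have c1 := cardsD1 k ([set: 'I_n] :\ j); rewrite kj in c1.
    by have := card_setT1 j; rewrite c1 add1n => c3; have := congr1 predn nm; rewrite -c3 /= => <-.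
  have m0 : (0 < m)%N.
    rewrite lt0n; apply: contra jk => /eqP m0; apply/eqP/val_inj => /=.
    by have := ltn_ord j; have := ltn_ord k; move: nm; rewrite m0; lia.
  by rewrite -(prednK m0) (nsum_nilp eta2_comm eta2_sqr) ?mulr0.
- have kill1 : eta (j, false) * eta (k, true) * eta2 j = 0.
    rewrite -mulrA -(eta2_comm1 j (hom_eta (k, true))) mulrA eta_eta2; exact: mul0r.
  have kill2 : eta (j, false) * eta (k, true) * eta2 k = 0.
    rewrite -mulrA eta_eta2; exact: mulr0.
  by rewrite mulrDr kill1 kill2 addr0.
- by apply/commr_sym/commrD; apply/commr_sym/comm_nsum/eta2_comm.
Qed.

Section Mixed.
Variables a b : 'I_n -> R[i].

(** Used with a_j the conjugate of z_j and b_j = z_j for z = x - y, when it is del s /\ delbar s and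
    the sum of the a_j b_j is s itself. *)
Definition tau : A :=
  (\sum_j a j *: eta (j, false)) * (\sum_j b j *: eta (j, true)).

Lemma hom_lin (c : 'I_n -> R[i]) e : hom 1 (\sum_j c j *: eta (j, e)).
Proof. by apply: hom_sum => j _; apply/homZ/hom_eta. Qed.
Arguments hom_lin : clear implicits.

Lemma tau_sqr : tau * tau = 0.
Proof.
rewrite /tau; set x := \sum_j _; set y := \sum_j _.
have hx : hom 1 x by exact: hom_lin.
have hyx := hom1_anticomm (hom_lin b true) hx.
by rewrite mulrA -[x * y * x]mulrA hyx mulrN mulrA (hom1_sqr0 hx) mul0r oppr0 mul0r.
Qed.

Lemma beta_tau : GRing.comm beta tau.
Proof. by apply: commrM; apply: beta_comm1; apply: hom_lin. Qed.

(** Off-diagonal products die against [beta ^+ m], and each diagonal one gives the same share of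
    [beta ^+ n]. *)
Lemma tau_beta m : n = m.+1 ->
  (tau * beta ^+ m) *+ n = (\sum_j a j * b j) *: beta ^+ n.
Proof.
move=> nm; have -> : tau * beta ^+ m = \sum_j (a j * b j) *: (eta2 j * beta ^+ m).
  rewrite /tau !mulr_suml; apply: eq_bigr => j _.
  rewrite mulr_sumr mulr_suml (bigD1 j) //= big1 ?addr0 => [|k kj].
    by rewrite -!scalerAl -!scalerAr -!scalerAl scalerA.
  by rewrite -!scalerAl -!scalerAr -!scalerAl eta_off_beta ?scaler0 // eq_sym.
rewrite -sumrMnl scaler_suml; apply: eq_bigr => j _.
by rewrite scalerMnr (eta2_beta _ nm).
Qed.

(* [d1 * s = - d2] encodes that dd^c log|z| is degenerate in the radial direction. *)
Lemma mixed_power (c1 c2 d1 d2 : R[i]) : (0 < n)%N ->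
  d1 * (\sum_j a j * b j) = - d2 ->
  ((c1 *: tau + c2 *: beta) * (d1 *: tau + d2 *: beta) ^+ n.-1) *+ n =
  (d2 ^+ n.-1 * (c1 * (\sum_j a j * b j) + c2)) *: beta ^+ n.
Proof.
set s := \sum_j _; move=> n0; have [m nm] : exists m, n = m.+1 by case: n n0 => // m _; exists m.
have -> : n.-1 = m by rewrite nm.
move=> ds; have tb := tau_beta nm; rewrite -/s in tb.
have cTB k : tau * beta ^+ k = beta ^+ k * tau.
  by apply/esym/commr_sym/commrX/commr_sym/beta_tau.
case: m nm tb => [|m] nm tb.
  have e1 (X : A) : X *+ n = X by transitivity (X *+ 1); first by congr (_ *+ _).
  have e2 : beta ^+ n = beta by transitivity (beta ^+ 1); first by congr (_ ^+ _).
  by move: tb; rewrite !expr0 !e1 !mulr1 mul1r e2 => ->; rewrite scalerA scalerDl.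
rewrite exprS_sqr0; last 2 first.
- by rewrite /GRing.comm -!scalerAl -!scalerAr beta_tau !scalerA mulrC.
- by rewrite -scalerAl -scalerAr tau_sqr !scaler0.
rewrite !exprZn mulrDr !mulrDl -!scalerAl -!scalerAr.
have bb : beta * beta ^+ m.+1 = beta ^+ n by rewrite -exprS -nm.
have tt0 : tau * (tau * beta ^+ m) = 0 by rewrite mulrA tau_sqr mul0r.
have bt : beta * (tau * beta ^+ m) = tau * beta ^+ m.+1.
  by rewrite mulrA beta_tau -mulrA -exprS.
rewrite bb !mulrnAr -!scalerAr tt0 bt !scaler0 mul0rn !scaler0 add0r.
rewrite !mulrnDl !scalerMnr mulrnAC tb.
rewrite -[beta ^+ n *+ n]scaler_nat -[(s *: _) *+ _]scaler_nat !scalerA -!scalerDl.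
congr (_ *: _); have -> : n%:R = m.+1%:R + 1 :> R[i] by rewrite nm mulrSr.
(* Here n = m + 2. Since d1 s = - d2, this cross term removes m + 1 of the n copies of c2 d2^(m+1)
   and leaves exactly one. *)
have -> : c2 * d1 * d2 ^+ m * m.+1%:R * s = c2 * d2 ^+ m * m.+1%:R * (d1 * s) by ring.
rewrite ds exprS; ring.
Qed.

End Mixed.

Definition Xset Q : {set gen n} := [set a | a.1 \in Q].

Lemma gx_gl_coef a (x : A) I : (gx (gl a) * x) (gr @: I) = 0.
Proof.
by rewrite extM /gx covg_bas wedge_basl sub1set gl_notin_gr.
Qed.

Lemma gx_gr_coef a (x : A) I : (gx (gr a) * x) (gr @: I) =
  if a \in I then (-1) ^+ inversions [set a] (I :\ a) * x (gr @: (I :\ a)) else 0.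
Proof.
rewrite extM /gx covg_bas wedge_basl sub1set mem_imset; last exact: gr_inj.
have -> : gr @: I :\: [set gr a] = gr @: (I :\ a).
  apply/setP => b; apply/setDP/imsetP => [[/imsetP[c cI ->]]|[c]].
    by rewrite in_set1 (inj_eq gr_inj) => ca; exists c; rewrite // !inE ca.
  by case/setD1P => ca cI ->; split; rewrite ?imset_f // in_set1 (inj_eq gr_inj).
by rewrite -imset_set1 inversions_gr.
Qed.

Lemma eta_coef a (x : A) I : (eta a * x) (gr @: I) =
  if a \in I then - ((-1) ^+ inversions [set a] (I :\ a) * x (gr @: (I :\ a))) else 0.
Proof.
rewrite /eta mulrBl [LHS](_ : _ = (gx (gl a) * x) (gr @: I) - (gx (gr a) * x) (gr @: I)).
  by rewrite gx_gl_coef gx_gr_coef sub0r; case: ifP; rewrite ?oppr0.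
by rewrite !ffunE.
Qed.

(** dz_j and its conjugate are adjacent in the order of the generators, so every generator of
    another index lies on the same side of both. A pair therefore moves past anything without a
    sign. *)
Lemma inversions_pair j Q : j \notin Q ->
  inversions [set (j, false)] (Xset Q) = inversions [set (j, true)] (Xset Q).
Proof.
move=> jQ; rewrite !inversionsE !big_set1; apply: eq_bigr => -[k e] /=.
rewrite inE /= => kQ; have kj : k != j by apply: contraNneq jQ => <-.
congr (nat_of_bool _); rewrite /glt /=.
have : (k < j)%N || (j < k)%N by rewrite -neq_ltn.
by case: e => /=; move: kj; rewrite -val_eqE /=; lia.
Qed.

Lemma eta2_coef j (x : A) Q : (eta2 j * x) (gr @: Xset Q) =
  if j \in Q then x (gr @: Xset (Q :\ j)) else 0.
Proof.
rewrite /eta2 -mulrA eta_coef !inE /=; case: ifP => // jQ.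
have ne : ((j, true) == (j, false)) = false by rewrite xpair_eqE andbF.
rewrite eta_coef !inE /= jQ ne /=.
have -> : Xset Q :\ (j, false) :\ (j, true) = Xset (Q :\ j).
  by apply/setP => -[k e]; rewrite !inE /= !xpair_eqE; case: (k == j); case: e; rewrite ?andbF.
have e1 : Xset Q :\ (j, false) = (j, true) |: Xset (Q :\ j).
  apply/setP => -[k e]; rewrite !inE /= !xpair_eqE.
  by case: (eqVneq k j) => [->|]; case: e; rewrite /= ?jQ ?andbF.
have e2 : inversions [set (j, false)] (Xset Q :\ (j, false)) =
          inversions [set (j, true)] (Xset (Q :\ j)).
  rewrite e1 inversionsUr; last by rewrite disjoints1 !inE eqxx.
  rewrite inversions11 inversions_pair ?inE ?eqxx //.
  by rewrite /glt /= ltnNge leq_add2l /= .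
by rewrite e2 mulrN opprK mulrA -expr2 sqrr_sign mul1r.
Qed.

(** The first factor may use any of the m indices of [Q], and the induction hypothesis handles the
    rest. The full index set is the case of interest; general [Q] is for the induction. *)
Lemma betaX_coef m Q : #|Q| = m -> (beta ^+ m) (gr @: Xset Q) = m`!%:R.
Proof.
elim: m Q => [|m IH] Q Qm.
  move/eqP: Qm; rewrite cards_eq0 => /eqP ->; rewrite expr0.
  rewrite [1](_ : _ = cov1 :> cov R (n + n)) // ffunE; case: eqP => // -[].
  apply/setP => a; rewrite inE; apply/imsetP => -[b]; by rewrite !inE.
rewrite exprS /beta mulr_suml -/beta sum_ffunE.
under eq_bigr => j _ do rewrite eta2_coef.
rewrite -big_mkcond /= (eq_bigr (fun=> m`!%:R)) => [|j jQ].
  by rewrite sumr_const Qm factS natrM mulr_natl.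
by apply: IH; have := cardsD1 j Q; rewrite jQ Qm add1n => -[].
Qed.

(** Against [beta ^+ n] every [eta a] vanishes, so each dy may be replaced by the corresponding dx.
    This turns the pulled back form in y into a form in x. *)
Lemma bas_gr_beta I : (bas (gr @: I) : A) * beta ^+ n = (bas (gl @: I) : A) * beta ^+ n.
Proof.
have [k] := ubnP #|I|; elim: k I => // k IH I; rewrite ltnS => Ik.
case: (set_0Vmem I) => [->|[a aI]]; first by rewrite !imset0.
have e (g : gen n -> gen (n + n)) : injective g ->
    (forall I J, inversions (g @: I) (g @: J) = inversions I J) ->
  (bas (g @: I) : A) = (-1) ^+ inversions (I :\ a) [set a] *:
     ((bas (g @: (I :\ a)) : A) * gx (g a)).
  move=> ginj ginv; rewrite extM /gx covg_bas wedge_bas /wsign.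
  have -> : [disjoint g @: (I :\ a) & [set g a]]%B.
    by rewrite disjoint_sym disjoints1 mem_imset // !inE eqxx.
  rewrite -imset_set1 -imsetU ginv.
  have -> : I :\ a :|: [set a] = I by rewrite setUC setD1K.
  by apply/ffunP => K; rewrite extZE [cscale _ _ _]ffunE mulrA -expr2 sqrr_sign mul1r.
rewrite (e _ gr_inj inversions_gr) (e _ gl_inj inversions_gl) -!scalerAl; congr (_ *: _).
rewrite -!mulrA; have cb x : hom 1 x -> x * beta ^+ n = beta ^+ n * x.
  by move=> hx; apply/commrX/commr_sym/beta_comm1.
have gg : gx (gr a) * beta ^+ n = gx (gl a) * beta ^+ n :> A.
  by apply/esym/eqP; rewrite -subr_eq0 -mulrBl; apply/eqP/eta_beta.
rewrite gg cb ?mulrA; last exact: hom_gx.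
rewrite IH //; have := cardsD1 a I; rewrite aI; lia.
Qed.

(** Once dy_J has become dx_J, the coefficient on dx_I and all the dy receives only J = I, where
    [beta ^+ n] contributes n!. A proper subset J of I would ask for a coefficient of [beta ^+ n] in
    degree above 2n. *)
Lemma fibre_coef (phi : cov R n) I :
  wedge [ffun J : {set gen (n + n)} =>
    let I := gr @^-1: J in if gr @: I == J then phi I else 0] (beta ^+ n)
    ((gl @: I) :|: (gr @: [set: gen n])) = n`!%:R * phi I.
Proof.
set F := [ffun J => _]; set K := _ :|: _.
have FE : F = \sum_J phi J *: (bas (gr @: J) : A).
  apply/ffunP => J; rewrite sum_ffunE ffunE.
  under eq_bigr => L _ do rewrite extZE ffunE.
  case: eqP => [e|ne].
    rewrite (bigD1 (gr @^-1: J)) //= e eqxx mulr1 big1 ?addr0 // => L nL.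
    case: eqP => [JL|]; last by rewrite mulr0.
    by case/eqP: nL; rewrite JL preim_gr.
  rewrite big1 // => L _; case: eqP => [JL|]; last by rewrite mulr0.
  by case: ne; rewrite JL preim_gr.
rewrite FE -extM mulr_suml sum_ffunE.
have KgrT : K :\: gl @: I = gr @: [set: gen n].
  rewrite /K setU_diffl // -setI_eq0; apply/eqP/setP => a; rewrite !inE.
  by apply/negP => /andP[/imsetP[b _ ->]]; rewrite gl_notin_gr.
have cK : #|K| = (#|I| + n * 2)%N.
  have := cardsID (gl @: I) K; rewrite KgrT (setIidPr (subsetUl _ _)).
  rewrite !card_imset; [|exact: gr_inj|exact: gl_inj].
  by rewrite cardsT card_prod card_ord card_bool.
rewrite (bigD1 I) //= big1 ?addr0 => [|J JI]; rewrite -scalerAl extZE bas_gr_beta extM wedge_basl.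
  rewrite subsetUl KgrT inversions_glgr expr0 mul1r mulrC; congr (_ * _).
  have -> : [set: gen n] = Xset [set: 'I_n] by apply/setP => a; rewrite !inE.
  by rewrite betaX_coef // cardT_ord.
case: ifP => [JK|]; last by rewrite mulr0.
have sJI : J \subset I.
  apply/fintype.subsetP => a aJ; have : gl a \in K by apply: (fintype.subsetP JK); rewrite imset_f.
  by rewrite inE gl_notin_gr orbF mem_imset //; exact: gl_inj.
have hb : hom (n * 2) (beta ^+ n) by apply/homX/hom_beta.
rewrite (hom_coef0 hb) ?mulr0 //.
have := cardsID (gl @: J) K; rewrite (setIidPr JK) card_imset; last exact: gl_inj.
have : (#|J| < #|I|)%N by apply: proper_card; rewrite properEneq JI.
by rewrite cK => lt e; apply: contraTneq lt => e2; rewrite -leqNgt -(leq_add2r (n * 2)) -e e2.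
Qed.

End FibreCoefficient.

(** * Riemann sums for the iterated integral *)

Section RealLineIntegral.
Context {R : realType}.
Implicit Types (f A : R -> R) (a b : R).
Local Notation mu := (@lebesgue_measure R).

Lemma is_derive_continuous f (x d : R) : is_derive x 1 f d -> {for x, continuous f}.
Proof. by move=> [df _]; apply/differentiable_continuous/derivable1_diffP. Qed.

Lemma continuous_seg_integrable f a b : continuous f -> mu.-integrable `[a, b] (EFin \o f).
Proof.
move=> cf; apply: continuous_compact_integrable; first exact: segment_compact.
exact: continuous_subspaceT.
Qed.

Lemma restrict_seg f a b : (forall x, x < a -> f x = 0) -> (forall x, b < x -> f x = 0) ->
  f \_ `[a, b] = f.
Proof.
move=> fa fb; apply/funext => x; rewrite patchE; case: ifPn => //.
rewrite notin_setE /= in_itv /= => /negP; rewrite negb_and -!ltNge.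
by case/orP => [/fa|/fb] ->.
Qed.

Lemma integrable_csupp f a b : continuous f ->
  (forall x, x < a -> f x = 0) -> (forall x, b < x -> f x = 0) ->
  mu.-integrable setT (EFin \o f).
Proof.
move=> cf fa fb; have := continuous_seg_integrable a b cf.
rewrite integrable_mkcond //; congr (mu.-integrable _ _).
by rewrite restrict_EFin restrict_seg.
Qed.

Lemma Rintegral_csupp_FTC2 f A a b : a < b -> continuous f ->
  (forall x, x < a -> f x = 0) -> (forall x, b < x -> f x = 0) ->
  (forall x : R, is_derive x 1 A (f x)) -> \int[mu]_x f x = A b - A a.
Proof.
move=> ab cf fa fb dA; rewrite -{1}(restrict_seg fa fb) -Rintegral_mkcond.
rewrite /Rintegral (@continuous_FTC2 _ f A a b ab) //.
- exact: continuous_subspaceT.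
- split => [x _||].
  + by case: (dA x).
  + by apply: cvg_at_right_filter; apply: is_derive_continuous.
  + by apply: cvg_at_left_filter; apply: is_derive_continuous.
- by move=> x _; rewrite derive1E; case: (dA x).
Qed.

Lemma antiderivative f a : continuous f -> (forall x, x <= a -> f x = 0) ->
  exists A : R -> R, (forall x, x <= a -> A x = 0) /\ forall x : R, is_derive x 1 A (f x).
Proof.
move=> cf f0; exists (fun x => \int[mu]_(t in `]-oo, x]) f t); split=> [s sa|x].
  rewrite -[RHS](Rintegral_set0 mu f) [LHS]Rintegral_mkcond [RHS]Rintegral_mkcond.
  apply: eq_Rintegral => t _; rewrite !patchE in_set0 mem_setE in_itv /=.
  by case: ifP => // ts; apply: f0; lra.
have itg : mu.-integrable `]-oo, (x + 1)] (EFin \o f).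
  have := continuous_seg_integrable a (x + 1) cf.
  rewrite integrable_mkcond // [X in _ -> X]integrable_mkcond //.
  congr (mu.-integrable _ _); apply/funext => t; rewrite !patchE.
  rewrite !mem_setE !in_itv /=; case: (leP a t) => // ta.
  by case: ifP => // _; rewrite /= f0 // ltW.
have x1 : x < x + 1 by rewrite ltrDl.
have [|df dE] := continuous_FTC1 x1 itg _ (cf x); first by rewrite ltNyr.
by apply: (DeriveDef df); rewrite -derive1E; exact: dE.
Qed.

(** Both integrals are differences of values of one antiderivative A, since -A(c - x) is an
    antiderivative of the reflected integrand. *)
Lemma Rintegral_reflect f a b c : a < b -> continuous f ->
  (forall x, x < a -> f x = 0) -> (forall x, b < x -> f x = 0) ->
  \int[mu]_x f (c - x) = \int[mu]_x f x.
Proof.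
move=> ab cf fa fb; have fa' t : t <= a - 1 -> f t = 0 by move=> ta; apply: fa; lra.
have [A [_ dA]] := antiderivative cf fa'.
have dr (x : R) : is_derive x 1 (fun t : R => c - t) (- 1).
  by rewrite -[- 1]add0r; apply: is_deriveB.
rewrite (Rintegral_csupp_FTC2 ab cf fa fb dA).
transitivity (- A (c - (c - a)) - - A (c - (c - b))); last by rewrite !subKr; ring.
apply: (@Rintegral_csupp_FTC2 (fun x => f (c - x)) (fun x => - A (c - x)) (c - b) (c - a)).
- by rewrite ltrD2l ltrN2.
- move=> x; apply: continuous_comp; last exact: cf.
  by apply: (@is_derive_continuous (fun t => c - t)); apply: dr.
- by move=> x xcb; apply: fb; lra.
- by move=> x xca; apply: fa; lra.
- move=> x; rewrite -[f _]opprK; apply: is_deriveN.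
  by rewrite -[- f _]mulrN1; exact: (@is_derive1_comp _ A (fun t => c - t) _ _ _ (dA _) (dr _)).
Qed.

End RealLineIntegral.

Section UniformContinuity.
Context {R : realType}.

Lemma mul_divS_le (C e : R) : 0 <= C -> 0 <= e -> C * (e / (C + 1)) <= e.
Proof.
move=> C0 e0; have c0 : 0 < C + 1 by lra.
by rewrite mulrA ler_pdivrMr // mulrC ler_wpM2l // lerDl.
Qed.

Definition modulus (W : normedModType R) (f : W -> R) (d e : R) :=
  forall u v, `|u - v| < d -> `|f u - f v| <= e.

Definition equicont (W : normedModType R) (T : Type) (F : T -> W -> R) :=
  forall e : R, 0 < e -> exists2 d : R, 0 < d & forall t, modulus (F t) d e.

Definition ucont (W : normedModType R) (f : W -> R) :=
  forall e : R, 0 < e -> exists2 d : R, 0 < d & modulus f d e.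

Definition bsupp (W : normedModType R) (M : R) (f : W -> R) :=
  forall v, M < `|v| -> f v = 0.

Lemma ucont_continuous (W : normedModType R) (f : W -> R) : ucont f -> continuous f.
Proof.
move=> uf x; apply/cvgrPdist_le => e e0; have [d d0 df] := uf _ e0.
near=> y; apply: df; near: y; apply/nbhs_normP; exists d => //=.
Unshelve. all: by end_near. Qed.

Lemma modulus_ge0 (W : normedModType R) (f : W -> R) d e : 0 < d -> modulus f d e -> 0 <= e.
Proof. by move=> d0 /(_ 0 0); rewrite !subrr !normr0; apply. Qed.

Lemma equicont_ucont (W : normedModType R) T (F : T -> W -> R) t : equicont F -> ucont (F t).
Proof. by move=> eF e /eF[d d0 Fd]; exists d. Qed.

Lemma ucont_equicont (W : normedModType R) (f : W -> R) : ucont f -> equicont (fun _ : unit => f).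
Proof. by move=> uf e /uf[d d0 Fd]; exists d. Qed.

Lemma equicont_fin (W : normedModType R) (T : finType) (U : T -> Type)
  (F : forall t, U t -> W -> R) : (forall t, equicont (F t)) ->
  equicont (fun tu : {t : T & U t} => F (tag tu) (tagged tu)).
Proof.
move=> eF e e0; have /choice[d dP] t : exists d : R, 0 < d /\ forall u, modulus (F t u) d e.
  by have [d d0 H] := eF t e e0; exists d.
exists (\big[Num.min/1]_t d t).
  by apply: lt_bigmin => // t _; case: (dP t).
move=> [t u] /= v w vw; apply: (dP t).2; apply: lt_le_trans vw _.
exact: bigmin_le_cond.
Qed.

End UniformContinuity.

Section RiemannApproximation.
Context {R : realType}.

Definition wsum (W : normedModType R) (L : seq (W * R)) (f : W -> R) :=
  \sum_(p <- L) p.2 * f p.1.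

(** The order of the quantifiers is what matters: the nodes and weights depend on the support radius
    [M] and the mesh [d] but not on [f], and the total weight stays below [C] for every mesh. One
    sum thus serves a whole equicontinuous family, and the property is inherited by iterated
    integrals. *)
Definition rapprox (W : normedModType R) (I : (W -> R) -> R) :=
  forall M, exists2 C : R, 0 <= C & forall d : R, 0 < d -> exists L : seq (W * R),
    [/\ all (fun p => 0 <= p.2) L, \sum_(p <- L) p.2 <= C &
      forall (e : R) f, ucont f -> bsupp M f -> modulus f d e -> `|I f - wsum L f| <= C * e].

Lemma wsum_le (W : normedModType R) (L : seq (W * R)) (f : W -> R) C e :
  all (fun p => 0 <= p.2) L -> \sum_(p <- L) p.2 <= C ->
  (forall v, `|f v| <= e) -> `|wsum L f| <= C * e.
Proof.
move=> L0 LC fe; have e0 : 0 <= e by apply: le_trans (fe 0).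
apply: le_trans (ler_wpM2r e0 LC).
rewrite /wsum mulr_suml; apply: le_trans (ler_norm_sum _ _ _) _.
rewrite big_seq [leRHS]big_seq; apply: ler_sum => p pL.
have p0 : 0 <= p.2 by exact: (allP L0).
by rewrite normrM ger0_norm // ler_wpM2l.
Qed.

Lemma wsumB (W : normedModType R) (L : seq (W * R)) (f g : W -> R) :
  wsum L (fun v => f v - g v) = wsum L f - wsum L g.
Proof. by rewrite /wsum -sumrB; apply: eq_bigr => p _; rewrite mulrBr. Qed.

Lemma rapprox_rint0 : rapprox (@rint R 0).
Proof.
move=> M; exists 1; rewrite ?ler01 // => d d0; exists [:: (0, 1)]; split.
- by rewrite /= ler01.
- by rewrite big_seq1.
- move=> e f _ _ /(modulus_ge0 d0) e0; rewrite /wsum big_seq1 /= mul1r subrr normr0 mul1r//.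
Qed.

(** Left endpoint sums over a subdivision of [-M, M] of step less than [d], compared with the
    integral cell by cell. *)
Lemma rapprox_line : rapprox (fun f : R -> R => \int[@lebesgue_measure R]_t f t).
Proof.
(* The new radius is positive even when the given one is negative, and lies strictly beyond it. *)
move=> M0; pose M := Num.max M0 0 + 1.
have M0M : M0 < M by rewrite /M ltr_pwDr // le_max lexx.
have Mp : 0 < M by rewrite /M ltr_wpDl // le_max lexx orbT.
exists (2 * M); first by rewrite mulr_ge0 // ltW.
move=> d d0; have [N Nd] : exists N : nat, 2 * M / d < N.+1%:R.
  exists (Num.Def.truncn (2 * M / d)); apply: truncnS_gt.
pose h := 2 * M / N.+1%:R; have h0 : 0 < h by rewrite divr_gt0 // mulr_gt0.
have hd : h < d by move: Nd; rewrite ltr_pdivrMr // /h ltr_pdivrMr // [d * _]mulrC.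
pose x (i : nat) := - M + i%:R * h.
have xS i : x i.+1 = x i + h by rewrite /x -natr1; ring.
have xN : x N.+1 = M by rewrite /x mulrC divfK ?pnatr_eq0 //; lra.
exists [seq (x i, h) | i <- iota 0 N.+1]; split.
- by apply/allP => p /mapP[i _ ->] /=; apply: ltW.
- rewrite (_ : \sum_(p <- _) _ = \sum_(i <- iota 0 N.+1) h); last by rewrite big_map.
  by rewrite big_const_seq count_predT size_iota iter_addr_0 /h -[_ *+ N.+1]mulr_natr divfK ?pnatr_eq0.
move=> e f uf sf mf; have cf := ucont_continuous uf.
have fa t : t < - M -> f t = 0.
  by move=> tM; apply: sf; rewrite ltr0_norm; lra.
have fb t : M < t -> f t = 0.
  by move=> tM; apply: sf; rewrite gtr0_norm; lra.
have fa' t : t <= - M - 1 -> f t = 0 by move=> tM; apply: fa; lra.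
have [A [_ dA]] := antiderivative cf fa'.
rewrite (@Rintegral_csupp_FTC2 _ f A (- M) M) //; last lra.
have tel : A M - A (- M) = \sum_(0 <= i < N.+1) (A (x i.+1) - A (x i)).
  by rewrite telescope_sumr // xN /x mul0r addr0.
rewrite tel /wsum big_map /= -/(index_iota 0 N.+1) -sumrB.
have -> : 2 * M * e = \sum_(0 <= i < N.+1) h * e.
  by rewrite sumr_const_nat subn0 /h -[_ *+ N.+1]mulr_natr [in RHS]mulrAC divfK ?pnatr_eq0.
apply: le_trans (ler_norm_sum _ _ _) _; apply: ler_sum => i _.
have xx : x i < x i.+1 by rewrite xS ltrDl.
(* The integral over one cell is f(c) h for some c in the cell, hence at distance less than [d] from
   the node. *)
have [c cx ->] := @MVT R A f (x i) (x i.+1) xx (fun t _ => dA t)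
  (continuous_subspaceT (fun t => is_derive_continuous (dA t))).
rewrite xS addrAC subrr add0r [f c * h]mulrC -mulrBr normrM (gtr0_norm h0) ler_pM2l //.
apply: mf; move: cx; rewrite in_itv /= xS => /andP[c1 c2].
by rewrite gtr0_norm; lra.
Qed.

(* The closeness of the inner integrals of two slices at the same scale gives
   the modulus of continuity of the outer integrand. *)
Lemma rapprox_prod (W1 W2 W : normedModType R) (j : W1 -> W2 -> W) I1 I2 :
  (forall a a' b, `|j a b - j a' b| <= `|a - a'|) ->
  (forall a b b', `|j a b - j a b'| <= `|b - b'|) ->
  (forall a b, `|a| <= `|j a b|) -> (forall a b, `|b| <= `|j a b|) ->
  rapprox I1 -> rapprox I2 ->
  rapprox (fun f : W -> R => I1 (fun a => I2 (fun b => f (j a b)))).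
Proof.
move=> j1 j2 n1 n2 r1 r2 M.
have [C1 C10 H1] := r1 M; have [C2 C20 H2] := r2 M.
have C120 : 0 <= C1 * C2 by exact: mulr_ge0.
(* The outer sum accounts for 3 and the inner sums for 1. The outer integrand has modulus 3 C2 e:
   two approximation errors, plus the difference of two slices of the same inner sum. *)
exists (4 * (C1 * C2)); first by rewrite mulr_ge0.
pose apx d L2 := forall (e : R) f, ucont f -> bsupp M f -> modulus f d e ->
  `|I2 f - wsum L2 f| <= C2 * e.
have modI d e f : 0 < d -> ucont f -> bsupp M f -> modulus f d e ->
    modulus (fun a => I2 (fun b => f (j a b))) d (3 * C2 * e) /\
    forall L2, apx d L2 ->
      forall a, `|I2 (fun b => f (j a b)) - wsum L2 (fun b => f (j a b))| <= C2 * e.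
  move=> d0 uf sf mf.
  have app L2 : apx d L2 ->
      forall a, `|I2 (fun b => f (j a b)) - wsum L2 (fun b => f (j a b))| <= C2 * e.
    move=> HL2 a; apply: HL2.
    - move=> e' /uf[d' d'0 mf']; exists d' => // u v uv; apply: mf'.
      exact: le_lt_trans uv.
    - by move=> b Mb; apply: sf; apply: lt_le_trans Mb _.
    - by move=> u v uv; apply: mf; apply: le_lt_trans uv.
  split=> // a a' aa'.
  have [L2 [L20 L2C HL2]] := H2 d d0.
  have h1 := app L2 HL2 a; have h2 := app L2 HL2 a'.
  have h3 : `|wsum L2 (fun b => f (j a b)) - wsum L2 (fun b => f (j a' b))| <= C2 * e.
    rewrite -wsumB; apply: wsum_le => // b; apply: mf; exact: le_lt_trans aa'.
  rewrite (_ : _ - _ = (I2 (fun b => f (j a b)) - wsum L2 (fun b => f (j a b))) +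
    (wsum L2 (fun b => f (j a b)) - wsum L2 (fun b => f (j a' b))) -
    (I2 (fun b => f (j a' b)) - wsum L2 (fun b => f (j a' b)))); last by ring.
  apply: le_trans (ler_normB _ _) _; apply: le_trans (lerD (ler_normD _ _) (lexx _)) _.
  by rewrite (_ : 3 * C2 * e = C2 * e + C2 * e + C2 * e); [rewrite !lerD | ring].
move=> d d0; have [L1 [L10 L1C HL1]] := H1 d d0; have [L2 [L20 L2C HL2]] := H2 d d0.
exists [seq (j p.1 q.1, p.2 * q.2) | p <- L1, q <- L2]; split.
- apply/allP => _ /allpairsP[[p q] /= [pL qL ->]] /=.
  by rewrite mulr_ge0 // ?(allP L10 _ pL) ?(allP L20 _ qL).
- rewrite big_allpairs_dep /=.
  under eq_bigr do rewrite -mulr_sumr.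
  rewrite -mulr_suml; have L1p : 0 <= \sum_(p <- L1) p.2.
    by rewrite big_seq; apply: sumr_ge0 => p pL; apply: (allP L10 _ pL).
  have L2p : 0 <= \sum_(p <- L2) p.2.
    by rewrite big_seq; apply: sumr_ge0 => p pL; apply: (allP L20 _ pL).
  apply: le_trans (ler_pM L1p L2p L1C L2C) _.
  by rewrite ler_peMl //; lra.
move=> e f uf sf mf; have [mG app] := modI d e f d0 uf sf mf.
pose G a := I2 (fun b => f (j a b)).
have uG : ucont G.
  move=> e' e'0; pose e1 := e' / (3 * C2 + 1).
  have c0 : 0 < 3 * C2 + 1 by lra.
  have e10 : 0 < e1 by rewrite divr_gt0.
  have [d1 d10 m1] := uf _ e10; exists d1 => // a a' aa'.
  apply: le_trans ((modI d1 e1 f d10 uf sf m1).1 a a' aa') _.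
  by rewrite /e1 mulrA ler_pdivrMr // mulrC ler_pM2l //; lra.
have sG : bsupp M G.
  move=> a Ma; rewrite /G; have [L2' [L20' L2C' HL2']] := H2 1 ltr01.
  have z : (fun b => f (j a b)) = fun=> 0.
    by apply/funext => b; apply: sf; apply: lt_le_trans Ma _.
  rewrite z; apply/eqP; rewrite -normr_le0.
  have := HL2' 0 (fun=> 0); rewrite /wsum big1 => [|p _]; last by rewrite mulr0.
  rewrite subr0 mulr0; apply.
  - by move=> e' e'0; exists 1 => // u v _; rewrite subrr normr0 ltW.
  - by [].
  - by move=> u v _; rewrite subrr normr0.
have h1 := HL1 _ G uG sG mG.
have -> : wsum [seq (j p.1 q.1, p.2 * q.2) | p <- L1, q <- L2] f =
    wsum L1 (fun a => wsum L2 (fun b => f (j a b))).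
  rewrite /wsum big_allpairs_dep /=; apply: eq_bigr => p _; rewrite mulr_sumr.
  by apply: eq_bigr => q _; rewrite mulrA.
rewrite -/G (_ : I1 G - _ = (I1 G - wsum L1 G) +
    wsum L1 (fun a => G a - wsum L2 (fun b => f (j a b)))); last by rewrite wsumB; ring.
apply: le_trans (ler_normD _ _) _.
rewrite (_ : 4 * (C1 * C2) * e = C1 * (3 * C2 * e) + C1 * (C2 * e)); last by ring.
by apply: lerD => //; apply: wsum_le => // a; apply: app.
Qed.

End RiemannApproximation.

Section RiemannConsequences.
Context {R : realType}.
Variables (W : normedModType R) (I : (W -> R) -> R).
Hypothesis rI : rapprox I.

(** The common modulus of the family fixes the mesh. [C] is chosen before the family and the
    precision, so the total weight stays bounded as the precision improves. *)
Lemma rapprox_equi M : exists2 C : R, 0 <= C & forall (T : Type) (F : T -> W -> R),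
  equicont F -> (forall t, bsupp M (F t)) -> forall e : R, 0 < e ->
  exists L : seq (W * R), [/\ all (fun p => 0 <= p.2) L, \sum_(p <- L) p.2 <= C &
    forall t, `|I (F t) - wsum L (F t)| <= e].
Proof.
have [C C0 H] := rI M; exists C => // T F eF sF e e0.
have c1 : 0 < C + 1 by lra.
have [d d0 Fd] := eF (e / (C + 1)) (divr_gt0 e0 c1).
have [L [L0 LC HL]] := H d d0; exists L; split => // t.
apply: le_trans (HL _ _ (equicont_ucont t eF) (sF t) (Fd t)) _.
exact: mul_divS_le (ltW e0).
Qed.

Lemma ucont_cst (c : R) : ucont (fun _ : W => c).
Proof. by move=> e e0; exists 1 => // u v _; rewrite subrr normr0 ltW. Qed.

Lemma ucontD (f g : W -> R) : ucont f -> ucont g -> ucont (fun v => f v + g v).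
Proof.
move=> uf ug e e0; have e2 : 0 < e / 2 by rewrite divr_gt0.
have [d1 d10 h1] := uf _ e2; have [d2 d20 h2] := ug _ e2.
exists (Num.min d1 d2) => [|u v]; rewrite lt_min; first by rewrite d10.
move=> /andP[/h1 uv1 /h2 uv2]; rewrite opprD addrACA.
by apply: le_trans (ler_normD _ _) _; lra.
Qed.

Lemma ucontZ (f : W -> R) a : ucont f -> ucont (fun v => a * f v).
Proof.
move=> uf e e0; have c0 : 0 < `|a| + 1 by rewrite ltr_wpDl.
have [d d0 h] := uf _ (divr_gt0 e0 c0); exists d => // u v /h uv.
rewrite -mulrBr normrM; apply: le_trans (ler_wpM2l (normr_ge0 a) uv) _.
exact: mul_divS_le (ltW e0).
Qed.

Lemma bsuppD M (f g : W -> R) : bsupp M f -> bsupp M g -> bsupp M (fun v => f v + g v).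
Proof. by move=> sf sg v Mv; rewrite sf // sg // addr0. Qed.

Lemma bsuppZ M (f : W -> R) a : bsupp M f -> bsupp M (fun v => a * f v).
Proof. by move=> sf v Mv; rewrite sf // mulr0. Qed.

Lemma bsupp_le M N (f : W -> R) : M <= N -> bsupp M f -> bsupp N f.
Proof. by move=> MN sf v Nv; apply: sf; apply: le_lt_trans Nv. Qed.

Lemma wsumD L (f g : W -> R) : wsum L (fun v => f v + g v) = wsum L f + wsum L g.
Proof. by rewrite /wsum -big_split; apply: eq_bigr => p _; rewrite mulrDr. Qed.

Lemma wsumZ L a (f : W -> R) : wsum L (fun v => a * f v) = a * wsum L f.
Proof. by rewrite /wsum mulr_sumr; apply: eq_bigr => p _; rewrite mulrCA. Qed.

Lemma eps_eq0 (x K : R) : 0 <= K -> (forall e : R, 0 < e -> `|x| <= K * e) -> x = 0.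
Proof.
move=> K0 H; apply/eqP; rewrite -normr_le0 leNgt; apply/negP => x0.
have c0 : 0 < K + 1 by lra.
have := H (`|x| / (K + 1) ) (divr_gt0 x0 c0).
rewrite mulrA ler_pdivlMr // mulrC leNgt => /negP; apply.
by rewrite mulrDl mul1r ltrDl.
Qed.

(** One weighted sum approximates the integrals of f, g and a f + g simultaneously, and weighted
    sums are linear. *)
Lemma rapproxDZ M a (f g : W -> R) : ucont f -> ucont g -> bsupp M f -> bsupp M g ->
  I (fun v => a * f v + g v) = a * I f + I g.
Proof.
move=> uf ug sf sg; have [C C0 H] := rapprox_equi M.
pose F (t : 'I_3) v := if t == 0 :> nat then f v else
  if t == 1%N :> nat then g v else a * f v + g v.
have eF : equicont F.
  have u3 : ucont (fun v => a * f v + g v) by apply: ucontD => //; apply: ucontZ.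
  move=> e e0; have [d1 d10 h1] := uf _ e0; have [d2 d20 h2] := ug _ e0.
  have [d3 d30 h3] := u3 _ e0.
  exists (Num.min d1 (Num.min d2 d3)); first by rewrite !lt_min d10 d20.
  move=> [[|[|[|//]]] ?] u v; rewrite !lt_min => /and3P[uv1 uv2 uv3];
    [exact: h1|exact: h2|exact: h3].
have sF t : bsupp M (F t).
  by case: t => [[|[|[|//]]] ?] //; apply: bsuppD => //; apply: bsuppZ.
apply/eqP; rewrite -subr_eq0; apply/eqP; apply: (@eps_eq0 _ (2 + `|a|)) => // e e0.
have [L [_ _ HL]] := H _ F eF sF e e0.
have h1 := HL (@Ordinal 3 0 isT); have h2 := HL (@Ordinal 3 1 isT).
have h3 := HL (@Ordinal 3 2 isT); rewrite /F /= wsumD wsumZ in h1 h2 h3.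
rewrite (_ : _ - _ = (I (fun v => a * f v + g v) - (a * wsum L f + wsum L g)) -
   a * (I f - wsum L f) - (I g - wsum L g)); last by ring.
apply: le_trans (ler_normB _ _) _; apply: le_trans (lerD (ler_normB _ _) (lexx _)) _.
rewrite normrM; have := ler_wpM2l (normr_ge0 a) h1.
by rewrite mulrDl; lra.
Qed.

Lemma rapprox0 : I (fun=> 0) = 0.
Proof.
have := @rapproxDZ 0 0 (fun=> 0) (fun=> 0) (ucont_cst 0) (ucont_cst 0).
rewrite !mul0r !add0r /bsupp; have := @rapproxDZ 0 1 (fun=> 0) (fun=> 0) (ucont_cst 0) (ucont_cst 0).
rewrite mulr0 addr0 mul1r => h _; have := h (fun _ _ => erefl) (fun _ _ => erefl).
by lra.
Qed.

Lemma rapproxZ M a (f : W -> R) : ucont f -> bsupp M f ->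
  I (fun v => a * f v) = a * I f.
Proof.
move=> uf sf; have := rapproxDZ a uf (ucont_cst 0) sf (fun _ _ => erefl).
by under [X in I X = _]eq_fun do rewrite addr0; rewrite rapprox0 addr0.
Qed.

Lemma rapproxB M (f g : W -> R) : ucont f -> ucont g -> bsupp M f -> bsupp M g ->
  I (fun v => f v - g v) = I f - I g.
Proof.
move=> uf ug sf sg; have := rapproxDZ (-1) ug uf sg sf.
under [X in I X = _]eq_fun do rewrite mulN1r addrC.
by rewrite mulN1r addrC.
Qed.

Lemma rapprox_bound M : exists2 C : R, 0 <= C & forall f (B : R), ucont f -> bsupp M f ->
  (forall v, `|f v| <= B) -> `|I f| <= C * B.
Proof.
have [C C0 H] := rapprox_equi M; exists C => // f B uf sf fB.
apply/ler_addgt0Pr => e e0.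
have [L [L0 LC HL]] := H unit (fun=> f) (ucont_equicont uf) (fun=> sf) e e0.
rewrite -[I f](subrK (wsum L f)) addrC; apply: le_trans (ler_normD _ _) _.
by apply: lerD (HL tt); apply: wsum_le.
Qed.

Lemma rapprox_ge0 M f : ucont f -> bsupp M f -> (forall v, 0 <= f v) -> 0 <= I f.
Proof.
move=> uf sf f0; have [C C0 H] := rapprox_equi M.
apply/ler_addgt0Pl => /= e e0.
have [L [L0 LC HL]] := H unit (fun=> f) (ucont_equicont uf) (fun=> sf) e e0.
have := HL tt; rewrite ler_norml => /andP[h _].
have : 0 <= wsum L f.
  rewrite /wsum big_seq; apply: sumr_ge0 => p pL.
  by rewrite mulr_ge0 // (allP L0 _ pL).
move=> w0; rewrite -lerBlDl sub0r; apply: le_trans h _; rewrite lerBlDr lerDl //.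
Qed.

Lemma rapprox_le M f g : ucont f -> ucont g -> bsupp M f -> bsupp M g ->
  (forall v, f v <= g v) -> I f <= I g.
Proof.
move=> uf ug sf sg fg; rewrite -subr_ge0 -(rapproxB ug uf sg sf).
apply: (@rapprox_ge0 M).
- by under eq_fun do rewrite -mulN1r; apply: ucontD => //; apply: ucontZ.
- by move=> v Mv; rewrite sf // sg // subrr.
- by move=> v; rewrite subr_ge0.
Qed.

Lemma ucont_slice (T : normedModType R) (f : T -> W -> R) M :
  (forall t, ucont (f t)) -> (forall t, bsupp M (f t)) ->
  equicont (fun w t => f t w) -> ucont (fun t => I (f t)).
Proof.
move=> uf sf ef; have [C C0 HC] := rapprox_bound M.
move=> e e0; have c0 : 0 < C + 1 by lra.
have [d d0 mf] := ef _ (divr_gt0 e0 c0); exists d => // t t' tt'.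
rewrite -(rapproxB (uf t) (uf t') (sf t) (sf t')).
apply: le_trans (HC _ (e / (C + 1)) _ _ _) _.
- by under eq_fun do rewrite -mulN1r; apply: ucontD => //; exact: ucontZ.
- by move=> v Mv; rewrite !sf // subrr.
- by move=> v; apply: mf.
- exact: mul_divS_le (ltW e0).
Qed.

End RiemannConsequences.

Section IteratedIntegral.
Context {R : realType}.

Lemma coord_le_norm k (v : 'rV[R]_k) i : `|v 0 i| <= `|v|.
Proof.
rewrite [leRHS]/Num.norm /= mx_normrE.
exact: (@le_bigmax _ _ _ 0 (fun ij : 'I_1 * 'I_k => `|v ij.1 ij.2|) (0, i)).
Qed.

Lemma rV_norm_le k (v : 'rV[R]_k) B : 0 <= B -> (forall i, `|v 0 i| <= B) -> `|v| <= B.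
Proof.
move=> B0 H; rewrite [leLHS]/Num.norm /= mx_normrE; apply/bigmax_leP; split=> // -[i j] _ /=.
by rewrite (ord1 i).
Qed.

Definition consrV k (t : R) (v : 'rV[R]_k) : 'rV[R]_k.+1 :=
  row_mx (t%:M : 'M[R]_1) v : 'rV[R]_(1 + k).

Lemma consrV0 k t (v : 'rV[R]_k) : consrV t v 0 0 = t.
Proof.
rewrite /consrV (_ : 0 = lshift k (0 : 'I_1) :> 'I_(1 + k)); last exact/val_inj.
by etransitivity; [exact: row_mxEl | rewrite mxE eqxx].
Qed.

Lemma consrVS k t (v : 'rV[R]_k) i : consrV t v 0 (lift ord0 i) = v 0 i.
Proof.
rewrite /consrV (_ : lift ord0 i = rshift 1 i :> 'I_(1 + k)); last exact/val_inj.
exact: row_mxEr.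
Qed.

Lemma consrV_surj k (w : 'rV[R]_k.+1) : exists t v, w = consrV t v.
Proof.
exists (w 0 0), (\row_i w 0 (lift ord0 i)); apply/rowP => i.
by case: (unliftP ord0 i) => [j ->|->]; rewrite ?consrVS ?consrV0 ?mxE.
Qed.

Lemma consrVB k t t' (v v' : 'rV[R]_k) :
  consrV t v - consrV t' v' = consrV (t - t') (v - v').
Proof.
by apply/rowP => i; rewrite [LHS]mxE [X in _ + X]mxE;
  case: (unliftP ord0 i) => [j ->|->]; rewrite ?consrVS ?consrV0 ?mxE.
Qed.

Lemma consrV_norm_le k t (v : 'rV[R]_k) B : `|t| <= B -> `|v| <= B -> `|consrV t v| <= B.
Proof.
move=> tB vB; apply: rV_norm_le => [|i]; first exact: le_trans tB.
case: (unliftP ord0 i) => [j ->|->]; rewrite ?consrVS ?consrV0 //.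
exact: le_trans (coord_le_norm _ _) vB.
Qed.

Lemma consrV_norm_gel k t (v : 'rV[R]_k) : `|t| <= `|consrV t v|.
Proof. by rewrite -{1}(consrV0 t v) coord_le_norm. Qed.

Lemma consrV_norm_ger k t (v : 'rV[R]_k) : `|v| <= `|consrV t v|.
Proof. by apply: rV_norm_le => // i; rewrite -(consrVS t) coord_le_norm. Qed.

Lemma rapprox_rint k : rapprox (@rint R k).
Proof.
elim: k => [|k IH]; first exact: rapprox_rint0.
apply: (@rapprox_prod _ R^o _ _ (@consrV k) _ _ _ _ _ _ rapprox_line IH).
- by move=> a a' b; rewrite consrVB subrr consrV_norm_le ?normr0.
- by move=> a b b'; rewrite consrVB subrr consrV_norm_le ?normr0.
- exact: consrV_norm_gel.
- exact: consrV_norm_ger.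
Qed.

Definition vint n (f : 'CV[R]_n -> R) : R := rint (fun a => rint (fun b => f (a, b))).

Lemma pair_norm (W1 W2 : normedModType R) (a : W1) (b : W2) : `|(a, b)| = Num.max `|a| `|b|.
Proof. by []. Qed.

Lemma pair_normBl (W1 W2 : normedModType R) (a a' : W1) (b : W2) : `|(a, b) - (a', b)| <= `|a - a'|.
Proof. by rewrite [_ - _](_ : _ = (a - a', b - b)) // subrr pair_norm normr0 ge_max lexx /=. Qed.

Lemma pair_normBr (W1 W2 : normedModType R) (a : W1) (b b' : W2) : `|(a, b) - (a, b')| <= `|b - b'|.
Proof. by rewrite [_ - _](_ : _ = (a - a, b - b')) // subrr pair_norm normr0 ge_max lexx andbT. Qed.

Lemma rapprox_vint n : rapprox (@vint n).
Proof.
apply: (@rapprox_prod _ _ _ _ (fun a b => (a, b)) _ _ _ _ _ _ (@rapprox_rint n) (@rapprox_rint n)).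
- exact: pair_normBl.
- exact: pair_normBr.
- by move=> a b; rewrite pair_norm le_max lexx.
- by move=> a b; rewrite pair_norm le_max lexx orbT.
Qed.

End IteratedIntegral.

Section Reflection.
Context {R : realType}.

(** The inner coordinates are reflected by induction and the first one by the one-variable
    statement, whose continuity hypothesis is met by [ucont_slice]. *)
Lemma rint_reflect k (f : 'rV[R]_k -> R) M w : ucont f -> bsupp M f ->
  rint (fun v => f (w - v)) = rint f.
Proof.
elim: k f M w => [|k IH] f M w uf sf.
  by rewrite /=; congr (f _); apply/rowP => -[].
have [t0 [w' ->]] := consrV_surj w.
have uft t : ucont (fun v => f (consrV t v)).
  move=> e /uf[d d0 mf]; exists d => // u v uv; apply: mf.
  by rewrite consrVB subrr; apply: le_lt_trans uv; rewrite consrV_norm_le ?normr0.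
have sft t : bsupp M (fun v => f (consrV t v)).
  by move=> v Mv; apply: sf; apply: lt_le_trans (consrV_norm_ger _ _).
rewrite [LHS](_ : _ = \int[lebesgue_measure]_t
    (fun t => rint (fun v => f (consrV t v))) (t0 - t)); last first.
  apply: eq_Rintegral => t _ /=; rewrite -(IH _ M w' (uft _) (sft _)).
  by congr rint; apply/funext => v; rewrite -consrVB.
pose N := `|M| + 1; have M1 : M < N by rewrite ltr_pwDr // ler_norm.
have N0 : 0 < N by rewrite ltr_wpDl.
have zero t : N < `|t| -> rint (fun v => f (consrV t v)) = 0.
  move=> Nt; rewrite (_ : (fun v => _) = fun=> 0) ?(rapprox0 (@rapprox_rint R k)) //.
  apply/funext => v; apply: sf; apply: lt_le_trans (consrV_norm_gel _ _).
  exact: lt_trans Nt.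
apply: (@Rintegral_reflect _ (fun t => rint (fun v => f (consrV t v))) (- N) N); first lra.
- apply: ucont_continuous; apply: (ucont_slice (@rapprox_rint R k) uft sft).
  move=> e /uf[d d0 mf]; exists d => // v t t' tt'; apply: mf.
  by rewrite consrVB subrr; apply: le_lt_trans tt'; rewrite consrV_norm_le ?normr0.
- by move=> t tN; apply: zero; rewrite ltr0_norm; lra.
- by move=> t tN; apply: zero; rewrite gtr0_norm; lra.
Qed.

Lemma ucont_comp (W W' : normedModType R) (f : W -> R) (g : W' -> W) :
  (forall u v, `|g u - g v| <= `|u - v|) -> ucont f -> ucont (fun u => f (g u)).
Proof.
move=> gl uf e /uf[d d0 mf]; exists d => // u v uv; apply: mf.
exact: le_lt_trans (gl _ _) uv.
Qed.

Lemma vint_reflect n (f : 'CV[R]_n -> R) M x : ucont f -> bsupp M f ->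
  vint (fun y => f (x - y)) = vint f.
Proof.
case: x => x1 x2 uf sf; rewrite /vint.
have nl (a b : 'rV[R]_n) : `|a| <= `|(a, b)| by rewrite pair_norm le_max lexx.
have nr (a b : 'rV[R]_n) : `|b| <= `|(a, b)| by rewrite pair_norm le_max lexx orbT.
have ufa a : ucont (fun b => f (a, b)).
  by apply: (@ucont_comp _ _ f (fun b => (a, b))) => // u v; exact: pair_normBr.
have sfa a : bsupp M (fun b => f (a, b)).
  by move=> b Mb; apply: sf; apply: lt_le_trans (nr _ _).
rewrite [LHS](_ : _ = rint (fun a => (fun a => rint (fun b => f (a, b))) (x1 - a))); last first.
  congr rint; apply/funext => a; rewrite -(rint_reflect x2 (ufa _) (sfa _)).
  by congr rint; apply/funext => b.
apply: (@rint_reflect _ _ M).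
- apply: (ucont_slice (@rapprox_rint R n) ufa sfa).
  move=> e /uf[d d0 mf]; exists d => // v t t' tt'; apply: mf; apply: le_lt_trans tt'.
  exact: pair_normBl.
- move=> a Ma; rewrite (_ : (fun b => _) = fun=> 0) ?(rapprox0 (@rapprox_rint R n)) //.
  by apply/funext => b; apply: sf; apply: lt_le_trans (nl _ _).
Qed.

End Reflection.

(** * Integrals of radial functions *)

Section PlaneRadialIntegral.
Context {R : realType}.
Local Notation mu := (@lebesgue_measure R).

(** With F regarded as a function of the squared radius, this Abel transform integrates out one real
    coordinate, so 2n iterations evaluated at 0 give the integral over C^n. *)
Definition abel (F : R -> R) (r : R) : R := \int[mu]_t F (t ^+ 2 + r).

Lemma continuous_sqrD (r : R) : continuous (fun t : R => t ^+ 2 + r).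
Proof.
by move=> t; apply: cvgD; [exact: exprn_continuous | exact: cvg_cst].
Qed.

Lemma abel_integrable (F : R -> R) B r : continuous F -> (forall s, B <= s -> F s = 0) ->
  mu.-integrable setT (fun t => (F (t ^+ 2 + r))%:E).
Proof.
move=> cF FB; pose N := `|B| + `|r| + 1; have N1 : 1 <= N.
  by rewrite /N; have := normr_ge0 B; have := normr_ge0 r; lra.
have big t : N < `|t| -> F (t ^+ 2 + r) = 0.
  move=> Nt; apply: FB.
  have : N <= `|t| ^+ 2.
    by rewrite expr2; apply: le_trans (ltW Nt) _; rewrite ler_peMl //; lra.
  rewrite -normrX ger0_norm ?sqr_ge0 // /N.
  have := ler_norm B; have := ler_norm (- r); rewrite normrN; lra.
apply: (@integrable_csupp _ (fun t => F (t ^+ 2 + r)) (- N) N).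
- by move=> t; apply: continuous_comp; [exact: continuous_sqrD | exact: cF].
- by move=> t tN; apply: big; rewrite ltr0_norm; lra.
- by move=> t tN; apply: big; rewrite gtr0_norm; lra.
Qed.

Lemma abelE (F : R -> R) B r : continuous F -> (forall s, B <= s -> F s = 0) ->
  (abel F r)%:E = (\int[mu]_t (F (t ^+ 2 + r))%:E)%E.
Proof.
move=> cF FB; rewrite /abel /Rintegral fineK //.
exact: integrable_fin_num (abel_integrable r cF FB).
Qed.

Lemma abel_scale (F : R -> R) (a r : R) : a != 0 -> continuous F -> (forall s, 0 <= F s) ->
  (\int[mu]_t (F (t ^+ 2 + (a ^+ 2 + r)))%:E =
   \int[mu]_t (`|a| * F (a ^+ 2 * (1 + t ^+ 2) + r))%:E)%E.
Proof.
move=> a0 cF F0; have na0 : 0 < `|a| by rewrite normr_gt0.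
have dl (x : R) : is_derive x 1 (fun t : R => `|a| * t) `|a|.
  apply: (is_derive_eq (@is_deriveZ R R R id `|a| x 1 1 (is_derive_id x 1))).
  by rewrite /GRing.scale /= mulr1.
have d1 : (fun t : R => `|a| * t)^`()%classic = cst `|a|.
  by apply/funext => x; rewrite derive1E; case: (dl x).
rewrite (@increasing_ge0_integration_by_substitutionT _ (fun t => `|a| * t)
  (fun t => F (t ^+ 2 + (a ^+ 2 + r)))).
- apply: eq_integral => t _ /=; rewrite d1 /= /cst; congr EFin.
  rewrite [LHS]/GRing.mul /= mulrC; congr (_ * F _).
  by rewrite exprMn -normrX ger0_norm ?sqr_ge0 //; ring.
- by move=> x y xy; rewrite ltr_pM2l.
- by rewrite d1 => x; exact: cst_continuous.
- by rewrite d1; exact: is_cvg_cst.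
- by rewrite d1; exact: is_cvg_cst.
- by move=> x; case: (dl x).
- by apply: gt0_cvgMrNy => //; exact: cvg_id.
- by apply: gt0_cvgMry => //; exact: cvg_id.
- by move=> t; apply: continuous_comp; [exact: continuous_sqrD | exact: cF].
- by [].
Qed.

Lemma cvg_eventually0 (f : R -> R) N : (forall x, N <= x -> f x = 0) -> f x @[x --> +oo] --> 0.
Proof.
move=> f0; apply: cvg_near_cst; near=> x; apply: f0; near: x.
by apply: nbhs_pinfty_ge; exact: num_real.
Unshelve. all: by end_near. Qed.

(** The integral along one line through the origin, of slope t with k = 1 + t^2. The integrand is
    even, and on the half line it has the primitive -G(a^2 k + r) / (2k). *)
Lemma radial_half (F G : R -> R) B (k r : R) : 1 <= k -> continuous F -> (forall s, 0 <= F s) ->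
  (forall s, B <= s -> F s = 0) -> (forall s, B <= s -> G s = 0) ->
  (forall s : R, is_derive s 1 G (- F s)) ->
  (\int[mu]_a (`|a| * F (a ^+ 2 * k + r))%:E = (G r / k)%:E)%E.
Proof.
move=> k1 cF F0 FB GB dG; have k0 : 0 < k by lra.
have cin (x : R) : {for x, continuous (fun a : R => a ^+ 2 * k + r)}.
  apply: continuousD; last exact: cst_continuous.
  by apply: continuousM; [exact: exprn_continuous | exact: cst_continuous].
rewrite ge0_symfun_integralT /=; last 3 first.
- by move=> x; rewrite mulr_ge0.
- move=> x; apply: continuousM; first exact: norm_continuous.
  by apply: continuous_comp; [exact: cin | exact: cF].
- by move=> x /=; rewrite normrN sqrrN.
have -> : [set x : R | 0 <= x] = `[0, +oo[%classic.
  by apply/seteqP; split=> x /=; rewrite in_itv /= andbT.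
rewrite [X in (_ * X)%E](_ : _ =
    (\int[mu]_(a in `[0%R, +oo[) (a * F (a ^+ 2 * k + r))%:E)%E); last first.
  by apply: eq_integral => x; rewrite inE /= in_itv /= andbT => x0; rewrite ger0_norm.
pose P (a : R) := - (2 * k)^-1 * G (a ^+ 2 * k + r).
have dP (x : R) : is_derive x 1 P (x * F (x ^+ 2 * k + r)).
  have d0 : is_derive x 1 (fun a : R => a * a * k + r) (2 * x * k).
    apply: (is_derive_eq (is_deriveD (is_deriveM (is_deriveM (is_derive_id x 1) (is_derive_id x 1))
      (is_derive_cst k x 1)) (is_derive_cst r x 1))).
    by rewrite /GRing.scale /=; ring.
  have d1 : is_derive x 1 (fun a : R => a ^+ 2 * k + r) (2 * x * k) by [].
  have d2 := @is_derive1_comp _ G _ _ _ _ (dG _) d1.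
  have d3 := @is_deriveZ _ _ _ (G \o (fun a : R => a ^+ 2 * k + r)) (- (2 * k)^-1) _ _ _ d2.
  apply: (is_derive_eq d3); rewrite /GRing.scale /=; field; lra.
rewrite (@ge0_continuous_FTC2y _ (fun a => a * F (a ^+ 2 * k + r)) P 0 0).
- rewrite -EFinB -EFinM sub0r /P expr0n /= mul0r add0r; congr EFin; field; lra.
- by move=> x x0; rewrite mulr_ge0.
- apply: continuous_subspaceT => x; apply: continuousM; first exact: cvg_id.
  by apply: continuous_comp; [exact: cin | exact: cF].
- apply: (@cvg_eventually0 _ (`|B| + `|r| + 1)) => x xN.
  rewrite /P GB ?mulr0 //.
  have x1 : 1 <= x by apply: le_trans xN; have := normr_ge0 B; have := normr_ge0 r; lra.
  have x2 : x <= x ^+ 2 * k.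
    by rewrite expr2 -mulrA ler_peMr ?mulr_ege1 //; lra.
  have := ler_norm B; have := ler_norm (- r); rewrite normrN; lra.
- by move=> x _; case: (dP x).
- by apply: cvg_at_right_filter; apply: is_derive_continuous (dP 0).
- by move=> x _; rewrite derive1E; case: (dP x).
Qed.

Lemma measurable_slice (F : R -> R) (r : R) : continuous F ->
  measurable_fun setT (fun z : R * R => `|z.1| * F (z.1 ^+ 2 * (1 + z.2 ^+ 2) + r)).
Proof.
move=> cF; apply: measurable_funM.
  by apply: measurableT_comp => //; exact: measurable_fst.
apply: (@measurableT_comp _ _ _ _ _ _ F); first exact: continuous_measurable_fun.
apply: measurable_funD => //; apply: measurable_funM.
  by apply: measurable_funX; exact: measurable_fst.
by apply: measurable_funD => //; apply: measurable_funX; exact: measurable_snd.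
Qed.

Lemma measurable_plane (F : R -> R) (r : R) : continuous F ->
  measurable_fun setT (fun z : R * R => F (z.2 ^+ 2 + (z.1 ^+ 2 + r))).
Proof.
move=> cF.
apply: (@measurableT_comp _ _ _ _ _ _ F); first exact: continuous_measurable_fun.
apply: measurable_funD; first by apply: measurable_funX; exact: measurable_snd.
by apply: measurable_funD => //; apply: measurable_funX; exact: measurable_fst.
Qed.

Lemma decr_vanish_ge0 (F G : R -> R) B (r : R) : (forall s, 0 <= F s) ->
  (forall s, B <= s -> G s = 0) -> (forall s : R, is_derive s 1 G (- F s)) -> 0 <= G r.
Proof.
move=> F0 GB dG; rewrite -(GB (Num.max B r)); last by rewrite le_max lexx.
have xy : r <= Num.max B r by rewrite le_max lexx orbT.
have [c _ e] := @MVT_segment R G (fun s => - F s) r _ xy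
  (fun t _ => dG t) (continuous_subspaceT (fun t => is_derive_continuous (dG t))).
by rewrite -subr_le0 e mulNr oppr_le0 mulr_ge0 // subr_ge0.
Qed.

(* Slicing the plane by the lines through the origin, (a, b) = (a, a t). *)
Lemma abel_abel (F G : R -> R) B (r : R) : continuous F -> (forall s, 0 <= F s) ->
  (forall s, B <= s -> F s = 0) -> (forall s, B <= s -> G s = 0) ->
  (forall s : R, is_derive s 1 G (- F s)) ->
  abel (abel F) r = pi * G r.
Proof.
move=> cF F0 FB GB dG.
have mP := iffRL (measurable_EFinP _ _) (@measurable_plane F r cF).
have mS := iffRL (measurable_EFinP _ _) (@measurable_slice F r cF).
have P0 (z : R * R) : (0 <= (EFin \o (fun z : R * R => F (z.2 ^+ 2 + (z.1 ^+ 2 + r)))%R) z)%E.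
  by rewrite lee_fin.
have S0 (z : R * R) : (0 <= (EFin \o (fun z : R * R => `|z.1| * F (z.1 ^+ 2 * (1 + z.2 ^+ 2) + r))%R) z)%E.
  by rewrite lee_fin mulr_ge0.
have G0 : 0 <= G r := decr_vanish_ge0 r F0 GB dG.
rewrite {1}/abel /Rintegral.
rewrite [X in fine X](_ : _ = (\int[mu]_a \int[mu]_t (F (t ^+ 2 + (a ^+ 2 + r)))%:E)%E); last first.
  by apply: eq_integral => a _; rewrite (abelE _ cF FB).
pose h (a : R) := (\int[mu]_t (F (t ^+ 2 + (a ^+ 2 + r)))%:E)%E.
have mh := measurable_fun_fubini_tonelli_F (m2 := mu) _ mP P0.
(* The null line a = 0 is removed because b = |a| t is a change of variable only for a != 0. *)
have m0 : measurable ([set: R] `\ (0 : R)) by apply: measurableD.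
rewrite -/h -(@integral_setD1 _ h 0 setT m0); last exact: measurable_funS mh.
rewrite [X in fine X](_ : _ = (\int[mu]_(a in [set: R] `\ (0%R : R))
    \int[mu]_t (`|a : R| * F ((a : R) ^+ 2 * (1 + t ^+ 2) + r))%:E)%E); last first.
  by apply: eq_integral => a; rewrite inE => -[_ /eqP a0]; rewrite /h abel_scale.
have mk := measurable_fun_fubini_tonelli_F (m2 := mu) _ mS S0.
rewrite (@integral_setD1 _ _ 0 setT m0); last exact: measurable_funS mk.
(* After the exchange the inner integral is G(r) / (1 + t^2), and the integral of 1 / (1 + t^2) over
   the line produces the factor pi. *)
have sw := @fubini_tonelli _ _ _ _ _ mu mu _ mS S0.
rewrite /= in sw; rewrite [X in fine X]sw {sw}.
under eq_integral => t _.
  rewrite /= (@radial_half F G B (1 + t ^+ 2) r) //; last by rewrite lerDl sqr_ge0.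
  over.
rewrite [X in fine X](_ : _ = (\int[mu]_t ((G r)%:E * ((oneDsqr (t : R))^-1)%:E))%E); last first.
  by apply: eq_integral => t _; rewrite -EFinM.
rewrite ge0_integralZl_EFin //; last first.
  apply/measurable_EFinP; apply: measurable_funTS; apply: continuous_measurable_fun.
  exact: continuous_oneDsqrV.
rewrite ge0_symfun_integralT; last 3 first.
- by move=> t; rewrite invr_ge0 (le_trans ler01).
- exact: continuous_oneDsqrV.
- by move=> t; rewrite /= /oneDsqr sqrrN.
have -> : [set x : R | 0 <= x] = `[0, +oo[%classic.
  by apply/seteqP; split=> x /=; rewrite in_itv /= andbT.
by rewrite integral0y_oneDsqr -!EFinM /=; field.
Qed.

Lemma primitive_csupp (F : R -> R) B : continuous F -> (forall s, B <= s -> F s = 0) ->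
  exists G : R -> R, (forall s, B <= s -> G s = 0) /\
    forall s : R, is_derive s 1 G (- F s).
Proof.
move=> cF FB; pose f t := F (B - t).
have dr (x : R) : is_derive x 1 (fun t : R => B - t) (- 1).
  by rewrite -[- 1]add0r; apply: is_deriveB.
have cr : continuous (fun t : R => B - t).
  by move=> t; apply: is_derive_continuous (dr t).
have cf : continuous f by move=> t; apply: continuous_comp; [exact: cr | exact: cF].
have f0 t : t <= 0 -> f t = 0 by move=> t0; apply: FB; lra.
have [A [A0 dA]] := antiderivative cf f0.
exists (fun s => A (B - s)); split=> [s Bs|s]; first by apply: A0; lra.
rewrite (_ : - F s = f (B - s) * -1); last by rewrite /f subKr mulrN1.
exact: (@is_derive1_comp _ A (fun t => B - t) _ _ _ (dA _) (dr _)).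
Qed.

Lemma derive0_eq (f : R -> R) : (forall x : R, is_derive x 1 f 0) -> forall x y, f x = f y.
Proof.
move=> df; suff le x y : x <= y -> f x = f y.
  by move=> x y; case: (leP x y) => [/le //|/ltW/le ->].
move=> xy; have [c _] := @MVT_segment R f (fun=> 0) x y xy (fun t _ => df t)
  (continuous_subspaceT (fun t => is_derive_continuous (df t))).
by rewrite mul0r => /eqP; rewrite subr_eq0 => /eqP.
Qed.

(** The polar formula in dimension 2m+2: pi^(m+1) / m! times the integral of s^m F(s) over [0, B].
    Two Abel transforms replace F by pi G with G' = -F, and integration by parts, recorded in [Q],
    turns s^m G into s^(m+1) F / (m+1). *)
Lemma iter_abel m (F P : R -> R) B : 0 <= B -> continuous F -> (forall s, 0 <= F s) ->
  (forall s, B <= s -> F s = 0) ->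
  (forall s : R, is_derive s 1 P (s ^+ m * F s)) ->
  iter (m.+1 + m.+1) abel F 0 * m`!%:R = pi ^+ m.+1 * (P B - P 0).
Proof.
elim: m F P => [|m IH] F P B0 cF F0 FB dP.
all: have [G [GB dG]] := primitive_csupp cF FB.
  rewrite /= (abel_abel 0 cF F0 FB GB dG) mulr1 expr1; congr (_ * _).
  have -> : G 0 = G 0 - G B by rewrite (GB B) // subr0.
  apply/eqP; rewrite subr_eq addrAC -subr_eq opprK; apply/eqP.
  rewrite [RHS]addrC; apply: (@derive0_eq (fun s => G s + P s)) => x.
  have := is_deriveD (dG x) (dP x); rewrite expr0 mul1r addNr.
  exact.
have G0 s : 0 <= G s := decr_vanish_ge0 s F0 GB dG.
have -> : iter (m.+2 + m.+2) abel F 0 = iter (m.+1 + m.+1) abel (fun s => pi * G s) 0.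
  have -> : (m.+2 + m.+2)%N = (m.+1 + m.+1).+2 by rewrite addSn addnS.
  rewrite 2!iterSr; congr (iter _ _ _ _).
  by apply/funext => s; exact: (abel_abel s cF F0 FB GB dG).
pose Q s := (pi / m.+1%:R) * (s ^+ m.+1 * G s + P s).
have dQ (s : R) : is_derive s 1 Q (s ^+ m * (pi * G s)).
  have d1 : is_derive s 1 (fun s : R => s ^+ m.+1) (m.+1%:R * s ^+ m).
    by apply: (DeriveDef (@exprn_derivable _ _ _ _)); rewrite -derive1E exp_derive1.
  have d2 := is_deriveM d1 (dG s).
  have d3 := is_deriveZ (pi / m.+1%:R) (is_deriveD d2 (dP s)).
  by apply: (is_derive_eq d3); rewrite /GRing.scale /=; field; rewrite ?natr1 ?nat1r pnatr_eq0.
have := IH (fun s => pi * G s) Q B0 _ _ _ dQ.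
rewrite factS natrM => IH'.
rewrite mulrCA [iter _ _ _ _ * _]IH'.
- by rewrite /Q (GB B (lexx B)) expr0n /= mulr0 mul0r !add0r [in RHS]exprSr; field; rewrite ?natr1 ?nat1r pnatr_eq0.
- by move=> s; apply: cvgM; [exact: cvg_cst | exact: is_derive_continuous (dG s)].
- by move=> s; rewrite mulr_ge0 // pi_ge0.
- by move=> s Bs; rewrite GB // mulr0.
Qed.

Definition sqn {n} (z : 'CV[R]_n) : R := \sum_j (z.1 0 j ^+ 2 + z.2 0 j ^+ 2).

Lemma rint_radial k (F : R -> R) (r : R) :
  rint (fun v : 'rV[R]_k => F (\sum_i v 0 i ^+ 2 + r)) = iter k abel F r.
Proof.
elim: k r => [|k IH] r; first by rewrite /= big_ord0 add0r.
rewrite [LHS](_ : _ = \int[mu]_t iter k abel F (t ^+ 2 + r)) //.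
apply: eq_Rintegral => t _; rewrite -IH; congr rint; apply/funext => v.
rewrite -/(consrV t v) big_ord_recl consrV0.
under eq_bigr do rewrite consrVS.
by congr F; rewrite addrCA addrA.
Qed.

Lemma vint_radial n (F : R -> R) : vint (fun z : 'CV[R]_n => F (sqn z)) = iter (n + n) abel F 0.
Proof.
rewrite iterD -rint_radial /vint; congr rint; apply/funext => a.
rewrite -rint_radial addr0; congr rint; apply/funext => b; congr F.
by rewrite /sqn big_split /= addrC.
Qed.

End PlaneRadialIntegral.

(** * Smooth functions and bounded functionals *)

Section DirectionalDerivatives.
Context {R : realType}.

Lemma is_derive_lineP (W : normedModType R) (f : W -> R) (z v : W) (d : R) :
  is_derive z v f d <-> is_derive (0 : R) 1 (fun t : R => f (t *: v + z)) d.
Proof.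
have E : 'D_v f z = 'D_1 (fun t : R => f (t *: v + z)) 0.
  rewrite /derive; have -> // : (fun h : R => h^-1 *: ((f \o shift z) (h *: v) - f z)) =
    (fun h : R => h^-1 *: (((fun t : R => f (t *: v + z)) \o shift 0) (h *: 1) - f (0 *: v + z))).
  by apply/funext => h /=; rewrite addr0 scale0r add0r [_%:A]mulr1.
split=> -[df <-]; apply: DeriveDef.
- exact: (derivable1P f z v).1.
- by rewrite E.
- exact: (derivable1P f z v).2.
- by rewrite E.
Qed.

Lemma is_derive_comp1 (W : normedModType R) (F : R -> R) (q : W -> R) (z v : W) (a b : R) :
  is_derive (q z) 1 F a -> is_derive z v q b -> is_derive z v (fun w => F (q w)) (a * b).
Proof.
move=> dF /is_derive_lineP dq; apply/is_derive_lineP.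
have dF' : is_derive (q (0 *: v + z)) 1 F a by rewrite scale0r add0r.
exact: (@is_derive1_comp _ F (fun t : R => q (t *: v + z)) 0 _ _ dF' dq).
Qed.

Lemma is_derive_bound (W : normedModType R) (f : W -> R) (x v : W) (l : R) :
  (forall e : R, 0 < e -> exists2 d : R, 0 < d & forall h : R, h != 0 -> `|h| < d ->
     `|h^-1 * (f (h *: v + x) - f x) - l| <= e) -> is_derive x v f l.
Proof.
move=> H; have lim : h^-1 *: ((f \o shift x) (h *: v) - f x) @[h --> (0 : R)^'] --> l.
  apply/cvgrPdist_le => e e0; have [d d0 Hd] := H e e0.
  near=> h; rewrite distrC /= ; apply: Hd.
  - near: h; exact: nbhs_dnbhs_neq.
  - near: h; apply: dnbhs0_lt => //.
split; first by apply/cvg_ex; exists l.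
exact/cvg_lim.
Unshelve. all: by end_near. Qed.

Lemma is_derive_translate (W : normedModType R) (f : W -> R) (c : R) (x z v : W) (d : R) :
  is_derive (c *: z + x) v f d -> is_derive z v (fun w => f (c *: w + x)) (c * d).
Proof.
move=> /is_derive_lineP df; apply/is_derive_lineP.
have dc : is_derive (0 : R) 1 (fun t : R => c * t) c.
  apply: (is_derive_eq (@is_deriveZ R R R id c (0 : R) (1 : R) 1 (is_derive_id (0 : R) (1 : R)))).
  by rewrite /GRing.scale /= mulr1.
have df' : is_derive (c * 0) 1 (fun t : R => f (t *: v + (c *: z + x))) d by rewrite mulr0.
rewrite mulrC; have := @is_derive1_comp _ _ (fun t : R => c * t) 0 _ _ df' dc.
congr (is_derive _ _ _ _); apply/funext => t /=.
by rewrite scalerDr scalerA addrA.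
Qed.

End DirectionalDerivatives.

(** * Uniform continuity and boundedness from compact support *)

Section HeineCantor.
Context {R : realType}.

Lemma compact_ball_rV n (M : R) : compact [set v : 'rV[R]_n | `|v| <= M].
Proof.
apply: bounded_closed_compact; last first.
  apply: (@closed_comp _ _ (fun v : 'rV[R]_n => `|v|) [set r | r <= M]).
    by move=> v _; exact: norm_continuous.
  exact: closed_le.
by exists M; split=> [|N MN v /= vM]; rewrite ?num_real // (le_trans vM) // ltW.
Qed.

Lemma compact_ballCV n (M : R) : compact [set z : 'CV[R]_n | `|z| <= M].
Proof.
have -> : [set z : 'CV[R]_n | `|z| <= M] = [set v | `|v| <= M] `*` [set v | `|v| <= M].
  by apply/seteqP; split=> -[a b] /=; rewrite pair_norm ge_max => /andP.
by apply: compact_setX; apply: compact_ball_rV.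
Qed.

(** The margin 1 in the radius of the compact ball matters: if one of two points closer than 1 lies
    outside that ball, both lie off the support and nothing is to be compared. *)
Lemma heine_cantor (W : normedModType R) (f : W -> R) M :
  compact [set v : W | `|v| <= M + 1] -> continuous f -> bsupp M f -> ucont f.
Proof.
move=> cK cf sf e e0.
have /compact_near_coveringP ncK := cK.
have e2 : 0 < e / 2 by rewrite divr_gt0.
pose P (d : R) (x : W) := forall y, `|x - y| < d -> `|f x - f y| <= e.
have H : \forall d \near (0 : R)^'+, [set v : W | `|v| <= M + 1] `<=` P d.
  apply: ncK => x _.
  have /cvgrPdist_le/(_ _ e2)/nbhs_normP[r /= r0 Hr] := cf x.
  have r2 : 0 < r / 2 by rewrite divr_gt0.
  exists ([set x' | `|x - x'| < r / 2], [set d : R | d < r / 2]) => /=.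
    split; last by exact: nbhs_right_lt.
    by apply/nbhs_normP; exists (r / 2).
  move=> [x' d] /= [xx' dr] y x'y.
  have h1 : `|f x - f x'| <= e / 2 by apply: Hr; rewrite /ball_ /=; lra.
  have h2 : `|f x - f y| <= e / 2.
    apply: Hr; rewrite /ball_ /= (_ : x - y = (x - x') + (x' - y)); last by rewrite addrA subrK.
    by apply: le_lt_trans (ler_normD _ _) _; lra.
  rewrite (_ : _ - _ = (f x - f y) - (f x - f x')); last by ring.
  by apply: le_trans (ler_normB _ _) _; lra.
near ((0 : R)^'+) => d.
have d0 : 0 < d by near: d; exact: nbhs_right_gt.
have d1 : d < 1 by near: d; exact: nbhs_right_lt.
have Hd : [set v : W | `|v| <= M + 1] `<=` P d by near: d.
exists d => // u v uv; case: (leP `|u| (M + 1)) => [uM|uM]; first exact: Hd.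
rewrite [f u]sf; last by lra.
rewrite [f v]sf ?subrr ?normr0 ?ltW //.
have : `|u| <= `|u - v| + `|v| by rewrite -{1}(subrK v u) ler_normD.
lra.
Unshelve. all: by end_near. Qed.

Lemma ucont_csuppCV n (f : 'CV[R]_n -> R) M : continuous f -> bsupp M f -> ucont f.
Proof. by apply: heine_cantor; apply: compact_ballCV. Qed.

Lemma bounded_csuppCV n (f : 'CV[R]_n -> R) M : continuous f -> bsupp M f ->
  exists2 B : R, 0 <= B & forall z, `|f z| <= B.
Proof.
move=> cf sf; have /compact_bounded[B [Br HB]] :
    compact (f @` [set z : 'CV[R]_n | `|z| <= M]).
  apply: continuous_compact; last exact: compact_ballCV.
  exact: continuous_subspaceT.
exists (`|B| + 1); first by rewrite addr_ge0.
move=> z; case: (leP `|z| M) => [zM|/sf ->]; last by rewrite normr0 addr_ge0.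
by apply: (HB (`|B| + 1)); [rewrite ltr_pwDr // ler_norm | exists z].
Qed.

End HeineCantor.

Section SmoothAlgebra.
Context {R : realType} {n : nat}.
Implicit Types (f g h : 'CV[R]_n -> R) (a : gen n) (z : 'CV[R]_n).

Definition smooth f := smooth_on setT f.

(** The algebra generated by a class [B] and the constants. When the first derivatives of members of
    [B] belong to it, it is stable under all partial derivatives; smoothness then follows from one
    derivative computation, without formulas of higher order. *)
Inductive falg (B : ('CV[R]_n -> R) -> Prop) : ('CV[R]_n -> R) -> Prop :=
| falg_base f : B f -> falg B f
| falg_cst c : falg B (fun=> c)
| falg_add f g : falg B f -> falg B g -> falg B (fun z => f z + g z)
| falg_mul f g : falg B f -> falg B g -> falg B (fun z => f z * g z).

Lemma falg_smooth (B : ('CV[R]_n -> R) -> Prop) :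
  (forall f, B f -> continuous f /\ forall a, exists2 g, falg B g &
     forall z, is_derive z (basev a) f (g z)) ->
  forall f, falg B f -> smooth f.
Proof.
move=> HB; have HA f : falg B f -> continuous f /\ forall a, exists2 g, falg B g &
     forall z, is_derive z (basev a) f (g z).
  elim=> {f} [f /HB //|c|f g Af [cf df] Ag [cg dg]|f g Af [cf df] Ag [cg dg]].
  - split=> [|a]; first exact: cst_continuous.
    by exists (fun=> 0); [exact: falg_cst | move=> z; exact: is_derive_cst].
  - split=> [z|a]; first by apply: cvgD; [exact: cf | exact: cg].
    have [f' Af' df'] := df a; have [g' Ag' dg'] := dg a.
    by exists (fun z => f' z + g' z); [exact: falg_add | move=> z; exact: is_deriveD].
  - split=> [z|a]; first by apply: cvgM; [exact: cf | exact: cg].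
    have [f' Af' df'] := df a; have [g' Ag' dg'] := dg a.
    exists (fun z => f z * g' z + g z * f' z); last by move=> z; exact: is_deriveM.
    by apply: falg_add; apply: falg_mul.
have HD f (l : seq (gen n)) : falg B f -> falg B (pderivs l f).
  move=> Af; elim: l => //= a l IH.
  have [g Ag dg] := (HA _ IH).2 a.
  by rewrite (_ : (fun z => _) = g) //; apply/funext => z; case: (dg z).
move=> f Af l z _; have [c d] := HA _ (HD f l Af); split=> [|a]; first exact: c.
by have [g _ dg] := d a; case: (dg z).
Qed.

Lemma smooth_continuous f : smooth f -> continuous f.
Proof. by move=> sf z; have [] := sf [::] z I. Qed.

Lemma smooth_is_derive f z a : smooth f -> is_derive z (basev a) f ('D_(basev a) f z).
Proof. by move=> sf; apply/derivableP; have [_] := sf [::] z I; apply. Qed.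

Lemma smooth_derive f a : smooth f -> smooth ('D_(basev a) f).
Proof.
move=> sf l z _; have := sf (l ++ [:: a]) z I.
by rewrite /pderivs foldr_cat.
Qed.

Lemma falg_of_smooth f : falg smooth f -> smooth f.
Proof.
apply: falg_smooth => g sg; split=> [|a]; first exact: smooth_continuous.
exists ('D_(basev a) g); last by move=> z; apply: smooth_is_derive.
exact/falg_base/smooth_derive.
Qed.

Lemma smooth_cst c : smooth (fun=> c).
Proof. exact/falg_of_smooth/falg_cst. Qed.

Lemma smoothDf f g : smooth f -> smooth g -> smooth (fun z => f z + g z).
Proof. by move=> sf sg; apply/falg_of_smooth/falg_add; apply: falg_base. Qed.

Lemma smoothM f g : smooth f -> smooth g -> smooth (fun z => f z * g z).
Proof. by move=> sf sg; apply/falg_of_smooth/falg_mul; apply: falg_base. Qed.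

Lemma smoothZ c f : smooth f -> smooth (fun z => c * f z).
Proof. by move=> sf; apply: smoothM => //; apply: smooth_cst. Qed.

Lemma smoothB f g : smooth f -> smooth g -> smooth (fun z => f z - g z).
Proof.
move=> sf sg; rewrite (_ : (fun z => _) = fun z => f z + (-1) * g z).
  exact: smoothDf sf (smoothZ _ sg).
by apply/funext => z; rewrite mulN1r.
Qed.

Lemma smooth_affine f (c : R) (x : 'CV[R]_n) : smooth f -> smooth (fun z => f (c *: z + x)).
Proof.
pose B g := exists2 f, smooth f & g = (fun z => f (c *: z + x)).
move=> sf; apply: (@falg_smooth B); last by apply: falg_base; exists f.
move=> _ [{sf} f sf ->]; split=> [z|a].
  apply: continuous_comp; last exact: smooth_continuous.
  by apply: cvgD; [apply: cvgZr; exact: cvg_id | exact: cvg_cst].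
exists (fun z => c * 'D_(basev a) f (c *: z + x)).
  apply: falg_mul; first exact: falg_cst.
  by apply: falg_base; exists ('D_(basev a) f) => //; apply: smooth_derive.
by move=> z; apply: is_derive_translate; apply: smooth_is_derive.
Qed.

Lemma derive_affine f (c : R) (x z : 'CV[R]_n) a : smooth f ->
  'D_(basev a) (fun z => f (c *: z + x)) z = c * 'D_(basev a) f (c *: z + x).
Proof.
by move=> sf; have [_ ->] := is_derive_translate (smooth_is_derive (c *: z + x) a sf).
Qed.

Lemma bsupp_derive f a M : bsupp M f -> bsupp M ('D_(basev a) f).
Proof.
move=> sf z Mz; rewrite (@near_eq_derive _ _ _ f (fun=> 0)) ?derive_cst //.
near=> w; apply: sf; near: w.
apply: (cvgr_gt `|z|) => //; exact: norm_continuous.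
Unshelve. all: by end_near. Qed.

Lemma CV_norm_le z B : 0 <= B -> (forall a, `|if a.2 then z.2 0 a.1 else z.1 0 a.1| <= B) -> `|z| <= B.
Proof.
move=> B0 H; case: z H => x y H; rewrite pair_norm ge_max; apply/andP; split; apply: rV_norm_le => // i.
  exact: (H (i, false)).
exact: (H (i, true)).
Qed.

Lemma basev_norm a : `|basev a : 'CV[R]_n| <= 1.
Proof.
apply: CV_norm_le => // b; case: a b => [j e] [k e'] /=; rewrite /basev /=.
by case: e e' => -[] /=; rewrite !mxE ?normr0 ?ler01 //; case: (_ && _);
  rewrite ?normr1 ?normr0 ?ler01.
Qed.

End SmoothAlgebra.

Section TestFunctions.
Context {R : realType} {n : nat}.
Implicit Types (f g h : 'CV[R]_n -> R) (a : gen n) (z : 'CV[R]_n).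

Definition ccs f := smooth f /\ exists M, bsupp M f.

Lemma ccs_ucont f : ccs f -> ucont f.
Proof. by move=> [sf [M bf]]; apply: ucont_csuppCV bf; apply: smooth_continuous. Qed.

Lemma ccs_derive f a : ccs f -> ccs ('D_(basev a) f).
Proof. by move=> [sf [M bf]]; split; [exact: smooth_derive | exists M; exact: bsupp_derive]. Qed.

Lemma ccsD f g : ccs f -> ccs g -> ccs (fun z => f z + g z).
Proof.
move=> [sf [M bf]] [sg [N bg]]; split; first exact: smoothDf.
exists (Num.max M N); apply: bsuppD.
  by apply: bsupp_le bf; rewrite le_max lexx.
by apply: bsupp_le bg; rewrite le_max lexx orbT.
Qed.

Lemma ccsM f g : ccs f -> smooth g -> ccs (fun z => f z * g z).
Proof.
move=> [sf [M bf]] sg; split; first exact: smoothM.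
by exists M => z Mz; rewrite bf // mul0r.
Qed.

Lemma ccsZ c f : ccs f -> ccs (fun z => c * f z).
Proof.
move=> [sf [M bf]]; split; first exact: smoothZ.
by exists M; apply: bsuppZ.
Qed.

Lemma bsupp_affine M f (c : R) (x : 'CV[R]_n) : `|c| = 1 -> bsupp M f ->
  bsupp (M + `|x|) (fun z => f (c *: z + x)).
Proof.
move=> c1 bf z Mz; apply: bf.
have : `|z| <= `|c *: z + x| + `|x|.
  rewrite -{1}[`|z|]mul1r -c1 -normrZ -{1}(addrK x (c *: z)).
  exact: ler_normB.
lra.
Qed.

Lemma ccs_affine f (c : R) (x : 'CV[R]_n) : `|c| = 1 -> ccs f -> ccs (fun z => f (c *: z + x)).
Proof.
move=> c1 [sf [M bf]]; split; first exact: smooth_affine.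
by exists (M + `|x|); exact: bsupp_affine.
Qed.

Lemma ccs_trans f (y : 'CV[R]_n) : ccs f -> ccs (fun x => f (x - y)).
Proof.
move=> cf; have := @ccs_affine f 1 (- y) (normr1 _) cf.
by under eq_fun do rewrite scale1r.
Qed.

Lemma ccs_refl f (y : 'CV[R]_n) : ccs f -> ccs (fun x => f (y - x)).
Proof.
move=> cf; have := @ccs_affine f (-1) y (normrN1 _) cf.
by under eq_fun do rewrite scaleN1r addrC.
Qed.

(** The mean value theorem together with uniform continuity of the derivative. Uniformity in z is
    what allows a functional bounded in the sup norm to be differentiated under its sign. *)
Lemma uniform_quotient f a : ccs f -> forall e : R, 0 < e ->
  exists2 d : R, 0 < d & forall h : R, h != 0 -> `|h| < d -> forall z,
  `|h^-1 * (f (h *: basev a + z) - f z) - 'D_(basev a) f z| <= e.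
Proof.
move=> cf e e0; have [d d0 m] := ccs_ucont (ccs_derive a cf) e0.
exists d => // h h0 hd z; have [sf _] := cf.
pose g (t : R) := f (t *: basev a + z).
have dg (t : R) : is_derive t 1 g ('D_(basev a) f (t *: basev a + z)).
  have := (is_derive_lineP f (t *: basev a + z) (basev a) _).1 (smooth_is_derive _ a sf).
  move=> d1; have d2 : is_derive t 1 (fun s : R => s - t) 1.
    exact: is_derive_shift.
  have d3 : is_derive (t - t) 1 (fun s : R => f (s *: basev a + (t *: basev a + z)))
      ('D_(basev a) f (t *: basev a + z)) by rewrite subrr.
  have := @is_derive1_comp _ _ (fun s : R => s - t) t _ _ d3 d2; rewrite mulr1.
  congr (is_derive _ _ _ _); apply/funext => s /=.
  by rewrite addrA -scalerDl subrK.
have [c [ch ->]] : exists c, `|c| <= `|h| /\ h^-1 * (f (h *: basev a + z) - f z) =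
    'D_(basev a) f (c *: basev a + z).
  have g0 : f z = g 0 by rewrite /g scale0r add0r.
  have cg (s t : R) : {within `[s, t], continuous g}.
    by apply: continuous_subspaceT => x; apply: is_derive_continuous (dg x).
  case: (ltP 0 h) => [hp|hn].
    have [c] := @MVT R g _ 0 h hp (fun t _ => dg t) (cg _ _).
    rewrite in_itv /= subr0 => /andP[c0 ch] e1; exists c; split.
      by rewrite !ger0_norm // ltW.
    by rewrite g0 -/(g h) e1 mulrC mulfK.
  have hn' : h < 0 by rewrite lt_neqAle h0.
  have [c] := @MVT R g _ h 0 hn' (fun t _ => dg t) (cg _ _).
  rewrite in_itv /= sub0r => /andP[c0 ch] e1; exists c; split.
    by rewrite !ler0_norm ?lerN2 // ltW.
  have e2 : g h - g 0 = 'D_(basev a) f (c *: basev a + z) * h.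
    by rewrite -opprB e1 mulrN opprK.
  by rewrite g0 -/(g h) e2 mulrC mulfK.
apply: m; rewrite addrK normrZ.
apply: le_lt_trans hd; apply: le_trans ch.
by rewrite ler_piMr // basev_norm.
Qed.

(** A real distribution of order 0 whose bound does not depend on the support, as for a coefficient
    of a current of bounded mass. *)
Definition bfunctional (l : ('CV[R]_n -> R) -> R) :=
  (forall c f g, ccs f -> ccs g -> l (fun z => c * f z + g z) = c * l f + l g) /\
  exists2 C : R, 0 <= C & forall f B, ccs f -> (forall z, `|f z| <= B) -> `|l f| <= C * B.

Section Functional.
Variable l : ('CV[R]_n -> R) -> R.
Hypothesis bl : bfunctional l.

Lemma bfunctional_ucont f : ccs f -> ucont (fun y => l (fun x => f (x - y))).
Proof.
move=> cf; have [lin [C C0 HC]] := bl.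
move=> e e0; have c0 : 0 < C + 1 by lra.
have [d d0 m] := ccs_ucont cf (divr_gt0 e0 c0); exists d => // y y' yy'.
rewrite -[X in X - _]mul1r; have -> : 1 * l (fun x => f (x - y)) - l (fun x => f (x - y')) =
    l (fun x => (-1) * f (x - y') + f (x - y)).
  by rewrite lin; [ring | exact: ccs_trans..].
apply: le_trans (mul_divS_le C0 (ltW e0)); apply: HC.
  by apply: ccsD; [apply: ccsZ|]; apply: ccs_trans.
move=> z; rewrite mulN1r addrC; apply: m.
by rewrite opprB addrC addrA subrK distrC.
Qed.

(** The difference quotients of the translates converge uniformly, so the functional passes to the
    limit; the sign comes from the argument x - y. *)
Lemma bfunctional_derive f a y : ccs f ->
  is_derive y (basev a) (fun y => l (fun x => f (x - y)))
    ((-1) * l (fun x => 'D_(basev a) f (x - y))).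
Proof.
move=> cf; have [lin [C C0 HC]] := bl.
apply: is_derive_bound => e e0; have c0 : 0 < C + 1 by lra.
have [d d0 m] := uniform_quotient a cf (divr_gt0 e0 c0).
exists d => // h h0 hd.
set f1 := fun x => f (x - (h *: basev a + y)); set f0 := fun x => f (x - y).
set f' := fun x => 'D_(basev a) f (x - y).
have c1 : ccs f1 by exact: ccs_trans.
have c2 : ccs f0 by exact: ccs_trans.
have c3 : ccs f' by exact: (ccs_trans y (ccs_derive a cf)).
have -> : h^-1 * (l f1 - l f0) - -1 * l f' =
    l (fun x => h^-1 * ((-1) * f0 x + f1 x) + f' x).
  rewrite lin //; last by apply: ccsD => //; apply: ccsZ.
  by rewrite lin //; ring.
apply: le_trans (mul_divS_le C0 (ltW e0)); apply: HC.
  by apply: ccsD => //; apply/ccsZ/ccsD => //; apply: ccsZ.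
move=> x; have := m (- h); rewrite oppr_eq0 normrN => /(_ h0 hd (x - y)).
rewrite /f1 /f0 /f' invrN (_ : - h *: basev a + (x - y) = x - (h *: basev a + y)); last first.
  by rewrite scaleNr opprD addrCA.
by rewrite -normrN; congr (`|_| <= _); ring.
Qed.

Lemma bfunctional_smooth f : ccs f -> smooth (fun y => l (fun x => f (x - y))).
Proof.
pose B g := exists2 f, ccs f & g = (fun y => l (fun x => f (x - y))).
move=> cf; apply: (@falg_smooth _ _ B); last by apply: falg_base; exists f.
move=> _ [{cf} f cf ->]; split=> [|a].
  by apply: ucont_continuous; apply: bfunctional_ucont.
exists (fun y => (-1) * l (fun x => 'D_(basev a) f (x - y))).
  apply: falg_mul; first exact: falg_cst.
  by apply: falg_base; exists ('D_(basev a) f) => //; apply: ccs_derive.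
by move=> y; apply: bfunctional_derive.
Qed.

End Functional.

End TestFunctions.

(** * The radial kernel *)

Section Convexifier.
Context {R : realType}.
Variable chi : R -> R.
Hypothesis hchi : convexifier chi.

Local Notation chin k := (derive1n k chi).

Lemma chin_is_derive k (t : R) : is_derive t 1 (chin k) (chin k.+1 t).
Proof.
apply: DeriveDef; first by case: hchi.
by rewrite -derive1E derive1nS.
Qed.

Lemma near_lt (a t : R) : t < a -> \forall s \near t, s < a.
Proof. by move=> ta; apply: open_nbhs_nbhs; split; [exact: open_lt |]. Qed.

Lemma near_gt (a t : R) : a < t -> \forall s \near t, a < s.
Proof. by move=> ta; apply: open_nbhs_nbhs; split; [exact: open_gt |]. Qed.

Lemma derive_near_unique (f g : R -> R) (t a b : R) : (\forall s \near t, f s = g s) ->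
  is_derive t 1 f a -> is_derive t 1 g b -> a = b.
Proof. by move=> fg [_ <-] [_ <-]; apply: near_eq_derive. Qed.

Lemma chin_lt k (t : R) : t < -1 -> chin k t = 0.
Proof.
elim: k t => [|k IH] t t1.
  by case: hchi => _ [_ _ _ H _]; rewrite derive1n0 H // ltW.
apply: (@derive_near_unique (chin k) (fun=> 0) t _ 0 _ (chin_is_derive k t) (is_derive_cst _ _ _)).
by apply: filterS (near_lt t1) => s; apply: IH.
Qed.

Lemma chin1_gt (t : R) : 1 < t -> chin 1 t = 1.
Proof.
move=> t1; apply: (@derive_near_unique chi id t _ 1 _ (chin_is_derive 0 t) (is_derive_id _ _)).
apply: filterS (near_gt t1) => s s1.
by case: hchi => _ [_ _ _ _ H]; rewrite H // ltW.
Qed.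

Lemma chin_gt k (t : R) : 1 < t -> chin k.+2 t = 0.
Proof.
elim: k t => [|k IH] t t1.
  apply: (@derive_near_unique (chin 1) (fun=> 1) t _ 0 _ (chin_is_derive 1 t) (is_derive_cst _ _ _)).
  by apply: filterS (near_gt t1) => s; apply: chin1_gt.
apply: (@derive_near_unique (chin k.+2) (fun=> 0) t _ 0 _ (chin_is_derive k.+2 t) (is_derive_cst _ _ _)).
by apply: filterS (near_gt t1) => s; apply: IH.
Qed.

Lemma chi_convex (a b t : R) : 0 <= t <= 1 ->
  chi ((1 - t) * a + t * b) <= (1 - t) * chi a + t * chi b.
Proof.
case: hchi => _ [cv _ _ _ _] /andP[t0 t1].
pose T : {i01 R} := Itv01 t0 t1.
have aT (x : R) : x \in [set: R^o] by rewrite inE.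
have cv' : chi (t * b + (1 - t) * a) <= t * chi b + (1 - t) * chi a := cv T b a (aT b) (aT a).
by rewrite addrC [leRHS]addrC.
Qed.

(** By convexity every difference quotient at [a] with step below b - a is at most the slope of the
    chord, and the derivative is their limit. *)
Lemma chin1_slope_le (a b : R) : a < b -> chin 1 a <= (chi b - chi a) / (b - a).
Proof.
move=> ab; have ba : 0 < b - a by lra.
have [df dE] := chin_is_derive 0 a.
have lim : (fun h : R => h^-1 *: ((chi \o shift a) (h *: 1) - chi a)) @ (0 : R)^'+ --> chin 1 a.
  by rewrite -dE; apply: cvg_dnbhs_at_right; exact: df.
rewrite leNgt; apply/negP => lt.
have H : \forall h \near (0 : R)^'+, (chi b - chi a) / (b - a) <
    h^-1 *: ((chi \o shift a) (h *: 1) - chi a) by apply: (cvgr_gt (chin 1 a)).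
near ((0 : R)^'+) => h; have h0 : 0 < h by near: h; exact: nbhs_right_gt.
have hb : h < b - a by near: h; exact: nbhs_right_lt.
pose t := h / (b - a).
have t01 : 0 <= t <= 1.
  apply/andP; split; first by apply: divr_ge0; exact: ltW.
  by rewrite /t ler_pdivrMr // mul1r ltW.
have : (chi b - chi a) / (b - a) < h^-1 *: ((chi \o shift a) (h *: 1) - chi a) by near: h.
apply/negP; rewrite -leNgt; have := chi_convex a b t01; rewrite (_ : (1 - t) * a + t * b = h + a); last first.
  by rewrite /t; field; lra.
rewrite /= [h *: 1]mulr1 /GRing.scale /= => c.
rewrite ler_pdivlMr // -mulrA ler_pdivrMl //.
have x1 : chi (h + a) - chi a <= h / (b - a) * (chi b - chi a) by move: c; rewrite /t; lra.
by rewrite mulrAC ler_pdivlMr // in x1.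
Unshelve. all: by end_near. Qed.

(** If chi''(t) were negative, chi' would lie below chi'(t) just to the right of t. By the mean
    value theorem the slope of a short chord starting at t is such a value of chi', which
    contradicts the bound on slopes. *)
Lemma chin2_ge0 (t : R) : 0 <= chin 2 t.
Proof.
rewrite leNgt; apply/negP => t0.
have [df dE] := chin_is_derive 1 t.
have lim : (fun h : R => h^-1 *: ((chin 1 \o shift t) (h *: 1) - chin 1 t)) @ (0 : R)^'+ --> chin 2 t.
  by rewrite -dE; apply: cvg_dnbhs_at_right; exact: df.
have H : \forall h \near (0 : R)^'+, h^-1 *: ((chin 1 \o shift t) (h *: 1) - chin 1 t) < 0.
  by apply: (cvgr_lt (chin 2 t)).
have /nbhs_ballP[d /= d0 Hd] : nbhs (0 : R) (fun h : R => 0 < h ->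
    h^-1 *: ((chin 1 \o shift t) (h *: 1) - chin 1 t) < 0) by exact: H.
have td : t < t + d by rewrite ltrDl.
have := chin1_slope_le td; rewrite [t + d]addrC addrK [d + t]addrC.
have [c] := @MVT R chi (chin 1) t (t + d) td (fun s _ => chin_is_derive 0 s)
  (continuous_subspaceT (fun s => is_derive_continuous (chin_is_derive 0 s))).
have dn0 : d != 0 by rewrite gt_eqF.
rewrite in_itv /= => /andP[tc cd] ->; rewrite [t + d]addrC addrK (mulfK dn0) => le.
have ct : 0 < c - t by rewrite subr_gt0.
have : ball (0 : R) d (c - t) by rewrite /ball /= sub0r normrN (gtr0_norm ct) ltrBlDl.
move=> /Hd /(_ ct); rewrite /= /GRing.scale /= mulr1 subrK; apply/negP; rewrite -leNgt.
by apply: mulr_ge0; [rewrite invr_ge0 ltW | rewrite subr_ge0].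
Qed.

Section RadialProfiles.
Variable lam : R.

(* chi^(k)(log|z| - lam) / |z|^(2 m) as a function of s = |z|^2, extended by 0 to s <= 0,
   where the library has [ln s = 0]. *)
Definition bkm (k m : nat) (s : R) : R :=
  if 0 < s then chin k (ln s / 2 - lam) * s ^- m else 0.

Lemma bkm_lt k m s : s < expR (2 * (lam - 1)) -> bkm k m s = 0.
Proof.
rewrite /bkm; case: ifP => // s0 sl; rewrite chin_lt ?mul0r //.
have : ln s < 2 * (lam - 1) by rewrite -[ltRHS]expRK ltr_ln // posrE expR_gt0.
lra.
Qed.

Lemma ln_gt s : expR (2 * (lam + 1)) < s -> 1 < ln s / 2 - lam.
Proof.
move=> sl; have s0 : 0 < s by apply: lt_trans sl; exact: expR_gt0.
have : 2 * (lam + 1) < ln s by rewrite -[ltLHS]expRK ltr_ln // posrE expR_gt0.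
lra.
Qed.

Lemma bkm_gt k m s : expR (2 * (lam + 1)) < s -> bkm k.+2 m s = 0.
Proof. by move=> sl; rewrite /bkm chin_gt ?ln_gt // mul0r if_same. Qed.

Lemma bkm10_gt s : expR (2 * (lam + 1)) < s -> bkm 1 0 s = 1.
Proof.
move=> sl; rewrite /bkm (lt_trans (expR_gt0 _) sl) chin1_gt ?ln_gt //.
by rewrite expr0 invr1 mulr1.
Qed.

Lemma bkm2_ge0 m s : 0 <= bkm 2 m s.
Proof.
rewrite /bkm; case: ifP => // s0.
by rewrite mulr_ge0 ?chin2_ge0 // invr_ge0 exprn_ge0 // ltW.
Qed.

Lemma bkm_mul k m j s : s ^+ j * bkm k (j + m) s = bkm k m s.
Proof.
rewrite /bkm; case: ifP => s0; last by rewrite mulr0.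
by rewrite exprD invfM mulrCA mulVKf // expf_neq0 // gt_eqF.
Qed.

(** The derivative of ln s / 2 is 1 / (2s), so the family is closed under differentiation up to
    linear combinations. At s <= 0 there is nothing to compute: the function vanishes below
    exp(2(lam - 1)), hence near s. *)
Lemma bkm_is_derive k m (s : R) :
  is_derive s 1 (bkm k m) (2^-1 * bkm k.+1 m.+1 s - m%:R * bkm k m.+1 s).
Proof.
case: (ltP 0 s) => s0; last first.
  have sl : s < expR (2 * (lam - 1)) by apply: le_lt_trans s0 (expR_gt0 _).
  rewrite !bkm_lt // !mulr0 subrr.
  apply: (near_eq_is_derive _ (is_derive_cst (0 : R) s 1)).
  by apply: filterS (near_lt sl) => t tl; rewrite bkm_lt.
have d1 : is_derive s 1 (fun t : R => ln t / 2 - lam) (s^-1 * 2^-1).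
  have d0 := is_deriveB (is_deriveM (is_derive1_ln s0) (is_derive_cst (2^-1 : R) s 1)) (is_derive_cst lam s 1).
  by apply: (is_derive_eq d0); rewrite /GRing.scale /= mulr0 add0r subr0 mulrC.
have d2 := @is_derive1_comp _ _ (fun t : R => ln t / 2 - lam) s _ _ (chin_is_derive k _) d1.
have d3 : is_derive s 1 (fun t : R => t ^- m) (- (m%:R * s ^- m.+1)).
  have dX : is_derive s 1 (fun t : R => t ^+ m) (m%:R * s ^+ m.-1).
    by apply: (DeriveDef (@exprn_derivable _ _ _ _)); rewrite -derive1E exp_derive1.
  have sm : s ^+ m != 0 by rewrite expf_neq0 // gt_eqF.
  have dV := is_deriveV (f := fun t : R => t ^+ m) sm dX.
  apply: (is_derive_eq dV); rewrite /GRing.scale /= mulNr; congr (- _).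
  case: m {dX dV} sm => [|m] sm; first by rewrite !mul0r mulr0.
  by rewrite /= mulrCA; congr (_ * _); rewrite !exprS; field; rewrite expf_neq0 ?gt_eqF.
have d4 := is_deriveM d2 d3.
apply: (near_eq_is_derive _ (is_derive_eq d4 _)).
  by apply: filterS (near_gt s0) => t t0; rewrite /bkm t0.
rewrite /bkm s0 /GRing.scale /= !exprS; field.
by rewrite expf_neq0 ?gt_eqF.
Qed.

Lemma bkm_continuous k m : continuous (bkm k m).
Proof. by move=> s; apply: is_derive_continuous (bkm_is_derive k m s). Qed.

End RadialProfiles.

Section Kernel.
Variables (n : nat) (lam : R).
Hypothesis n0 : (0 < n)%N.
Local Notation b := (bkm lam).
Implicit Types (z : 'CV[R]_n) (a : gen n).

Definition coordv a z : R := if a.2 then z.2 0 a.1 else z.1 0 a.1.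

Lemma coordv_basev a a' : coordv a (basev a') = (a == a')%:R.
Proof.
case: a a' => [j e] [k e']; rewrite /coordv /basev xpair_eqE /=.
by case: e e' => -[] /=; rewrite !mxE ?andbF ?andbT ?eqxx.
Qed.

Lemma coordv_lin a c z z' : coordv a (c *: z + z') = c * coordv a z + coordv a z'.
Proof. by rewrite /coordv; case: ifP => _; rewrite !mxE. Qed.

Lemma coordv_is_derive a a' z : is_derive z (basev a') (coordv a) (a == a')%:R.
Proof.
apply/is_derive_lineP; rewrite -coordv_basev.
rewrite (_ : (fun t : R => _) = fun t : R => t * coordv a (basev a') + coordv a z); last first.
  by apply/funext => t; rewrite coordv_lin.
have dd := is_deriveD (is_deriveM (is_derive_id (0 : R) (1 : R)) (is_derive_cst (coordv a (basev a')) (0 : R) 1))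
  (is_derive_cst (coordv a z) (0 : R) 1).
by apply: (is_derive_eq dd); rewrite /GRing.scale /= mulr0 add0r mulr1 addr0.
Qed.

Lemma coordv_continuous a : continuous (coordv a).
Proof.
case: a => j [] z.
  apply: (@continuous_comp _ _ _ snd (fun x : 'rV[R]_n => x 0 j)); last exact: coord_continuous.
  exact: cvg_snd.
apply: (@continuous_comp _ _ _ fst (fun x : 'rV[R]_n => x 0 j)); last exact: coord_continuous.
exact: cvg_fst.
Qed.

Lemma sqnE z : sqn z = \sum_(a : gen n) coordv a z ^+ 2.
Proof.
rewrite /sqn (eq_bigr (fun j => \sum_(e : bool) coordv (j, e) z ^+ 2)).
  by rewrite pair_bigA /=; apply: eq_bigr => -[].
by move=> j _; rewrite big_bool /= addrC.
Qed.

Lemma sqn_is_derive a z : is_derive z (basev a) sqn (2 * coordv a z).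
Proof.
apply/is_derive_lineP.
rewrite (_ : (fun t : R => _) = fun t : R => t * t + (t * (2 * coordv a z) + sqn z)); last first.
  apply/funext => t; rewrite !sqnE.
  under eq_bigr => a' _ do rewrite coordv_lin coordv_basev.
  rewrite (bigD1 a) //= [in RHS](bigD1 a) //= eqxx.
  rewrite (eq_bigr (fun a' => coordv a' z ^+ 2)) => [|a' aa']; first by rewrite mulr1; ring.
  by rewrite (negPf aa') mulr0 add0r.
have dd := is_deriveD (is_deriveM (is_derive_id (0 : R) (1 : R)) (is_derive_id (0 : R) (1 : R)))
 (is_deriveD (is_deriveM (is_derive_id (0 : R) (1 : R)) (is_derive_cst (2 * coordv a z) (0 : R) 1))
  (is_derive_cst (sqn z) (0 : R) 1)).
by apply: (is_derive_eq dd); rewrite /GRing.scale /=; ring.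
Qed.

Lemma sqn_continuous : continuous (@sqn R n).
Proof.
move=> z; rewrite (_ : @sqn R n = fun z => \sum_(a : gen n) coordv a z ^+ 2); last first.
  by apply/funext => w; rewrite sqnE.
apply: cvg_big => [|a _]; first exact: add_continuous.
by apply: cvgM; exact: coordv_continuous.
Qed.

Lemma sqn_ge0 z : 0 <= sqn z.
Proof. by rewrite sqnE sumr_ge0 // => a _; rewrite sqr_ge0. Qed.

Lemma norm_le_sqn z : `|z| ^+ 2 <= sqn z.
Proof.
have h : `|z| <= Num.sqrt (sqn z).
  apply: CV_norm_le => [|a]; first exact: sqrtr_ge0.
  rewrite -/(coordv a z) -sqrtr_sqr ler_sqrt ?sqn_ge0 // sqnE (bigD1 a) //= lerDl sumr_ge0 // => a' _.
  exact: sqr_ge0.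
by rewrite -[leRHS]sqr_sqrtr ?sqn_ge0 // lerXn2r ?nnegrE ?normr_ge0 ?sqrtr_ge0.
Qed.

Lemma bkm_sqn_smooth k m : smooth (fun z : 'CV[R]_n => b k m (sqn z)).
Proof.
pose B (f : 'CV[R]_n -> R) := (exists k m, f = fun z => b k m (sqn z)) \/ exists a, f = coordv a.
apply: (@falg_smooth _ _ B); last by apply: falg_base; left; exists k, m.
move=> _ [{k m} [k [m ->]]|[a ->]]; split=> [|a'].
- move=> z; apply: continuous_comp; [exact: sqn_continuous | exact: bkm_continuous].
- exists (fun z => (2^-1 * b k.+1 m.+1 (sqn z) + - m%:R * b k m.+1 (sqn z)) * (2 * coordv a' z)).
    apply: falg_mul; [apply: falg_add; apply: falg_mul | apply: falg_mul];
      try exact: falg_cst; apply: falg_base.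
    + by left; exists k.+1, m.+1.
    + by left; exists k, m.+1.
    + by right; exists a'.
  move=> z; apply: is_derive_comp1 (sqn_is_derive a' z).
  by rewrite mulNr; exact: bkm_is_derive.
- exact: coordv_continuous.
- exists (fun=> (a == a')%:R); first exact: falg_cst.
  by move=> z; exact: coordv_is_derive.
Qed.

(** The constant is (2/pi)^n 2^(-n-1) n!/n. The first factor is the n-th power of (-2i)(i/pi), from
    the volume form and from dd^c; the second comes from the radial computation in [K_thetaE]; n! is
    the coefficient of [beta ^+ n], and the division by n undoes the multiple in [K_thetaE]. *)
Definition kern z : R := (n.-1)`!%:R / (2 * pi ^+ n) * b 2 n (sqn z).

Lemma kern_ge0 z : 0 <= kern z.
Proof.
by rewrite mulr_ge0 ?bkm2_ge0 // divr_ge0 // mulr_ge0 // exprn_ge0 // pi_ge0.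
Qed.

Lemma kern_bsupp : bsupp (expR (lam + 1)) kern.
Proof.
move=> z Mz; rewrite /kern bkm_gt ?mulr0 //.
apply: lt_le_trans (norm_le_sqn z).
by rewrite mulrC -[2]/(2%:R) expRM_natr ltrXn2r ?nnegrE ?expR_ge0 ?normr_ge0.
Qed.

Lemma kern_ccs : ccs kern.
Proof. by split; [apply/smoothZ/bkm_sqn_smooth | exists (expR (lam + 1)); exact: kern_bsupp]. Qed.

Lemma kern_opp z : kern (- z) = kern z.
Proof.
congr (_ * b _ _ _); rewrite !sqnE; apply: eq_bigr => a _.
by rewrite -[- z]addr0 -scaleN1r coordv_lin mulN1r {2}/coordv !mxE if_same addr0 sqrrN.
Qed.

(** In the polar formula the weight s^(n-1) reduces the profile to chi''(ln s / 2 - lam) / s, the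
    derivative of 2 chi'(ln s / 2 - lam). As chi' goes from 0 to 1, the mass is 2c pi^n / (n-1)! =
    1. *)
Lemma vint_kern : vint kern = 1.
Proof.
pose c : R := (n.-1)`!%:R / (2 * pi ^+ n).
pose B := expR (2 * (lam + 1)) + 1.
have B0 : 0 <= B by rewrite addr_ge0 ?expR_ge0.
have Bl : expR (2 * (lam + 1)) < B by rewrite ltrDl.
have pi0 : pi != 0 :> R by rewrite gt_eqF ?pi_gt0.
have c0 : 0 <= c by rewrite divr_ge0 // mulr_ge0 // exprn_ge0 // pi_ge0.
have dP (s : R) : is_derive s 1 (fun s => 2 * c * b 1 0 s) (s ^+ n.-1 * (c * b 2 n s)).
  have dd := is_deriveZ (2 * c) (bkm_is_derive lam 1 0 s); apply: (is_derive_eq dd).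
  have -> : b 2 n s = b 2 (n.-1 + 1)%N s by rewrite addn1 prednK.
  by rewrite [RHS]mulrCA (bkm_mul lam 2 1 n.-1 s) /GRing.scale /= mul0r subr0; field.
have := @iter_abel R n.-1 (fun s => c * b 2 n s) _ B B0 _ _ _ dP.
rewrite prednK // -vint_radial -/kern => H.
have f0 : (n.-1)`!%:R != 0 :> R by rewrite pnatr_eq0 -lt0n fact_gt0.
apply: (mulIf f0); rewrite -/c in H; rewrite mul1r H.
- rewrite bkm10_gt // bkm_lt ?expR_gt0 // mulr0 subr0 mulr1 /c; field.
  by rewrite expf_neq0.
- by move=> s; apply: cvgM; [exact: cvg_cst | exact: bkm_continuous].
- by move=> s; rewrite mulr_ge0 ?bkm2_ge0.
- by move=> s Bs; rewrite bkm_gt ?mulr0 //; apply: lt_le_trans Bs.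
Qed.

End Kernel.

End Convexifier.

(** * The form K_theta as a convolution kernel *)

Section ComplexDerivatives.
Context {R : realType} {n : nat}.
Implicit Types (f g : 'CV[R]_n -> R[i]) (h k : R[i]).

Definition is_cderive (z v : 'CV[R]_n) f h :=
  is_derive z v (fun w => Re (f w)) (Re h) /\
  is_derive z v (fun w => Im (f w)) (Im h).

Lemma is_cderiveD z v f g h k : is_cderive z v f h -> is_cderive z v g k ->
  is_cderive z v (fun w => f w + g w) (h + k).
Proof.
move=> [fr fi] [gr gi]; split.
- have := is_deriveD fr gr; rewrite -[_ + Re k]raddfD; congr is_derive.
  by apply/funext => w; rewrite raddfD.
- have := is_deriveD fi gi; rewrite -[_ + Im k]raddfD; congr is_derive.
  by apply/funext => w; rewrite raddfD.
Qed.

Lemma is_cderiveZr z v f h (c : R[i]) :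
  is_cderive z v f h -> is_cderive z v (fun w => f w * c) (h * c).
Proof.
case: c => a b [fr fi]; split.
- have := is_deriveB (is_deriveZ a fr) (is_deriveZ b fi); congr is_derive.
    apply/funext => w; rewrite -[LHS]/(a * Re (f w) - b * Im (f w)).
    by case: (f w) => p q /=; ring.
  by case: h {fr fi} => p q; rewrite /GRing.scale /=; ring.
- have := is_deriveD (is_deriveZ b fr) (is_deriveZ a fi); congr is_derive.
    apply/funext => w; rewrite -[LHS]/(b * Re (f w) + a * Im (f w)).
    by case: (f w) => p q /=; ring.
  by case: h {fr fi} => p q; rewrite /GRing.scale /=; ring.
Qed.

Lemma is_cderive_cst z v h : is_cderive z v (fun=> h) 0.
Proof. by split; apply: is_derive_cst. Qed.

Lemma is_cderive_sum z v (T : Type) (r : seq T) (F : T -> 'CV[R]_n -> R[i]) (H : T -> R[i]) :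
  (forall i, is_cderive z v (F i) (H i)) ->
  is_cderive z v (fun w => \sum_(i <- r) F i w) (\sum_(i <- r) H i).
Proof.
move=> FH; elim: r => [|i r IH].
  rewrite big_nil (_ : (fun w => _) = fun=> 0); first exact: is_cderive_cst.
  by apply/funext => w; rewrite big_nil.
rewrite big_cons (_ : (fun w => _) = fun w => F i w + \sum_(i <- r) F i w); first exact: is_cderiveD.
by apply/funext => w; rewrite big_cons.
Qed.

Lemma is_derive_near (z v : 'CV[R]_n) (f g : 'CV[R]_n -> R) (a : R) :
  (\forall w \near z, f w = g w) -> is_derive z v f a -> is_derive z v g a.
Proof.
move=> fg [df <-]; split; first exact: near_eq_derivable fg df.
exact/esym/near_eq_derive.
Qed.

Lemma is_cderive_near (z v : 'CV[R]_n) f g h :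
  (\forall w \near z, f w = g w) -> is_cderive z v f h -> is_cderive z v g h.
Proof.
move=> fg [fr fi]; split.
- by apply: is_derive_near fr; apply: filterS fg => w ->.
- by apply: is_derive_near fi; apply: filterS fg => w ->.
Qed.

Lemma is_cderive_real (z v : 'CV[R]_n) (f : 'CV[R]_n -> R) (a : R) :
  is_derive z v f a -> is_cderive z v (fun w => (f w)%:C) a%:C.
Proof. by split => //=; apply: is_derive_cst. Qed.

Lemma cpderivE a f z h : is_cderive z (basev a) f h -> cpderiv a f z = h.
Proof. by case: h => p q [[_ /= fr] [_ /= fi]]; rewrite /cpderiv fr fi. Qed.

End ComplexDerivatives.

Section KernelForm.
Context {R : realType} {n : nat}.
Implicit Types (p q : 'CV[R]_(n + n)) (z : 'CV[R]_n).
Local Notation A := (ext R (n + n)).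

Definition dif p : 'CV[R]_n := pr_x p - pr_y p.

Lemma dif_lin (t : R) p q : dif (t *: p + q) = t *: dif p + dif q.
Proof.
by congr pair; apply/matrixP => i j; rewrite /dif !mxE /=; ring.
Qed.

Lemma dif_gl (a : gen n) : dif (basev (gl a)) = basev a.
Proof.
case: a => j []; congr pair; apply/matrixP => i k; rewrite /dif !mxE /= ?mxE ?ord1 ?subr0 //.
all: by rewrite eqxx /= !(inj_eq (@lshift_inj _ _)) eq_rlshift subr0.
Qed.

Lemma dif_gr (a : gen n) : dif (basev (gr a)) = - basev a.
Proof.
case: a => j []; congr pair; apply/matrixP => i k; rewrite /dif !mxE /= ?mxE ?ord1 ?subr0 ?oppr0 //.
all: by rewrite eqxx /= !(inj_eq (@rshift_inj _ _)) eq_lrshift sub0r.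
Qed.

Lemma coordv_dif (a : gen n) p : coordv a (dif p) = coordv (gl a) p - coordv (gr a) p.
Proof. by rewrite /coordv /=; case: ifP => _; rewrite !mxE. Qed.

Lemma sqn_dif_continuous : continuous (fun p => sqn (dif p)).
Proof.
move=> p; rewrite (_ : (fun p => _) = fun p => \sum_(a : gen n) coordv a (dif p) ^+ 2); last first.
  by apply/funext => w; rewrite sqnE.
apply: cvg_big => [|a _]; first exact: add_continuous.
have c : coordv a (dif q) @[q --> p] --> coordv a (dif p).
  rewrite coordv_dif (_ : (fun q => coordv a (dif q)) = fun q => coordv (gl a) q - coordv (gr a) q).
    by apply: cvgB; exact: coordv_continuous.
  by apply/funext => q; rewrite coordv_dif.
exact: (cvgM c c).
Qed.

Lemma pairCVK (x y : 'CV[R]_n) : pr_x (pairCV x y) = x /\ pr_y (pairCV x y) = y.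
Proof. by case: x y => a b [c d]; rewrite /pr_x /pr_y /= !row_mxKl !row_mxKr. Qed.

Lemma dif_is_derive (f : 'CV[R]_n -> R) p (v : 'CV[R]_(n + n)) (w : 'CV[R]_n) (c d : R) :
  dif v = c *: w -> is_derive (dif p) w f d -> is_derive p v (fun q => f (dif q)) (c * d).
Proof.
move=> vw df; apply/is_derive_lineP.
have df' : is_derive (c *: (0 : R) + 0 : R) 1 (fun t : R => f (t *: w + dif p)) d.
  by rewrite scaler0 addr0; exact: (is_derive_lineP f (dif p) w d).1.
have := is_derive_translate df'; congr is_derive.
apply/funext => t; rewrite dif_lin vw scalerA addr0.
by rewrite /GRing.scale /= mulrC.
Qed.

Lemma dif_is_cderive (f : 'CV[R]_n -> R[i]) p (v : 'CV[R]_(n + n)) (w : 'CV[R]_n) (c : R) (d : R[i]) :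
  dif v = c *: w -> is_cderive (dif p) w f d ->
  is_cderive p v (fun q => f (dif q)) (c%:C * d).
Proof.
move=> vw [fr fi]; split.
- have := dif_is_derive vw fr; congr is_derive; case: d {fr fi} => a b /=; ring.
- have := dif_is_derive vw fi; congr is_derive; case: d {fr fi} => a b /=; ring.
Qed.

Definition wirt (b : bool) (d : gen n -> R[i]) (j : 'I_n) : R[i] :=
  2^-1 * (d (j, false) + (-1) ^+ (~~ b) * 'i * d (j, true)).

Lemma wirtinger_form_dif b (T : finType) (H : T -> 'CV[R]_n -> R[i]) (d : T -> gen n -> R[i])
    (e : T -> A) (Psi : dform R (n + n)) p (k : 'I_(n + n)) (j : 'I_n) (c : R) :
  (forall i a, is_cderive (dif p) (basev a) (H i) (d i a)) ->
  (\forall q \near p, Psi q = \sum_i H i (dif q) *: e i) ->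
  (forall e, dif (basev (k, e)) = c *: basev (j, e)) ->
  wirtinger_form (k, b) Psi p = \sum_i (c%:C * wirt b (d i) j) *: e i :> A.
Proof.
move=> Hd Psip kj; apply/ffunP => K; rewrite ffunE sum_ffunE.
have dP e' : cpderiv (k, e') (fun w => Psi w K) p = \sum_i c%:C * d i (j, e') * e i K.
  apply: cpderivE; apply: (@is_cderive_near _ _ _ _ (fun q => \sum_i H i (dif q) * e i K)).
    apply: filterS Psip => q ->; rewrite sum_ffunE; apply: eq_bigr => i _; by rewrite extZE.
  apply: is_cderive_sum => i; apply/is_cderiveZr/(dif_is_cderive (kj e')); exact: Hd.
rewrite /wirtinger !dP mulr_sumr -big_split mulr_sumr /=; apply: eq_bigr => i _.
rewrite extZE /wirt; ring.
Qed.

(** Coefficients depending on x - y alone have opposite derivatives along x_j and y_j, so the two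
    generators combine into [eta (j, b)]. The finite sum in the hypothesis lets the lemma serve both
    delbar of a function and del of the form obtained. *)
Lemma wirtinger_sum_dif b (T : finType) (H : T -> 'CV[R]_n -> R[i]) (d : T -> gen n -> R[i])
    (e : T -> A) (Psi : dform R (n + n)) p :
  (forall i a, is_cderive (dif p) (basev a) (H i) (d i a)) ->
  (\forall q \near p, Psi q = \sum_i H i (dif q) *: e i) ->
  \sum_k wedge (covg (k, b)) (wirtinger_form (k, b) Psi p) =
    \sum_i (\sum_j wirt b (d i) j *: eta (j, b)) * e i :> A.
Proof.
move=> Hd Psip; rewrite big_split_ord /= -big_split /=.
transitivity (\sum_j (eta (j, b) * (\sum_i wirt b (d i) j *: e i) : A)).
  apply: eq_bigr => j _; rewrite mulrBl; congr (_ + _).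
    rewrite (wirtinger_form_dif (j := j) (c := 1) b Hd Psip) => [|a].
      by congr (_ * _ : A); apply: eq_bigr => i _; rewrite mul1r.
    by rewrite scale1r -dif_gl.
  rewrite (wirtinger_form_dif (j := j) (c := -1) b Hd Psip) => [|a].
    rewrite -mulrN; congr (_ * _ : A); rewrite -sumrN; apply: eq_bigr => i _.
    by rewrite rmorphN1 mulN1r scaleNr.
  by rewrite scaleN1r -dif_gr.
rewrite (eq_bigr (fun j => \sum_i (eta (j, b) * (wirt b (d i) j *: e i)))) => [|j _]; last first.
  exact: mulr_sumr.
rewrite exchange_big; apply: eq_bigr => i _; rewrite mulr_suml; apply: eq_bigr => j _.
by rewrite -scalerAr -scalerAl.
Qed.

Definition wz (j : 'I_n) z : R[i] := coordv (j, false) z +i* coordv (j, true) z.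

Lemma delbar_radial (F : R -> R) (F1 : R) (f : 'CV[R]_(n + n) -> R) p :
  (\forall q \near p, f q = F (sqn (dif q))) -> is_derive (sqn (dif p)) 1 F F1 ->
  delbar (fform f) p = \sum_j (F1%:C * wz j (dif p)) *: eta (j, true) :> A.
Proof.
move=> fF dF; have dH (u : unit) a : is_cderive (dif p) (basev a) (fun z => (F (sqn z))%:C)
    (F1 * (2 * coordv a (dif p)))%:C.
  by apply: is_cderive_real; apply: is_derive_comp1 dF _; exact: sqn_is_derive.
rewrite /delbar (wirtinger_sum_dif true (e := fun _ : unit => 1) dH); last first.
  by apply: filterS fF => q fq; rewrite (big_pred1 tt) => [|[]//]; rewrite /fform fq.
rewrite (big_pred1 tt) => [|[]//]; rewrite mulr1; apply: eq_bigr => j _; congr (_ *: _).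
rewrite /wirt expr0 mul1r /wz; have h2 : 2 != 0 :> R[i] by rewrite pnatr_eq0.
by apply: (mulfI h2); rewrite mulVKf //; simpc; congr (_ +i* _); ring.
Qed.

Lemma near_comp_sqn (P : R -> Prop) p : (\forall s \near sqn (dif p), P s) ->
  \forall q \near p, P (sqn (dif q)).
Proof. by move=> H; apply: (@sqn_dif_continuous p); exact: H. Qed.

(** The identity ddbar F(s) = F'' del s /\ delbar s + F' ddbar s. The hypotheses are local at [p],
    as log s is differentiable only off the diagonal. *)
Lemma del_delbar_radial (F F1 : R -> R) (F2 : R) (f : 'CV[R]_(n + n) -> R) p :
  (\forall q \near p, f q = F (sqn (dif q))) ->
  (\forall s \near sqn (dif p), is_derive (s : R) 1 F (F1 s)) ->
  is_derive (sqn (dif p)) 1 F1 F2 ->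
  del (delbar (fform f)) p =
    F2%:C *: tau (fun j => (wz j (dif p))^*) (fun j => wz j (dif p)) +
    (F1 (sqn (dif p)))%:C *: beta :> A.
Proof.
move=> /near_join fF /near_comp_sqn dF dF1; set z := dif p.
pose H (j : 'I_n) w : R[i] := (F1 (sqn w))%:C * wz j w.
pose d (j : 'I_n) a : R[i] := (F2 * (2 * coordv a z))%:C * wz j z +
  (F1 (sqn z))%:C * ((a == (j, false))%:R +i* (a == (j, true))%:R).
have dH j a : is_cderive z (basev a) (H j) (d j a).
  have dF1' := is_derive_comp1 dF1 (sqn_is_derive a z).
  have x1 := is_deriveM dF1' (coordv_is_derive (j, false) a z).
  have x2 := is_deriveM dF1' (coordv_is_derive (j, true) a z).
  split.
  - move: x1; congr is_derive.
      by apply/funext => w; rewrite /H /wz /=; simpc.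
    by rewrite /d /wz ![(_, _) == a]eq_sym /GRing.scale /=; ring.
  - move: x2; congr is_derive.
      by apply/funext => w; rewrite /H /wz /=; simpc.
    by rewrite /d /wz ![(_, _) == a]eq_sym /GRing.scale /=; ring.
rewrite /del (wirtinger_sum_dif false (e := fun j => eta (j, true)) dH); last first.
  by apply: filterS2 fF dF => q fq dq; apply: delbar_radial.
have wE j k : wirt false (d k) j = F2%:C * ((wz j z)^* * wz k z) + (F1 (sqn z))%:C * (j == k)%:R.
  rewrite /wirt /d /= expr1 !xpair_eqE !andbT !andbF; have h2 : 2 != 0 :> R[i] by rewrite pnatr_eq0.
  apply: (mulfI h2); rewrite mulVKf // /wz; case: (j == k); simpc; congr (_ +i* _); ring.
rewrite /tau mulr_sumr scaler_sumr /beta [X in _ + X]scaler_sumr -big_split; apply: eq_bigr => k _ /=.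
rewrite (eq_bigr (fun j => F2%:C *: ((wz j z)^* *: eta (j, false)) * (wz k z)%:A +
  ((F1 (sqn z))%:C * (j == k)%:R) *: eta (j, false))) => [|j _]; last first.
  by rewrite wE scalerDl mulrA -!scalerAl mulr_algr !scalerA mulrAC.
rewrite big_split /= mulrDl; congr (_ + _).
  by rewrite -mulr_suml -mulrA mulr_algl -scaler_sumr -scalerAl.
rewrite (bigD1 k) //= eqxx mulr1 big1 ?addr0 ?scalerAl // => j /negPf ->.
by rewrite mulr0 scale0r.
Qed.

End KernelForm.

Section KernelFormula.
Context {R : realType} {n : nat}.
Variable chi : R -> R.
Hypothesis hchi : convexifier chi.
Hypothesis n0 : (0 < n)%N.
Variable theta : R[i].
Let lam := logmod theta.
Local Notation b := (bkm chi lam).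
Local Notation A := (ext R (n + n)).
Implicit Types (p q : 'CV[R]_(n + n)).

Lemma ln_sqrt (s : R) : 0 < s -> ln (Num.sqrt s) = ln s / 2.
Proof.
move=> s0; have r0 : 0 < Num.sqrt s by rewrite sqrtr_gt0.
by rewrite -{2}(sqr_sqrtr (ltW s0)) expr2 lnM ?posrE //; field.
Qed.

(** The value 0 given to [bkm] at s = 0 agrees with chi at minus infinity, so the formula holds
    across the diagonal without exception. *)
Lemma u_thetaE p : u_theta chi theta p = b 0 0 (sqn (dif p)) + lam.
Proof.
rewrite /u_theta /bkm /u_ker -/lam -subr_eq0 -/(dif p); case: eqP => [->|/eqP z0].
  by rewrite (_ : sqn 0 = 0) ?ltxx ?add0r // /sqn big1 // => j _; rewrite !mxE expr0n /= addr0.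
have s0 : 0 < sqn (dif p).
  by apply: lt_le_trans (norm_le_sqn _); rewrite exprn_gt0 // normr_gt0.
by rewrite s0 /eucl -/(sqn _) ln_sqrt // expr0 invr1 mulr1.
Qed.

Lemma ddcE (f : 'CV[R]_(n + n) -> R) p :
  ddc (fform f) p = ('i / pi%:C) *: (del (delbar (fform f)) p : A).
Proof. by []. Qed.

Lemma sum_wz (z : 'CV[R]_n) : \sum_j (wz j z)^* * wz j z = (sqn z)%:C.
Proof.
rewrite /sqn rmorph_sum; apply: eq_bigr => j _; rewrite /wz /coordv /=; simpc.
by congr (_ +i* _); ring.
Qed.

Lemma ddc_u_theta p : let s := sqn (dif p) in
  ddc (fform (u_theta chi theta)) p = ('i / pi%:C) *:
    ((2^-1 * (2^-1 * b 2 2 s - b 1 2 s))%:C *: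
       tau (fun j => (wz j (dif p))^*) (fun j => wz j (dif p)) +
     (2^-1 * b 1 1 s)%:C *: beta) :> A.
Proof.
move=> s; have D : is_derive s 1 (fun s => 2^-1 * b 1 1 s) (2^-1 * (2^-1 * b 2 2 s - b 1 2 s)).
  by have := is_deriveZ (2^-1) (bkm_is_derive hchi lam 1 1 s); rewrite mul1r.
rewrite ddcE (del_delbar_radial (F := fun s => b 0 0 s + lam) _ _ D) //.
- by apply: filterE => q; exact: u_thetaE.
- apply: filterE => t.
  have := is_deriveD (bkm_is_derive hchi lam 0 0 t) (is_derive_cst lam t 1).
  by rewrite mul0r subr0 addr0.
Qed.

Lemma ddc_u_ker p : let s := sqn (dif p) in 0 < s ->
  ddc (fform u_ker) p = ('i / pi%:C) *:
    ((- (2^-1 * s ^- 2))%:C *: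
       tau (fun j => (wz j (dif p))^*) (fun j => wz j (dif p)) +
     (2^-1 * s^-1)%:C *: beta) :> A.
Proof.
move=> s s0; have D : is_derive s 1 (fun s => 2^-1 * s^-1) (- (2^-1 * s ^- 2)).
  have sn0 : s != 0 by rewrite gt_eqF.
  have := is_deriveZ (2^-1) (is_deriveV sn0 (is_derive_id s (1 : R))).
  by congr is_derive; rewrite /GRing.scale /=; field.
rewrite ddcE (del_delbar_radial (F := fun s => 2^-1 * ln s) _ _ D) //.
- apply: (filterS _ (near_comp_sqn (near_gt s0))) => q q0.
  by rewrite /u_ker /eucl -/(sqn _) ln_sqrt // mulrC.
- apply: filterS (near_gt s0) => t t0; exact: (is_deriveZ (2^-1) (is_derive1_ln t0)).
Qed.

(** For log s / 2 the coefficients of [tau] and [beta] satisfy d1 s = - d2, the degeneracy required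
    by [mixed_power]. In c1 s + c2 the two chi' terms cancel, leaving chi'' / (4s) times (2s)^(1-n).
    On the diagonal all profiles vanish. The multiple n avoids a division in the exterior
    algebra. *)
Lemma K_thetaE p : let s := sqn (dif p) in
  (K_theta chi theta p : A) *+ n =
    (('i / pi%:C) ^+ n * (2 ^- n.+1 * b 2 n s)%:C) *: beta ^+ n.
Proof.
move=> s; rewrite /K_theta wedge_powE -[wedge _ _]/(_ * _ : A) ddc_u_theta -/s.
case: (ltP 0 s) => s0; last first.
  have b0 k m : b k m s = 0 by rewrite /bkm ltNge s0.
  by rewrite !b0 !(mulr0, subr0) !scale0r addr0 scaler0 mul0r mul0rn.
rewrite ddc_u_ker // -/s !scalerDr !scalerA.
have sn0 : s != 0 by rewrite gt_eqF.
have rM (x y : R) : x%:C * y%:C = (x * y)%:C by rewrite rmorphM.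
have rN (x : R) : - x%:C = (- x)%:C by rewrite rmorphN.
have rD (x y : R) : x%:C + y%:C = (x + y)%:C by rewrite rmorphD.
rewrite mixed_power ?sum_wz -/s //; last first.
  rewrite -[LHS]mulrA -[RHS]mulrN rM rN; congr (_ * _%:C); field.
  by rewrite sn0.
congr (_ *: _); rewrite -[_ * _ * s%:C]mulrA -mulrDr rM rD exprMn -rmorphXn mulrACA rM -exprSr prednK //.
congr (_ * _%:C); rewrite /bkm s0; have [m ->] : exists m, n = m.+1 by exists n.-1; rewrite prednK.
rewrite -[m.+1.-1]/m exprMn !exprVn !exprSr; field.
by rewrite sn0 expf_neq0 //= expf_neq0.
Qed.

Local Notation kern := (kern (n := n) chi lam).

Lemma conv_coef (phi : dform R n) (x y : 'CV[R]_n) (I : {set gen n}) :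
  (- (2 * 'i)) ^+ n * fwedge (pullback2 phi) (K_theta chi theta) (pairCV x y)
      ((gl @: I) :|: (gr @: [set: gen n]))%SET =
    (kern (x - y))%:C * phi y I.
Proof.
set J := (_ :|: _)%SET; set p := pairCV x y; have [px py] := pairCVK x y.
have nn : n%:R != 0 :> R[i] by rewrite pnatr_eq0 -lt0n.
apply: (mulfI nn); rewrite /fwedge.
have E (X Y : A) : (X * (Y *+ n)) J = n%:R * wedge X Y J.
  by rewrite mulrnAr -scaler_nat; exact: extZE.
rewrite mulrCA -E.
rewrite K_thetaE /dif px py -scalerAr extZE extM.
have := fibre_coef (phi y) I.
rewrite /pullback2 py => ->.
rewrite /kern -/lam; set B := b 2 n _.
have -> : (n.-1)`!%:R / (2 * pi ^+ n) * B = n%:R^-1 * (n`!%:R * (2 ^+ n / pi ^+ n) * (2 ^- n.+1 * B)) :> R.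
  have -> : n`!%:R = n%:R * (n.-1)`!%:R :> R by rewrite -natrM -{1 2}(prednK n0) factS.
  rewrite exprSr; field.
  by rewrite pnatr_eq0 -lt0n n0 !expf_neq0 // gt_eqF // pi_gt0.
have pin : pi%:C != 0 :> R[i] by apply/eqP => -[/eqP]; rewrite gt_eqF // pi_gt0.
have -> : (- (2 * 'i)) ^+ n * (('i / pi%:C) ^+ n * (2 ^- n.+1 * B)%:C * (n`!%:R * phi y I)) =
   ((- (2 * 'i)) * ('i / pi%:C)) ^+ n * (2 ^- n.+1 * B)%:C * (n`!%:R * phi y I).
  by rewrite [in RHS](exprMn n (- (2 * 'i))) -!mulrA.
have rM (u v : R) : u%:C * v%:C = (u * v)%:C by rewrite rmorphM.
have rn m : m%:R = m%:R%:C :> R[i] by rewrite rmorph_nat.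
(* The volume factor and the factor of dd^c combine into a positive real number, so the kernel is
   real. *)
have -> : (- (2 * 'i)) * ('i / pi%:C) = (2 / pi)%:C :> R[i].
  transitivity (- (2 * 'i ^+ 2) / pi%:C : R[i]); first by ring.
  by rewrite sqrCi mulrN1 opprK; apply: (mulIf pin); rewrite rM !divfK // gt_eqF // pi_gt0.
rewrite -rmorphXn !rn rM !mulrA !rM; congr (_%:C * _).
rewrite exprMn exprVn; field.
by rewrite pnatr_eq0 -lt0n n0 !expf_neq0 // gt_eqF // pi_gt0.
Qed.
End KernelFormula.

(** * Mollification *)

Section Convolution.
Context {R : realType} {n : nat}.
Implicit Types (f g w K : 'CV[R]_n -> R) (x y z : 'CV[R]_n).

Lemma bsupp_trans M f x : bsupp M f -> bsupp (M + `|x|) (fun y => f (y + x)).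
Proof.
move=> bf; have := @bsupp_affine _ _ M f 1 x (normr1 _) bf.
by under eq_fun do rewrite scale1r.
Qed.

Lemma ucont_refl f x : ucont f -> ucont (fun y => f (x - y)).
Proof. by move=> uf; apply: (ucont_comp _ uf) => y y'; rewrite opprB addrC addrA subrK distrC. Qed.

Lemma bsupp_refl M f x : bsupp M f -> bsupp (M + `|x|) (fun y => f (x - y)).
Proof.
move=> bf; have := @bsupp_affine _ _ M f (-1) x (normrN1 _) bf.
by under eq_fun do rewrite scaleN1r addrC.
Qed.

Lemma vint_trans f M x : ucont f -> bsupp M f -> vint (fun y => f (y + x)) = vint f.
Proof.
move=> uf bf; rewrite -(vint_reflect x uf bf) -[RHS](vint_reflect 0 (ucont_refl x uf) (bsupp_refl bf)).
by congr vint; apply/funext => y; rewrite sub0r opprK addrC.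
Qed.

Lemma bsuppMr M f w : bsupp M w -> bsupp M (fun y => f y * w y).
Proof. by move=> bw y My; rewrite bw // mulr0. Qed.

Lemma ucontM M f w : continuous f -> continuous w -> bsupp M w -> ucont (fun y => f y * w y).
Proof.
move=> cf cw bw; apply: ucont_csuppCV (bsuppMr _ bw) => z.
by apply: cvgM; [exact: cf | exact: cw].
Qed.

Lemma continuous_trans f x : continuous f -> continuous (fun y => f (y + x)).
Proof.
move=> cf y; apply: continuous_comp; last exact: cf.
by apply: cvgD; [exact: cvg_id | exact: cvg_cst].
Qed.

Definition rlinear (l : ('CV[R]_n -> R) -> R) :=
  forall c f g, ccs f -> ccs g -> l (fun z => c * f z + g z) = c * l f + l g.

Definition wint w f : R := vint (fun y => f y * w y).

Lemma wintDZ M w c f g : continuous w -> bsupp M w -> continuous f -> continuous g ->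
  wint w (fun z => c * f z + g z) = c * wint w f + wint w g.
Proof.
move=> cw bw cf cg; rewrite /wint -(rapproxDZ (rapprox_vint n) (M := M)) //.
- by congr vint; apply/funext => y; rewrite mulrDl mulrA.
- exact: ucontM cf cw bw.
- exact: ucontM cg cw bw.
- exact: bsuppMr.
- exact: bsuppMr.
Qed.

Lemma wint_bfunctional M w : continuous w -> bsupp M w -> bfunctional (wint w).
Proof.
move=> cw bw; split=> [c f g [/smooth_continuous cf _] [/smooth_continuous cg _]|].
  exact: wintDZ cw bw cf cg.
have [C C0 HC] := rapprox_bound (rapprox_vint n) M; have [N [N0 wN]] := bounded_csuppCV cw bw.
exists (C * N); first exact: mulr_ge0.
move=> f B [/smooth_continuous cf _] fB; rewrite -mulrA; apply: HC.
- exact: ucontM cf cw bw.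
- exact: bsuppMr.
- by move=> y; rewrite normrM mulrC; apply: ler_pM.
Qed.

(** Correlation rather than convolution; the two agree for even K. The translation falls on [f],
    which makes derivatives and distances to [f] direct to read. *)
Definition cnv K f x : R := wint K (fun y => f (y + x)).

(** Up to the reflection x -> -x this is a bounded functional applied to the translates of [f]; the
    reflection cancels the sign in [bfunctional_derive]. *)
Lemma cnv_smooth M K f : continuous K -> bsupp M K -> ccs f ->
  smooth (cnv K f) /\ forall a, 'D_(basev a) (cnv K f) = cnv K ('D_(basev a) f).
Proof.
move=> cK bK cf; have bl := wint_bfunctional cK bK.
have E g : cnv K g = fun x => (fun y => wint K (fun z => g (z - y))) ((-1) *: x + 0).
  by apply/funext => x; rewrite addr0 scaleN1r; congr wint; apply/funext => y; rewrite opprK.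
have sm := bfunctional_smooth bl cf; split; first by rewrite E; exact: (smooth_affine (-1) 0 sm).
move=> a; apply/funext => x; rewrite [in LHS]E (derive_affine (-1) 0 x a sm) E.
have [_ ->] := bfunctional_derive bl a ((-1) *: x + 0) cf.
by rewrite mulrA mulrNN !mul1r.
Qed.

(** Moves the translation to the kernel, so that mollifying a merely continuous [f] can inherit
    smoothness from K. *)
Lemma cnv_swap M K f : continuous K -> bsupp M K -> continuous f ->
  cnv K f = fun x => wint f (fun y => K (y - x)).
Proof.
move=> cK bK cf; apply/funext => x; rewrite /cnv /wint.
have bK' : bsupp (M + `|- x|) (fun y => K (y - x)) := bsupp_trans bK.
have cK' : continuous (fun y => K (y - x)) by exact: continuous_trans.
rewrite -(vint_trans (- x) (ucontM (continuous_trans cf) cK bK) (bsuppMr _ bK)).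
by congr vint; apply/funext => y; rewrite subrK mulrC.
Qed.

Lemma cnvDZ M K c f g x : continuous K -> bsupp M K -> continuous f -> continuous g ->
  cnv K (fun z => c * f z + g z) x = c * cnv K f x + cnv K g x.
Proof. by move=> cK bK cf cg; apply: wintDZ cK bK _ _; apply: continuous_trans. Qed.

(* With [c = 0] this bounds a mollification and locates its support; with [c = f x]
   it measures how far the mollification is from [f]. *)
Lemma cnv_close M K f x c e : continuous K -> bsupp M K -> (forall y, 0 <= K y) ->
  vint K = 1 -> continuous f -> (forall y, `|y| <= M -> `|f (y + x) - c| <= e) ->
  `|cnv K f x - c| <= e.
Proof.
move=> cK bK K0 K1 cf fe.
have cg : continuous (fun y => f (y + x) - c).
  by move=> y; apply: cvgB; [exact: continuous_trans | exact: cvg_cst].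
have uK : ucont K by exact: ucont_csuppCV bK.
have -> : cnv K f x - c = vint (fun y => (f (y + x) - c) * K y).
  rewrite -[c in LHS]mulr1 -K1 -(rapproxZ (rapprox_vint n) c uK bK) /cnv /wint.
  rewrite -(rapproxB (rapprox_vint n) (M := M)) //.
  - by congr vint; apply/funext => y; rewrite mulrBl.
  - by apply: ucontM cK bK; exact: continuous_trans.
  - exact: ucontZ.
  - exact: bsuppMr.
  - exact: bsuppZ.
have u1 := ucontM cg cK bK; have b1 := bsuppMr (fun y => f (y + x) - c) bK.
have le y : `|(f (y + x) - c) * K y| <= e * K y.
  rewrite normrM (ger0_norm (K0 y)); have [yM|My] := leP `|y| M; last by rewrite bK // !mulr0.
  by apply: ler_wpM2r => //; exact: fe.
rewrite ler_norml; apply/andP; split.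
  rewrite -[- e]mulr1 -K1 -(rapproxZ (rapprox_vint n) (- e) uK bK).
  apply: (rapprox_le (rapprox_vint n) (M := M)) => //; [exact: ucontZ | exact: bsuppZ |].
  by move=> y; have := le y; rewrite ler_norml mulNr => /andP[].
rewrite -[e]mulr1 -K1 -(rapproxZ (rapprox_vint n) e uK bK).
apply: (rapprox_le (rapprox_vint n) (M := M)) => //; [exact: ucontZ | exact: bsuppZ |].
by move=> y; have := le y; rewrite ler_norml => /andP[].
Qed.

Lemma bsupp_cnv M N K f : bsupp M K -> bsupp N f -> bsupp (N + M) (cnv K f).
Proof.
move=> bK bf x Mx; rewrite /cnv /wint (_ : (fun y => _) = fun=> 0).
  exact: (rapprox0 (rapprox_vint n)).
apply/funext => y; have [yM|My] := leP `|y| M; last by rewrite bK // mulr0.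
rewrite bf ?mul0r //; rewrite addrC; apply: lt_le_trans (lerB_normD _ _).
by rewrite ltrBrDr; apply: le_lt_trans Mx; rewrite lerD2l.
Qed.

End Convolution.

(** * Complex extension of real functionals *)

Section Complexification.
Context {R : realType} {n : nat}.
Implicit Types (f g : 'CV[R]_n -> R[i]) (l : ('CV[R]_n -> R) -> R) (c : R[i]).

Lemma normC_le (w : R[i]) (B : R) : `|w| <= B%:C -> `|Re w| <= B /\ `|Im w| <= B.
Proof.
rewrite normc_def lecR => wB; split; apply: le_trans wB; rewrite -sqrtr_sqr ler_wsqrtr //.
  by rewrite lerDl sqr_ge0.
by rewrite lerDr sqr_ge0.
Qed.

Lemma normC_ge (w : R[i]) (A B : R) : `|Re w| <= A -> `|Im w| <= B -> `|w| <= (A + B)%:C.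
Proof.
move=> aA bB; rewrite normc_def lecR; apply: le_trans (lerD aA bB).
have AB : 0 <= `|Re w| + `|Im w| by rewrite addr_ge0.
rewrite -[leRHS](ger0_norm AB) -sqrtr_sqr ler_wsqrtr // sqrrD !real_normK ?num_real //.
by rewrite -addrA lerD2l lerDr mulrn_wge0 // mulr_ge0.
Qed.

Definition cpx l f : R[i] := l (fun z => Re (f z)) +i* l (fun z => Im (f z)).

Definition cccs f := ccs (fun z => Re (f z)) /\ ccs (fun z => Im (f z)).

Lemma ccs0 : ccs (fun _ : 'CV[R]_n => 0).
Proof. by split; [exact: smooth_cst | exists 0]. Qed.

Lemma ReDZ c (u v : R[i]) : Re (c * u + v) =
  Re c * Re u + (- Im c * Im u + Re v).
Proof. by case: c u v => a b [p q] [r s] /=; ring. Qed.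

Lemma ImDZ c (u v : R[i]) : Im (c * u + v) =
  Im c * Re u + (Re c * Im u + Im v).
Proof. by case: c u v => a b [p q] [r s] /=; ring. Qed.

Lemma cccsDZ c f g : cccs f -> cccs g -> cccs (fun z => c * f z + g z).
Proof.
move=> [fr fi] [gr gi]; split.
  by under eq_fun do rewrite ReDZ; apply/ccsD/ccsD => //; exact: ccsZ.
by under eq_fun do rewrite ImDZ; apply/ccsD/ccsD => //; exact: ccsZ.
Qed.

Lemma cccs0 : cccs (fun=> 0).
Proof. by split; exact: ccs0. Qed.

Lemma cccsZ c f : cccs f -> cccs (fun z => c * f z).
Proof. by move=> /(cccsDZ c)/(_ cccs0); under eq_fun do rewrite addr0. Qed.

Lemma cccsD f g : cccs f -> cccs g -> cccs (fun z => f z + g z).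
Proof. by move=> cf /(cccsDZ 1 cf); under eq_fun do rewrite mul1r. Qed.

Lemma cccs_sum (T : Type) (r : seq T) (P : pred T) (F : T -> 'CV[R]_n -> R[i]) :
  (forall i, P i -> cccs (F i)) -> cccs (fun z => \sum_(i <- r | P i) F i z).
Proof.
move=> cF; elim: r => [|i r IH].
  by under eq_fun do rewrite big_nil; exact: cccs0.
case Pi: (P i); under eq_fun do rewrite big_cons Pi; last exact: IH.
by apply: cccsD => //; exact: cF.
Qed.

Lemma cccsMr (f : 'CV[R]_n -> R) g : smooth f -> cccs g -> cccs (fun z => (f z)%:C * g z).
Proof.
move=> sf [gr gi]; split.
  rewrite (_ : (fun z => _) = fun z => Re (g z) * f z); first exact: ccsM.
  by apply/funext => z; case: (g z) => a b /=; ring.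
rewrite (_ : (fun z => _) = fun z => Im (g z) * f z); first exact: ccsM.
by apply/funext => z; case: (g z) => a b /=; ring.
Qed.

Lemma cpxDZ l c f g : rlinear l -> cccs f -> cccs g ->
  cpx l (fun z => c * f z + g z) = c * cpx l f + cpx l g.
Proof.
move=> ll [fr fi] [gr gi]; rewrite /cpx.
under [X in l X +i* _]eq_fun do rewrite ReDZ.
under [X in _ +i* l X]eq_fun do rewrite ImDZ.
rewrite !ll //; try by [exact: ccsZ | apply: ccsD => //; exact: ccsZ].
by apply/eqP; rewrite eq_complex ReDZ ImDZ !eqxx.
Qed.

Lemma rlinear0 l : rlinear l -> l (fun=> 0) = 0.
Proof.
move=> ll; have := ll 1 _ _ ccs0 ccs0; rewrite mul1r.
by rewrite (_ : (fun z => _) = fun=> 0) => [|]; [lra | apply/funext => z; rewrite addr0].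
Qed.

Lemma cpx0 l : rlinear l -> cpx l (fun=> 0) = 0.
Proof. by move=> ll; rewrite /cpx /= rlinear0. Qed.

Lemma cpxZ l c f : rlinear l -> cccs f -> cpx l (fun z => c * f z) = c * cpx l f.
Proof.
by move=> ll cf; have := cpxDZ c ll cf cccs0; under eq_fun do rewrite addr0; rewrite cpx0 // addr0.
Qed.

Lemma cpxD l f g : rlinear l -> cccs f -> cccs g -> cpx l (fun z => f z + g z) = cpx l f + cpx l g.
Proof.
by move=> ll cf cg; have := cpxDZ 1 ll cf cg; under eq_fun do rewrite mul1r; rewrite mul1r.
Qed.

Lemma cpx_sum l (T : Type) (r : seq T) (P : pred T) (F : T -> 'CV[R]_n -> R[i]) :
  rlinear l -> (forall i, P i -> cccs (F i)) ->
  cpx l (fun z => \sum_(i <- r | P i) F i z) = \sum_(i <- r | P i) cpx l (F i).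
Proof.
move=> ll cF; elim: r => [|i r IH].
  by rewrite big_nil; under eq_fun do rewrite big_nil; exact: cpx0.
rewrite big_cons; case Pi: (P i); under eq_fun do rewrite big_cons Pi; last exact: IH.
by rewrite cpxD // ?IH //; [exact: cF | exact: cccs_sum].
Qed.

Lemma cccs_bounded f : cccs f -> exists2 B : R, 0 <= B & forall z, `|f z| <= B%:C.
Proof.
move=> [[sr [M1 b1]] [si [M2 b2]]].
have [B1 [B10 H1]] := bounded_csuppCV (smooth_continuous sr) b1.
have [B2 [B20 H2]] := bounded_csuppCV (smooth_continuous si) b2.
by exists (B1 + B2); [exact: addr_ge0 | move=> z; exact: normC_ge].
Qed.

End Complexification.

(** * Test forms and their convolution *)

Section TestForms.
Context {R : realType} {n : nat}.
Implicit Types (phi psi : dform R n) (U A : set 'CV[R]_n) (f : 'CV[R]_n -> R[i]).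

(** Compact support anywhere in C^n: the convolution of a test form on D may spill over the boundary
    of D, and [pairing] still has to be applied to it. *)
Definition tform phi := forall I, cccs (fun z => phi z I).

Lemma compact_bsupp A (f : 'CV[R]_n -> R) : compact A -> (forall z, ~ A z -> f z = 0) ->
  exists M, bsupp M f.
Proof.
move=> /compact_bounded[M [Mr HM]] fA; exists (M + 1) => z Mz; apply: fA => Az.
by have /= := HM (M + 1) _ z Az; rewrite ltrDl ltr01 leNgt Mz => /(_ isT).
Qed.

Lemma test_form_tform U phi : test_form U phi -> tform phi.
Proof.
move=> [sphi [A [cA _ supp]]] I; have [sr si] := sphi I.
by split; split => //; apply: compact_bsupp cA _ => z /supp ->; rewrite ffunE.
Qed.

Lemma tform_test_form U A phi : tform phi -> compact A -> A `<=` U -> supported_in A phi ->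
  test_form U phi.
Proof. by move=> tphi cA AU supp; split; [move=> I; case: (tphi I) => -[? _] [? _] | exists A]. Qed.

Lemma tformDZ c phi psi : tform phi -> tform psi -> tform (fun z => cscale c (phi z) + psi z).
Proof. by move=> tp tq I; under eq_fun do rewrite !ffunE; apply: cccsDZ. Qed.

Lemma test_formDZ U c phi psi : test_form U phi -> test_form U psi ->
  test_form U (fun z => cscale c (phi z) + psi z).
Proof.
move=> tp tq; have := tformDZ c (test_form_tform tp) (test_form_tform tq).
move: tp tq => [_ [A [cA AU sA]]] [_ [B [cB BU sB]]] t.
apply: (tform_test_form (A := A `|` B)) => //; first exact: compactU.
  by rewrite subUset.
by move=> z; rewrite /setU /= => /not_orP[/sA -> /sB ->]; apply/ffunP => I; rewrite !ffunE mulr0 addr0.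
Qed.

Lemma tform0 : tform (fun=> 0).
Proof. by move=> I; under eq_fun do rewrite ffunE; exact: cccs0. Qed.

Lemma test_form0 U : test_form U (fun=> 0).
Proof. by apply: (tform_test_form (A := set0)) => //; [exact: tform0 | exact: compact0]. Qed.

Lemma tformM (rho : 'CV[R]_n -> R) phi : smooth rho -> tform phi ->
  tform (fun z => cscale (rho z)%:C (phi z)).
Proof. by move=> sr tp I; under eq_fun do rewrite ffunE; exact: cccsMr. Qed.

Lemma tform_bounded phi : tform phi -> exists2 B : R, 0 <= B & forall z I, `|phi z I| <= B%:C.
Proof.
move=> tp; have /choice[B HB] I : exists B : R, 0 <= B /\ forall z, `|phi z I| <= B%:C.
  by have [B B0 H] := cccs_bounded (tp I); exists B.
exists (\sum_I B I); first by apply: sumr_ge0 => I _; case: (HB I).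
move=> z I; apply: le_trans ((HB I).2 z) _; rewrite lecR (bigD1 I) //= lerDl.
by apply: sumr_ge0 => J _; case: (HB J).
Qed.

Lemma cpderiv_cccs a f : cccs f -> cccs (cpderiv a f).
Proof. by move=> [fr fi]; split; exact: ccs_derive. Qed.

Lemma wirtinger_cccs a f : cccs f -> cccs (wirtinger a f).
Proof.
by move=> cf; apply/cccsZ/cccsD; [exact: cpderiv_cccs | apply/cccsZ/cpderiv_cccs].
Qed.

(** A combination of first derivatives with constant coefficients, the shape through which
    convolution can be pulled term by term. *)
Lemma dext_coef phi z J : dext phi z J =
  \sum_(b : bool) \sum_j \sum_(I in powerset J)
    (-1) ^+ inversions I (J :\: I) * (covg (j, b) : cov R n) I *
      wirtinger (j, b) (fun w => phi w (J :\: I)%SET) z.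
Proof.
rewrite big_bool /= /dext ffunE addrC; congr (_ + _); rewrite sum_ffunE; apply: eq_bigr => j _.
  by rewrite ffunE; apply: eq_bigr => I _; rewrite !ffunE.
by rewrite ffunE; apply: eq_bigr => I _; rewrite !ffunE.
Qed.

Lemma tform_dext phi : tform phi -> tform (dext phi).
Proof.
move=> tp J; under eq_fun do rewrite dext_coef.
by do 3 apply: cccs_sum => ? _; apply/cccsZ/wirtinger_cccs.
Qed.

Lemma supported_dext A phi : closed A -> supported_in A phi -> supported_in A (dext phi).
Proof.
move=> cA sA z nAz; have Az : \forall w \near z, phi w = 0.
  have : nbhs z (~` A) by apply: open_nbhs_nbhs; split => //; exact: closed_openC.
  by apply: filterS => w; exact: sA.
have c0 a I : cpderiv a (fun w => phi w I) z = 0.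
  by rewrite /cpderiv !(@near_eq_derive _ _ _ _ (fun=> 0)) ?derive_cst //;
    apply: filterS Az => w ->; rewrite ffunE.
apply/ffunP => J; rewrite dext_coef ffunE.
by do 3 apply: big1 => ? _; rewrite /wirtinger !c0 mulr0 addr0 !mulr0.
Qed.

Section Mollification.
Variables (M : R) (K : 'CV[R]_n -> R).
Hypotheses (cK : continuous K) (bK : bsupp M K).

Definition ccnv f x : R[i] := cpx (fun g => cnv K g x) f.

Definition fconv phi : dform R n := fun x => [ffun I => ccnv (fun y => phi y I) x].

Lemma cnv_rlinear x : rlinear (fun g => cnv K g x).
Proof.
by move=> c f g [/smooth_continuous cf _] [/smooth_continuous cg _]; exact: cnvDZ cK bK cf cg.
Qed.

Lemma cnv_ccs (f : 'CV[R]_n -> R) : ccs f -> ccs (cnv K f).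
Proof.
move=> cf; split; first by case: (cnv_smooth cK bK cf).
by case: cf => _ [N bf]; exists (N + M); exact: bsupp_cnv.
Qed.

Lemma ccnv_cccs f : cccs f -> cccs (ccnv f).
Proof. by move=> [fr fi]; split; exact: cnv_ccs. Qed.

Lemma tform_fconv phi : tform phi -> tform (fconv phi).
Proof. by move=> tp I; under eq_fun do rewrite ffunE; exact: ccnv_cccs. Qed.

Lemma fconvDZ c phi psi : tform phi -> tform psi ->
  fconv (fun z => cscale c (phi z) + psi z) = fun z => cscale c (fconv phi z) + fconv psi z.
Proof.
move=> tp tq; apply/funext => z; apply/ffunP => I; rewrite !ffunE.
rewrite -(cpxDZ _ (cnv_rlinear z)) //; congr cpx; apply/funext => y; by rewrite !ffunE.
Qed.

Lemma cpderiv_ccnv a f : cccs f -> cpderiv a (ccnv f) = ccnv (cpderiv a f).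
Proof.
move=> [/(cnv_smooth cK bK)[_ fr] /(cnv_smooth cK bK)[_ fi]].
by apply/funext => x; rewrite /cpderiv /ccnv /cpx /= -fr -fi.
Qed.

Lemma wirtinger_ccnv a f x : cccs f -> wirtinger a (ccnv f) x = ccnv (wirtinger a f) x.
Proof.
move=> cf; have c1 := cpderiv_cccs (a.1, false) cf; have c2 := cpderiv_cccs (a.1, true) cf.
rewrite /wirtinger !cpderiv_ccnv // /ccnv; have ll := cnv_rlinear x.
have c3 := cccsZ ((-1) ^+ (~~ a.2) * 'i) c2.
by rewrite (cpxZ _ ll (cccsD c1 c3)) (cpxD ll c1 c3) (cpxZ _ ll c2).
Qed.

Lemma dext_fconv phi : tform phi -> dext (fconv phi) = fconv (dext phi).
Proof.
move=> tp; apply/funext => x; apply/ffunP => J; rewrite dext_coef [RHS]ffunE.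
transitivity (ccnv (fun z => \sum_(b : bool) \sum_j \sum_(I in powerset J)
    (-1) ^+ inversions I (J :\: I) * (covg (j, b) : cov R n) I *
      wirtinger (j, b) (fun w => phi w (J :\: I)%SET) z) x); last first.
  by congr ccnv; apply/funext => z; rewrite dext_coef.
have cw (b : bool) j I : cccs (fun z => (-1) ^+ inversions I (J :\: I) * (covg (j, b) : cov R n) I *
      wirtinger (j, b) (fun w => phi w (J :\: I)%SET) z).
  exact/cccsZ/wirtinger_cccs.
rewrite /ccnv cpx_sum; [|exact: cnv_rlinear|by move=> b _; do 2 apply: cccs_sum => ? _].
apply: eq_bigr => b _; rewrite cpx_sum; [|exact: cnv_rlinear|by move=> j _; apply: cccs_sum].
apply: eq_bigr => j _; rewrite cpx_sum; [|exact: cnv_rlinear|by []].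
apply: eq_bigr => I _; rewrite cpxZ; [|exact: cnv_rlinear|exact: wirtinger_cccs].
congr (_ * _); rewrite -[RHS]/(ccnv (wirtinger (j, b) (fun w => phi w (J :\: I)%SET)) x).
rewrite -(wirtinger_ccnv _ _ (tp _)).
have -> // : (fun w => fconv phi w (J :\: I)%SET) = ccnv (fun w => phi w (J :\: I)%SET).
by apply/funext => w; rewrite ffunE.
Qed.

End Mollification.

End TestForms.

(** * Exhausting cutoffs *)

Section BoundaryDistance.
Context {R : realType} {n : nat}.
Variable D : set 'CV[R]_n.
Implicit Types (z w : 'CV[R]_n) (A : set 'CV[R]_n).

Let dset z := [set r : R | r = 1 \/ exists2 w, ~ D w & r = `|z - w|].

(* Capping the distance to the complement at 1 avoids a case distinction when the
   complement is empty. *)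
Definition dst z : R := inf (dset z).

Lemma dset_lb0 z : lbound (dset z) 0.
Proof. by move=> _ [->|[w _ ->]]; rewrite ?ler01. Qed.

Lemma dst_le z r : dset z r -> dst z <= r.
Proof. by move=> zr; apply: ge_inf => //; exists 0; exact: dset_lb0. Qed.

Lemma dst_ge z r : lbound (dset z) r -> r <= dst z.
Proof. by apply: lb_le_inf; exists 1; left. Qed.

Lemma dst_ge0 z : 0 <= dst z.
Proof. exact: dst_ge (@dset_lb0 z). Qed.

Lemma dst_out z : ~ D z -> dst z = 0.
Proof.
move=> nD; apply/eqP; rewrite eq_le dst_ge0 andbT; apply: dst_le; right.
by exists z => //; rewrite subrr normr0.
Qed.

Lemma dst_lip z w : dst z <= dst w + `|z - w|.
Proof.
rewrite -lerBlDr; apply: dst_ge => _ [->|[v Dv ->]]; rewrite lerBlDr.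
  apply: (@le_trans _ _ 1); first by apply: dst_le; left.
  by rewrite lerDl.
apply: (@le_trans _ _ `|z - v|); first by apply: dst_le; right; exists v.
by rewrite -(subrKA w) addrC ler_normD.
Qed.

Lemma dst_continuous : continuous dst.
Proof.
apply: ucont_continuous => e e0; exists e => // u v uv.
have h1 := dst_lip u v; have h2 := dst_lip v u; rewrite (distrC v u) in h2.
by rewrite ler_norml; apply/andP; split; lra.
Qed.

Lemma dst_gt0 z : open D -> D z -> 0 < dst z.
Proof.
move=> oD Dz; have /nbhs_normP[e /= e0 He] : nbhs z D by apply: open_nbhs_nbhs.
have e1 : 0 < Num.min 1 e by rewrite lt_min ltr01.
apply: (lt_le_trans e1); apply: dst_ge => _ [->|[w Dw ->]]; first by rewrite ge_min lexx.
by rewrite ge_min; apply/orP; right; rewrite leNgt; apply/negP => lt; apply: Dw; exact: He.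
Qed.

Lemma dst_pos_in z : 0 < dst z -> D z.
Proof. by move=> d0; apply: contrapT => /dst_out e; rewrite e ltxx in d0. Qed.

Lemma compact_dst A : open D -> compact A -> A `<=` D -> exists2 d : R, 0 < d & forall z, A z -> d <= dst z.
Proof.
move=> oD cA AD; have [[a Aa]|A0] := pselect (A !=set0); last first.
  by exists 1 => // z Az; case: A0; exists z.
have [|c /[!inE] Ac H] := @compact_EVT_min _ _ dst A (ex_intro _ a Aa) cA.
  exact: continuous_subspaceT dst_continuous.
exists (dst c); first by apply: dst_gt0 => //; exact: AD.
by move=> z Az; apply: H; rewrite inE.
Qed.

Definition inner (d : R) : set 'CV[R]_n := [set z | d <= dst z].

Lemma inner_sub d : 0 < d -> inner d `<=` D.
Proof. by move=> d0 z dz; apply: dst_pos_in; exact: lt_le_trans dz. Qed.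

Lemma bounded_bsupp : bounded_set D -> exists M : R, forall z, D z -> `|z| <= M.
Proof. by move=> [M [Mr HM]]; exists (M + 1) => z Dz; apply: (HM (M + 1)) => //; rewrite ltrDl. Qed.

Lemma inner_compact d : bounded_set D -> 0 < d -> compact (inner d).
Proof.
move=> /bounded_bsupp[M HM] d0.
apply: (subclosed_compact _ (@compact_ballCV R n M)).
  by apply: (@closed_comp _ _ dst [set r | d <= r]); [move=> z _; exact: dst_continuous | exact: closed_ge].
by move=> z dz; apply: HM; exact: (inner_sub d0).
Qed.

Section Cutoffs.
Variable chi : R -> R.
Hypotheses (hchi : convexifier chi) (n0 : (0 < n)%N).
Hypotheses (oD : open D) (bD : bounded_set D).

(** With q = 1/(k+1), the profile is 0 where the distance is at most 2q and 1 where it is at least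
    3q. Mollifying at radius q gives a function that vanishes below distance q and equals 1 from 4q
    on. The -1 in [width] compensates the support radius exp(lam + 1) of the kernel. *)
Let step (k : nat) z : R := Num.min 1 (Num.max 0 (k.+1%:R * dst z - 2)).
Let width (k : nat) : R := ln (k.+1%:R^-1) - 1.
Let cutoff k := cnv (kern chi (width k)) (step k).

Let kern_cont lam : continuous (kern (n := n) chi lam).
Proof. by have [sk _] := kern_ccs hchi n lam; exact: smooth_continuous. Qed.

Let k1_gt0 k : 0 < k.+1%:R^-1 :> R.
Proof. by rewrite invr_gt0. Qed.

Let width_bsupp k : bsupp (k.+1%:R^-1) (kern (n := n) chi (width k)).
Proof.
have := @kern_bsupp _ _ hchi n (width k); rewrite /width subrK lnK // posrE.
exact: k1_gt0.
Qed.

Let step_continuous k : continuous (step k).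
Proof.
move=> z; have c1 : {for z, continuous (fun z => k.+1%:R * dst z - 2)}.
  apply: cvgB; last exact: cvg_cst.
  by apply: cvgM; [exact: cvg_cst | exact: dst_continuous].
have c0 (c : R) : {for z, continuous (fun _ : 'CV[R]_n => c)} by exact: cvg_cst.
by apply: (continuous_min (c0 1)); apply: (continuous_max (c0 0)).
Qed.

Let step01 k z : 0 <= step k z <= 1.
Proof. by rewrite /step le_min ler01 le_max lexx ge_min lexx. Qed.

Let step_close k x c e : (forall y, `|y| <= k.+1%:R^-1 -> `|step k (y + x) - c| <= e) ->
  `|cutoff k x - c| <= e.
Proof.
apply: cnv_close; [exact: kern_cont | exact: width_bsupp | exact: kern_ge0 | exact: vint_kern|].
exact: step_continuous.
Qed.

Let step_bsupp k : exists M, bsupp M (step k).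
Proof.
have [M HM] := bounded_bsupp bD; exists M => z Mz.
rewrite /step dst_out ?mulr0; last by move=> /HM; rewrite leNgt Mz.
by rewrite max_l ?min_r //; lra.
Qed.

Lemma exhausting_cutoffs_exist : exists rho, exhausting_cutoffs D rho.
Proof.
exists cutoff; split=> [k|A cA AD].
  split; [|split].
  - have [M bM] := step_bsupp k.
    (* The profile is only continuous, so the smoothness has to come from the kernel. *)
    rewrite /cutoff (cnv_swap (@kern_cont (width k)) (@width_bsupp k) (@step_continuous k)).
    exact: (bfunctional_smooth (wint_bfunctional (@step_continuous k) bM) (kern_ccs hchi n (width k))).
  (* Closeness to the midpoint 1/2 within 1/2 encodes both bounds 0 and 1. *)
  - move=> z; have : `|cutoff k z - 1/2| <= 1/2.
      by apply: step_close => y _; have /andP[s0 s1] := step01 k (y + z); rewrite ler_norml; lra.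
    by rewrite ler_norml => /andP[h1 h2]; apply/andP; split; lra.
  - exists (inner (k.+1%:R^-1)); split; [exact: inner_compact | exact: inner_sub|].
    move=> z /negP; rewrite -ltNge => dz; apply/eqP; rewrite -normr_le0 -[cutoff k z]subr0.
    apply: step_close => y yk; rewrite subr0 /step max_l ?min_r ?normr0 //.
    rewrite subr_le0 -ler_pdivlMl //; have := dst_lip (y + z) z; rewrite addrK => h.
    by apply: (le_trans h); rewrite mulr_natr mulr2n; apply: lerD => //; exact: ltW.
have [d d0 Hd] := compact_dst oD cA AD.
near=> k; move=> z Az; have h : 4 / d < k.+1%:R.
  near: k; exists (Num.truncn (4 / d)).+1 => //= k hk.
  by apply: lt_le_trans (truncnS_gt _) _; rewrite ler_nat; exact: leqW.
apply/eqP; rewrite -subr_eq0 -normr_le0; apply: step_close => y yk.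
have dy : 3 / k.+1%:R <= dst (y + z).
  have := dst_lip z (y + z); rewrite opprD addrCA subrr addr0 normrN => h2.
  have h4 : 4 / k.+1%:R <= d by rewrite ltW // ltr_pdivrMr // mulrC -ltr_pdivrMr.
  move: h2 (Hd z Az) h4 yk; move: (k.+1%:R^-1) (dst (y + z)) (dst z) `|y| => q u v t; lra.
have : 3 <= k.+1%:R * dst (y + z) by rewrite -ler_pdivrMl // mulrC.
by move=> d3; rewrite /step max_r ?min_l ?subrr ?normr0 //; lra.
Unshelve. all: by end_near. Qed.
End Cutoffs.

End BoundaryDistance.

(** * Riemann sums of convolutions *)

Section RiemannSumsOfConvolutions.
Context {R : realType} {n : nat}.
Implicit Types (f g K : 'CV[R]_n -> R).

Lemma equicont_conv f K (A B : R) : ucont f -> ucont K -> (forall y, `|f y| <= A) ->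
  (forall y, `|K y| <= B) -> equicont (fun (x y : 'CV[R]_n) => f y * K (x - y)).
Proof.
move=> uf uK fA KB e e0; have A0 : 0 <= A by apply: le_trans (fA 0).
have B0 : 0 <= B by apply: le_trans (KB 0).
have e2 : 0 < e / 2 by rewrite divr_gt0.
have A1 : 0 < A + 1 by lra.
have B1 : 0 < B + 1 by lra.
have [d1 d10 h1] := uf _ (divr_gt0 e2 B1); have [d2 d20 h2] := uK _ (divr_gt0 e2 A1).
exists (Num.min d1 d2); first by rewrite lt_min d10.
move=> x u v; rewrite lt_min => /andP[uv1 uv2].
rewrite (_ : _ - _ = f u * (K (x - u) - K (x - v)) + K (x - v) * (f u - f v)); last by ring.
apply: le_trans (ler_normD _ _) _; rewrite [leRHS](_ : e = e / 2 + e / 2); last by field.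
rewrite !normrM; apply: lerD.
  apply: (@le_trans _ _ (A * (e / 2 / (A + 1)))); last by apply: mul_divS_le => //; exact: ltW.
  by apply: ler_pM => //; apply: h2; rewrite opprB addrC addrA subrK distrC.
apply: (@le_trans _ _ (B * (e / 2 / (B + 1)))); last by apply: mul_divS_le => //; exact: ltW.
by apply: ler_pM => //; exact: h1.
Qed.

Lemma equicont_sum (T U : Type) (F : T -> 'CV[R]_n -> R) (G : U -> 'CV[R]_n -> R) :
  equicont F -> equicont G -> equicont (fun t : T + U => match t with inl a => F a | inr b => G b end).
Proof.
move=> eF eG e e0; have [d1 d10 h1] := eF e e0; have [d2 d20 h2] := eG e e0.
exists (Num.min d1 d2); first by rewrite lt_min d10.
by case=> t u v; rewrite lt_min => /andP[uv1 uv2]; [exact: h1 | exact: h2].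
Qed.

Lemma ccs_sum (T : Type) (r : seq T) (F : T -> 'CV[R]_n -> R) :
  (forall i, ccs (F i)) -> ccs (fun z => \sum_(i <- r) F i z).
Proof.
move=> cF; elim: r => [|i r IH]; first by under eq_fun do rewrite big_nil; exact: ccs0.
by under eq_fun do rewrite big_cons; exact: ccsD.
Qed.

Lemma rlinear_sum l (T : Type) (r : seq T) (c : T -> R) (F : T -> 'CV[R]_n -> R) : rlinear l ->
  (forall i, ccs (F i)) -> l (fun z => \sum_(i <- r) c i * F i z) = \sum_(i <- r) c i * l (F i).
Proof.
move=> ll cF; elim: r => [|i r IH].
  by rewrite big_nil; under eq_fun do rewrite big_nil; exact: rlinear0.
rewrite big_cons; under eq_fun do rewrite big_cons; rewrite ll ?IH //.
by apply: ccs_sum => j; exact: ccsZ.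
Qed.

Lemma cnvE K f x : ccs K -> (forall z, K (- z) = K z) -> ccs f ->
  cnv K f x = vint (fun y => f y * K (x - y)).
Proof.
move=> [/smooth_continuous cK [M bK]] Ks [/smooth_continuous cf _].
rewrite (cnv_swap cK bK cf) /wint; congr vint; apply/funext => y.
by rewrite mulrC -[y - x]opprB Ks.
Qed.

(** The Fubini exchange: Riemann sums of the convolution converge uniformly in x, a bounded
    functional respects such convergence, and on finite sums it is linear. *)
Lemma bfunctional_cnv l K f : bfunctional l -> ccs K -> (forall z, K (- z) = K z) -> ccs f ->
  l (cnv K f) = vint (fun y => f y * l (fun x => K (x - y))).
Proof.
move=> bl cK Ks cf; have [ll [C C0 HC]] := bl.
have [sK [N bK]] := cK; have [sf [M bf]] := cf.
have [A A0 fA] := bounded_csuppCV (smooth_continuous sf) bf.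
have [B B0 KB] := bounded_csuppCV (smooth_continuous sK) bK.
pose G y := f y * l (fun x => K (x - y)).
have bG : bsupp M G by move=> y My; rewrite /G bf // mul0r.
have uG : ucont G.
  have cl : continuous (fun y : 'CV[R]_n => l (fun x => K (x - y))).
    by have := bfunctional_ucont bl cK => /ucont_continuous.
  apply: ucont_csuppCV bG => y; apply: cvgM; [exact: smooth_continuous | exact: cl].
(* A single list of nodes has to approximate the convolution at every x and the integral of [G] as
   well, hence the disjoint union of the two families. *)
have eF := equicont_sum (equicont_conv (ccs_ucont cf) (ccs_ucont cK) fA KB) (ucont_equicont uG).
have [C' C'0 H] := rapprox_equi (rapprox_vint n) M.
apply/eqP; rewrite -subr_eq0; apply/eqP; apply: (@eps_eq0 _ _ (C + 1)); first by rewrite addr_ge0.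
move=> e e0; have [|L [L0 LC HL]] := H _ _ eF _ e e0.
  by case=> [x|_] y My; [rewrite bf // mul0r | exact: bG].
have cS (p : 'CV[R]_n * R) : ccs (fun x => K (x - p.1)) by exact: ccs_trans.
rewrite -(subrKA (wsum L G)) mulrDl mul1r; apply: le_trans (ler_normD _ _) _.
apply: lerD; last by rewrite distrC; exact: (HL (inr tt)).
have cs : ccs (fun x => \sum_(p <- L) (p.2 * f p.1) * K (x - p.1)).
  by apply: ccs_sum => p; exact: ccsZ.
have -> : wsum L G = l (fun x => \sum_(p <- L) (p.2 * f p.1) * K (x - p.1)).
  rewrite rlinear_sum // /wsum; apply: eq_bigr => p _; by rewrite mulrA.
have cc : ccs (cnv K f) by apply: cnv_ccs cf; [exact: smooth_continuous | exact: bK].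
rewrite -[X in X - _]mul1r addrC -mulN1r; have := ll (-1) _ _ cs cc; rewrite mul1r => <-.
apply: HC; first by apply: ccsD cc; exact: ccsZ.
move=> x; rewrite mulN1r addrC cnvE //; have := HL (inl x).
by congr (`|_ - _| <= _); apply: eq_bigr => p _; rewrite mulrA.
Qed.

Lemma tform_bsupp (phi : dform R n) : tform phi -> exists M, forall I,
  bsupp M (fun z => Re (phi z I)) /\ bsupp M (fun z => Im (phi z I)).
Proof.
move=> tp; have /choice[B HB] (I : {set gen n}) : exists M, bsupp M (fun z => Re (phi z I)) /\
    bsupp M (fun z => Im (phi z I)).
  have [[_ [M1 b1]] [_ [M2 b2]]] := tp I; exists (Num.max M1 M2); split.
    by apply: bsupp_le b1; rewrite le_max lexx.
  by apply: bsupp_le b2; rewrite le_max lexx orbT.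
exists (\sum_I `|B I|) => I; have le : B I <= \sum_I `|B I|.
  by rewrite (bigD1 I) //= (le_trans (ler_norm _)) // lerDl sumr_ge0.
by have [b1 b2] := HB I; split; apply: bsupp_le le _.
Qed.

(** The same nonnegative weights serve all coefficients and both their real and imaginary parts, so
    the approximation is a combination of the covectors [phi p.1] themselves, with nonnegative
    functions as factors when K is nonnegative. *)
Lemma fconv_riemann K (phi : dform R n) (e : R) : ccs K -> (forall z, K (- z) = K z) ->
  tform phi -> 0 < e -> exists L : seq ('CV[R]_n * R), all (fun p => 0 <= p.2) L /\
  forall x I, `|fconv K phi x I - \sum_(p <- L) (p.2 * K (x - p.1))%:C * phi p.1 I| <= e%:C.
Proof.
move=> cK Ks tp e0; have [M HM] := tform_bsupp tp.
have [sK [N bK]] := cK; have [B B0 KB] := bounded_csuppCV (smooth_continuous sK) bK.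
pose f (t : {set gen n} * bool) y := if t.2 then Im (phi y t.1) else Re (phi y t.1).
have cf t : ccs (f t) by case: t => I []; case: (tp I).
have bf t : bsupp M (f t) by case: t => I []; case: (HM I).
have eF : equicont (fun (tu : {t : {set gen n} * bool & 'CV[R]_n}) y =>
    f (tag tu) y * K (tagged tu - y)).
  apply: (@equicont_fin _ _ _ _ (fun t x y => f t y * K (x - y))) => t.
  have [A A0 fA] := bounded_csuppCV (smooth_continuous (cf t).1) (bf t).
  exact: equicont_conv (ccs_ucont (cf t)) (ccs_ucont cK) fA KB.
have [C C0 H] := rapprox_equi (rapprox_vint n) M.
have e2 : 0 < e / 2 by rewrite divr_gt0.
have [|L [L0 _ HL]] := H _ _ eF _ _ e2; first by move=> [t x] y My /=; rewrite bf // mul0r.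
exists L; split=> // x I; rewrite ffunE [e](_ : e = e / 2 + e / 2); last by field.
have h t : `|cnv K (f t) x - \sum_(p <- L) p.2 * (f t p.1 * K (x - p.1))| <= e / 2.
  by have := HL (existT (fun _ => 'CV[R]_n) t x); rewrite cnvE.
have hr := h (I, false); have hi := h (I, true).
apply: normC_ge; rewrite raddfB raddf_sum.
  move: hr; congr (`|_ - _| <= _); apply: eq_bigr => p _.
  by rewrite /f; case: (phi p.1 I) => a b /=; ring.
move: hi; congr (`|_ - _| <= _); apply: eq_bigr => p _.
by rewrite /f; case: (phi p.1 I) => a b /=; ring.
Qed.

End RiemannSumsOfConvolutions.

(** * Pairing a current of bounded mass with bounded forms *)

Section ComplexLimits.
Context {R : realType}.

Lemma cvgCP (T : Type) (F : set_system T) (FF : Filter F) (f : T -> R[i]) (l : R[i]) :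
  (f t : R[i]^o) @[t --> F] --> (l : R[i]^o) <->
  forall e : R, 0 < e -> \forall t \near F, `|f t - l| <= e%:C.
Proof.
split=> [/cvgrPdist_le H e e0|H].
  have eC : 0 < e%:C :> R[i] by rewrite -[0]/(0%:C) ltcR.
  by apply: filterS (H e%:C eC) => t; rewrite distrC.
apply/cvgrPdist_le => -[a b]; rewrite ltcE /= => /andP[/eqP -> a0].
by apply: filterS (H a a0) => t; rewrite distrC.
Qed.

Lemma normRC (r : R) : `|r%:C| = `|r|%:C :> R[i].
Proof. by rewrite normc_def /= expr0n addr0 sqrtr_sqr. Qed.

Lemma geRC0 (r : R) : 0 <= r -> 0 <= r%:C :> R[i].
Proof. by move=> r0; rewrite lecE /= eqxx. Qed.

Lemma cauchy_real_cvg (x : nat -> R) :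
  (forall e : R, 0 < e -> exists k0, forall k, (k0 <= k)%N -> `|x k0 - x k| <= e) ->
  cvgn x.
Proof.
move=> H; apply: cauchy_cvg; apply: cauchy_exP => e e0.
have e2 : 0 < e / 2 by rewrite divr_gt0.
have [k0 Hk] := H _ e2; exists (x k0); exists k0 => //= k kk; rewrite /ball /=.
by apply: le_lt_trans (Hk k kk) _; rewrite ltr_pdivrMr // mulr_natr mulr2n ltrDl.
Qed.

End ComplexLimits.

Section Pairing.
Context {R : realType} {n : nat}.
Variables (D : set 'CV[R]_n) (S : dform R n -> R[i]) (M : R).
Hypothesis linS : forall (c : R[i]) phi psi, test_form D phi -> test_form D psi ->
  S (fun z => cscale c (phi z) + psi z) = c * S phi + S psi.
Hypothesis massS : forall phi, test_form D phi -> (forall z I, `|phi z I| <= 1) ->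
  `|S phi| <= M%:C.
Implicit Types (phi psi Phi : dform R n) (rho : nat -> 'CV[R]_n -> R).

Lemma current0 : S (fun=> 0) = 0.
Proof.
have := linS (-1) (test_form0 D) (test_form0 D).
rewrite (_ : (fun z => _) = fun=> 0) => [->|]; first by rewrite mulN1r addNr.
by apply/funext => z; apply/ffunP => I; rewrite !ffunE mulr0 addr0.
Qed.

Lemma currentZ c phi : test_form D phi -> S (fun z => cscale c (phi z)) = c * S phi.
Proof.
move=> tp; have := linS c tp (test_form0 D); rewrite current0 addr0 => <-.
by congr S; apply/funext => z; rewrite addr0.
Qed.

Lemma test_formZ c phi : test_form D phi -> test_form D (fun z => cscale c (phi z)).
Proof.
by move=> /(test_formDZ c)/(_ (test_form0 D)); under eq_fun do rewrite addr0.
Qed.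

Lemma mass_ge0 : 0 <= M.
Proof.
have := massS (test_form0 D); rewrite current0 normr0 lecE /= => h.
by have /andP[] : (0 == 0 :> R) && (0 <= M) by apply: h => z I; rewrite ffunE normr0.
Qed.

Lemma form_eq0 phi : (forall z I, `|phi z I| <= (0 : R)%:C) -> phi = fun=> 0.
Proof.
move=> p0; apply/funext => z; apply/ffunP => I; rewrite ffunE.
by apply/eqP; rewrite -normr_le0; exact: p0.
Qed.

Lemma cR_inv (B : R) : 0 < B -> `|(B^-1)%:C| = (B^-1)%:C :> R[i].
Proof. by move=> B0; rewrite normc_def /= expr0n addr0 sqrtr_sqr ger0_norm // invr_ge0 ltW. Qed.

Lemma current_le phi (B : R) : test_form D phi -> 0 <= B -> (forall z I, `|phi z I| <= B%:C) ->
  `|S phi| <= (M * B)%:C.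
Proof.
move=> tp; rewrite le_eqVlt => /orP[/eqP <-|B0] pB.
  by rewrite (form_eq0 pB) current0 normr0 mulr0.
have := massS (test_formZ (B^-1)%:C tp); rewrite currentZ // normrM cR_inv //.
move=> H; have : (B^-1)%:C * `|S phi| <= M%:C.
  apply: H => z I; rewrite ffunE normrM cR_inv //.
  have -> : 1 = (B^-1)%:C * B%:C :> R[i] by rewrite -rmorphM mulVf ?gt_eqF.
  by apply: ler_wpM2l => //; apply: geRC0; rewrite invr_ge0 ltW.
have BC : 0 <= B%:C :> R[i] by apply/geRC0/ltW.
move=> /(ler_wpM2l BC); rewrite mulrA -rmorphM divff ?gt_eqF // mul1r.
by rewrite -rmorphM mulrC.
Qed.

(* Choose [phi0] almost maximizing [Re (S phi)] among forms bounded by 1: adding to it a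
   form supported off its support cannot increase the real part by more than [e]. *)
Lemma current_tail (e : R) : 0 < e -> exists A : set 'CV[R]_n, [/\ compact A, A `<=` D &
  forall psi (B : R), test_form D psi -> (forall z, A z -> psi z = 0) -> 0 <= B ->
    (forall z I, `|psi z I| <= B%:C) -> `|S psi| <= (e * B)%:C].
Proof.
move=> e0; pose E := [set r : R | exists phi, [/\ test_form D phi,
  forall z I, `|phi z I| <= 1 & r = Re (S phi)]].
have Eub : ubound E M.
  move=> _ [phi [tp p1 ->]]; have [h _] := normC_le (massS tp p1).
  exact: le_trans (ler_norm _) h.
have supE : has_sup E.
  split; last by exists M.
  exists (Re (S (fun=> 0))), (fun=> 0); split=> //; first exact: test_form0.
  by move=> z I; rewrite ffunE normr0.
have [_ [phi0 [tp0 p01 ->]] lt0] := sup_adherent e0 supE.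
have [_ [A [cA AD sA]]] := tp0; exists A; split=> // psi B tp psiA.
rewrite le_eqVlt => /orP[/eqP <-|B0] pB.
  by rewrite (form_eq0 pB) current0 normr0 mulr0.
have [S0|S0] := eqVneq (S psi) 0.
  by rewrite S0 normr0; apply/geRC0/mulr_ge0 => //; exact: ltW.
(* [u] has modulus 1 and rotates S psi onto the positive axis. Hence u psi / B + phi0, still bounded
   by 1 because one summand vanishes wherever the other may not, has real part |S psi| / B + Re (S
   phi0). *)
pose u : R[i] := (S psi)^-1 * `|S psi|.
have nu : `|u| = 1 by rewrite normrM normfV normr_id mulVf // normr_eq0.
have : E (Re (u * (B^-1)%:C * S psi + S phi0)).
  exists (fun z => cscale (u * (B^-1)%:C) (psi z) + phi0 z); split.
  - exact: test_formDZ.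
  - move=> z I; rewrite !ffunE; have [Az|/sA ->] := pselect (A z).
      by rewrite psiA // ffunE mulr0 add0r.
    rewrite ffunE addr0 2!normrM nu mul1r cR_inv //.
    have -> : 1 = (B^-1)%:C * B%:C :> R[i] by rewrite -rmorphM mulVf ?gt_eqF.
    by apply: ler_wpM2l => //; apply: geRC0; rewrite invr_ge0 ltW.
  - by rewrite linS.
move=> /(sup_upper_bound supE).
have -> : u * (B^-1)%:C * S psi = (B^-1)%:C * `|S psi|.
  by rewrite /u mulrAC mulrC mulrAC mulVf // mul1r.
have [r ->] : exists r : R, `|S psi| = r%:C by rewrite normc_def; eexists.
move=> le1; have : B^-1 * r + Re (S phi0) <= sup E.
  by apply: le_trans le1; rewrite raddfD /= mul0r subr0.
by move=> le2; rewrite lecR mulrC -ler_pdivrMl //; lra.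
Qed.

Lemma cutoff_test rho k Phi : exhausting_cutoffs D rho -> tform Phi ->
  test_form D (fun z => cscale (rho k z)%:C (Phi z)).
Proof.
move=> [H _] tP; have [sr [_ [A [cA AD rA]]]] := H k.
apply: (tform_test_form (tformM sr tP) cA AD).
by move=> z /rA ->; apply/ffunP => I; rewrite !ffunE mul0r.
Qed.

(** Eventually both cutoffs equal 1 on the compact set carrying all but [e] of the mass. Their
    difference vanishes there and is at most 1 in modulus elsewhere. Comparing two families makes
    the limit independent of the family. *)
Lemma cutoff_cauchy rho rho' Phi (B e : R) : exhausting_cutoffs D rho -> exhausting_cutoffs D rho' ->
  tform Phi -> 0 <= B -> (forall z I, `|Phi z I| <= B%:C) -> 0 < e ->
  exists k0, forall k l, (k0 <= k)%N -> (k0 <= l)%N ->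
   `|S (fun z => cscale (rho k z)%:C (Phi z)) - S (fun z => cscale (rho' l z)%:C (Phi z))| <= (e * B)%:C.
Proof.
move=> er er' tP B0 PB e0; have [A [cA AD HA]] := current_tail e0.
have [[H1 /(_ A cA AD)[k1 _ Hk1]] [H2 /(_ A cA AD)[k2 _ Hk2]]] := (er, er').
exists (maxn k1 k2) => k l; rewrite !geq_max => /andP[k1k _] /andP[_ k2l].
rewrite distrC addrC -mulN1r -linS; last 2 first.
- exact: cutoff_test.
- exact: cutoff_test.
apply: HA => //.
- by apply: test_formDZ; exact: cutoff_test.
- move=> z Az; rewrite (Hk1 k k1k z Az) (Hk2 l k2l z Az); apply/ffunP => I.
  by rewrite !ffunE mulN1r addNr.
- move=> z I; rewrite !ffunE mulN1r -mulNr -mulrDl normrM -rmorphN -rmorphD.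
  rewrite normRC; have [_ [/(_ z)/andP[r0 r1] _]] := H1 k.
  have [_ [/(_ z)/andP[r'0 r'1] _]] := H2 l.
  apply: le_trans (PB z I); rewrite -[leRHS]mul1r; apply: ler_wpM2r => //.
  by rewrite -[1]/(1%:C) lecR ler_norml; lra.
Qed.

Hypothesis exhD : exists rho, exhausting_cutoffs D rho.

Definition is_pairing Phi (l : R[i]) := forall rho, exhausting_cutoffs D rho ->
  forall e : R, 0 < e -> \forall k \near \oo,
    `|S (fun z => cscale (rho k z)%:C (Phi z)) - l| <= e%:C.

(** Real and imaginary parts converge along one family by completeness, and [cutoff_cauchy] carries
    the limit over to every other family. *)
Lemma is_pairing_ex Phi : tform Phi -> exists l, is_pairing Phi l.
Proof.
move=> tP; have [B B0 PB] := tform_bounded tP; have [rho er] := exhD.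
have C (rho' : nat -> 'CV[R]_n -> R) (e : R) : exhausting_cutoffs D rho' -> 0 < e -> exists k0, forall k l,
  (k0 <= k)%N -> (k0 <= l)%N ->
   `|S (fun z => cscale (rho k z)%:C (Phi z)) - S (fun z => cscale (rho' l z)%:C (Phi z))| <= e%:C.
  move=> er' e0; have c0 : 0 < B + 1 by lra.
  have [k0 H] := cutoff_cauchy er er' tP B0 PB (divr_gt0 e0 c0); exists k0 => k l kk kl.
  apply: le_trans (H k l kk kl) _; rewrite lecR mulrC; apply: mul_divS_le => //; exact: ltW.
pose x k := S (fun z => cscale (rho k z)%:C (Phi z)).
have cr : cvgn (fun k => Re (x k)).
  apply: cauchy_real_cvg => e e0; have [k0 H] := C _ _ er e0; exists k0 => k kk.
  by have [+ _] := normC_le (H k0 k (leqnn _) kk); rewrite raddfB.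
have ci : cvgn (fun k => Im (x k)).
  apply: cauchy_real_cvg => e e0; have [k0 H] := C _ _ er e0; exists k0 => k kk.
  by have [_ +] := normC_le (H k0 k (leqnn _) kk); rewrite raddfB.
exists (limn (fun k => Re (x k)) +i* limn (fun k => Im (x k))) => rho' er' e e0.
have e3 : 0 < e / 3 by rewrite divr_gt0.
have [k0 H] := C _ _ er' e3.
have [k1 _ H1] : \forall k \near \oo, `|limn (fun k => Re (x k)) - Re (x k)| <= e / 3.
  by move: cr => /cvgrPdist_le; apply.
have [k2 _ H2] : \forall k \near \oo, `|limn (fun k => Im (x k)) - Im (x k)| <= e / 3.
  by move: ci => /cvgrPdist_le; apply.
exists k0 => //= l kl; pose k := maxn k0 (maxn k1 k2).
have kk : (k0 <= k)%N by rewrite leq_maxl.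
have kk1 : (k1 <= k)%N by rewrite /k; lia.
have kk2 : (k2 <= k)%N by rewrite /k; lia.
have a1 := H k l kk kl; have a2 := H1 k kk1; have a3 := H2 k kk2.
rewrite -(subrKA (x k)); apply: le_trans (ler_normD _ _) _.
rewrite (_ : e = e / 3 + (e / 3 + e / 3)); last by field.
rewrite rmorphD; apply: lerD; first by rewrite distrC.
by rewrite distrC; apply: normC_ge; rewrite raddfB.
Qed.

Lemma pairingP Phi : tform Phi -> is_pairing Phi (pairing D S Phi).
Proof.
move=> tP; have [l Hl] := is_pairing_ex tP.
have Q : exists l : R[i], [set l : R[i] | forall rho, exhausting_cutoffs D rho ->
    (S (fun z => cscale (rho k z)%:C (Phi z)) : R[i]^o) @[k --> \oo] --> (l : R[i]^o)] l.
  by exists l => rho er; apply/cvgCP => e e0; exact: Hl.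
by move=> rho er e e0; have /cvgCP := xgetPex 0 Q rho er; apply.
Qed.

Lemma pairing_unique rho Phi l : exhausting_cutoffs D rho -> tform Phi ->
  (forall e : R, 0 < e -> \forall k \near \oo,
    `|S (fun z => cscale (rho k z)%:C (Phi z)) - l| <= e%:C) -> pairing D S Phi = l.
Proof.
move=> er tP H; apply/eqP; rewrite -subr_eq0 -normr_eq0.
have [r rE] : exists r : R, `|pairing D S Phi - l| = r%:C by rewrite normc_def; eexists.
rewrite rE; have -> // : r = 0; apply: (@eps_eq0 R r 2) => // e e0.
have [k _ /(_ k (leqnn k))[h1 h2]] : \forall k \near \oo,
    `|S (fun z => cscale (rho k z)%:C (Phi z)) - pairing D S Phi| <= e%:C /\
    `|S (fun z => cscale (rho k z)%:C (Phi z)) - l| <= e%:C.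
  by apply: filterS2 (pairingP tP er e0) (H e e0).
have : r%:C <= (2 * e)%:C :> R[i].
  rewrite -rE -(subrKA (S (fun z => cscale (rho k z)%:C (Phi z)))).
  apply: le_trans (ler_normD _ _) _; rewrite mulr_natl mulr2n rmorphD; apply: lerD => //.
  by rewrite distrC.
have r0 : 0 <= r by have := normr_ge0 (pairing D S Phi - l); rewrite rE lecE => /andP[].
by rewrite lecR ger0_norm.
Qed.

Lemma pairingDZ c Phi Psi : tform Phi -> tform Psi ->
  pairing D S (fun z => cscale c (Phi z) + Psi z) = c * pairing D S Phi + pairing D S Psi.
Proof.
move=> tP tQ; have [rho er] := exhD; apply: (pairing_unique er (tformDZ c tP tQ)) => e e0.
have [r rE] : exists r : R, `|c| = r%:C by rewrite normc_def; eexists.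
have r0 : 0 <= r by have := normr_ge0 c; rewrite rE lecE => /andP[].
have e2 : 0 < e / 2 by rewrite divr_gt0.
have r1 : 0 < r + 1 by lra.
apply: filterS2 (pairingP tP er (divr_gt0 e2 r1)) (pairingP tQ er e2) => k h1 h2.
rewrite (_ : (fun z => _) = fun z => cscale c (cscale (rho k z)%:C (Phi z)) + cscale (rho k z)%:C (Psi z)).
  rewrite linS; [|exact: cutoff_test|exact: cutoff_test].
  rewrite opprD addrACA -mulrBr; apply: le_trans (ler_normD _ _) _.
  rewrite (_ : e = e / 2 + e / 2); last by field.
  rewrite rmorphD; apply: lerD => //; rewrite normrM rE.
  apply: le_trans (ler_wpM2l (geRC0 r0) h1) _; rewrite -rmorphM lecR.
  by apply: mul_divS_le => //; exact: ltW.
apply/funext => z; apply/ffunP => I; rewrite !ffunE; ring.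
Qed.

Lemma pairing_le Phi (B : R) : tform Phi -> 0 <= B -> (forall z I, `|Phi z I| <= B%:C) ->
  `|pairing D S Phi| <= (M * B)%:C.
Proof.
move=> tP B0 PB; have [rho er] := exhD.
have [r rE] : exists r : R, `|pairing D S Phi| = r%:C by rewrite normc_def; eexists.
rewrite rE lecR; apply/ler_addgt0Pr => e e0.
have [k _ /(_ k (leqnn k)) H] := pairingP tP er e0.
have H2 : `|S (fun z => cscale (rho k z)%:C (Phi z))| <= (M * B)%:C.
  apply: current_le => //; first exact: cutoff_test.
  move=> z I; rewrite ffunE normrM normRC; case: er => /(_ k)[_ [/(_ z)/andP[r0 r1] _]] _.
  apply: le_trans (PB z I); rewrite -[leRHS]mul1r; apply: ler_wpM2r => //.
  by rewrite -[1]/(1%:C) lecR ger0_norm.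
rewrite -lecR -rE -[X in `|X|](subKr (S (fun z => cscale (rho k z)%:C (Phi z)))) rmorphD.
by apply: le_trans (ler_normB _ _) _; apply: lerD.
Qed.

Lemma pairing_test Phi : test_form D Phi -> pairing D S Phi = S Phi.
Proof.
move=> tP; have [rho er] := exhD; apply: (pairing_unique er (test_form_tform tP)) => e e0.
case: tP => _ [A [cA AD sA]]; case: er => _ /(_ A cA AD); apply: filterS => k rk.
rewrite (_ : (fun z => _) = Phi) ?subrr ?normr0; first exact/geRC0/ltW.
apply/funext => z; apply/ffunP => I; rewrite ffunE; have [/rk ->|/sA ->] := pselect (A z).
  by rewrite mul1r.
by rewrite ffunE mulr0.
Qed.

Lemma pairing_eq0 Phi : tform Phi ->
  (forall rho k, exhausting_cutoffs D rho -> S (fun z => cscale (rho k z)%:C (Phi z)) = 0) ->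
  pairing D S Phi = 0.
Proof.
move=> tP H; have [rho er] := exhD; apply: (pairing_unique er tP) => e e0.
by apply: nearW => k; rewrite H // subr0 normr0; exact/geRC0/ltW.
Qed.

(** Nonnegativity in [R[i]] includes a vanishing imaginary part, so both parts have to pass to the
    limit. *)
Lemma ge0_approx (l : R[i]) :
  (forall e : R, 0 < e -> exists2 x : R[i], 0 <= x & `|x - l| <= e%:C) -> 0 <= l.
Proof.
move=> H; rewrite lecE; apply/andP; split => /=.
  apply/eqP/(@eps_eq0 _ _ 1) => // e e0; have [x] := H e e0.
  rewrite lecE => /andP[/eqP xi _] /normC_le[_]; rewrite raddfB /= xi sub0r normrN.
  by rewrite mul1r.
apply/ler_addgt0Pr => e e0; have [x] := H e e0.
rewrite lecE /= => /andP[_ x0] /normC_le[+ _]; rewrite raddfB /= ler_norml => /andP[_].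
by lra.
Qed.

Lemma pairing_ge0 Phi : tform Phi ->
  (forall rho k, exhausting_cutoffs D rho -> 0 <= S (fun z => cscale (rho k z)%:C (Phi z))) ->
  0 <= pairing D S Phi.
Proof.
move=> tP H; have [rho er] := exhD; apply: ge0_approx => e e0.
have [k _ /(_ k (leqnn k)) h] := pairingP tP er e0.
by exists (S (fun z => cscale (rho k z)%:C (Phi z))) => //; exact: H.
Qed.

(** * The mollified current *)

Variable K : 'CV[R]_n -> R.
Hypotheses (cK : ccs K) (Ks : forall z, K (- z) = K z) (K0 : forall z, 0 <= K z) (K1 : vint K = 1).
Implicit Types (f : 'CV[R]_n -> R) (I J : {set gen n}).

Let M0 : 0 <= M := mass_ge0.

Let Kc : continuous K.
Proof. by case: cK => /smooth_continuous. Qed.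

Definition mollified phi : R[i] := pairing D S (fconv K phi).

Let fconvt phi : tform phi -> tform (fconv K phi).
Proof. by move=> tp; case: cK => _ [N bK]; exact: (tform_fconv Kc bK). Qed.

Lemma mollifiedDZ c phi psi : tform phi -> tform psi ->
  mollified (fun z => cscale c (phi z) + psi z) = c * mollified phi + mollified psi.
Proof.
move=> tp tq; case: (cK) => _ [N bK]; rewrite /mollified (fconvDZ Kc bK c tp tq).
by apply: pairingDZ; exact: fconvt.
Qed.

Lemma fconv_close phi (z : 'CV[R]_n) I (c : R[i]) (N e : R) : tform phi -> bsupp N K ->
  (forall y, `|y| <= N -> `|Re (phi (y + z) I) - Re c| <= e /\
    `|Im (phi (y + z) I) - Im c| <= e) ->
  `|fconv K phi z I - c| <= (e + e)%:C.
Proof.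
move=> tp bK H; have [[/smooth_continuous cr _] [/smooth_continuous ci _]] := tp I.
rewrite ffunE; apply: normC_ge; rewrite raddfB.
  by apply: (cnv_close Kc bK K0 K1 cr) => y /H[].
by apply: (cnv_close Kc bK K0 K1 ci) => y /H[].
Qed.

Lemma mollified_le phi (B : R) : tform phi ->
  (forall z I, `|Re (phi z I)| <= B /\ `|Im (phi z I)| <= B) ->
  `|mollified phi| <= (M * (B + B))%:C.
Proof.
move=> tp pB; have B0 : 0 <= B by case: (pB 0 finset.set0) => + _; exact: le_trans.
apply: pairing_le; [exact: fconvt | exact: addr_ge0 |].
move=> z I; case: (cK) => _ [N bK]; rewrite -[fconv _ _ _ _]subr0.
by apply: (fconv_close tp bK) => y _; rewrite !subr0.
Qed.

Lemma tform_scale f (lam : cov R n) : ccs f -> tform (fun z => cscale (f z)%:C lam).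
Proof.
move=> cf J; under eq_fun do rewrite ffunE mulrC; apply: cccsZ.
by split => //; exact: ccs0.
Qed.

(** Bounded mass makes this a functional of order 0 on all compactly supported smooth functions of
    C^n. Its real and imaginary parts are the bounded functionals to which the Fubini exchange
    applies. *)
Definition coefS I f : R[i] := pairing D S (fun z => cscale (f z)%:C (bas I : cov R n)).

Lemma coefSDZ I (c : R) f g : ccs f -> ccs g ->
  coefS I (fun z => c * f z + g z) = c%:C * coefS I f + coefS I g.
Proof.
move=> cf cg; rewrite /coefS -pairingDZ; [|exact: tform_scale|exact: tform_scale].
congr (pairing D S _); apply/funext => z; apply/ffunP => J; rewrite !ffunE rmorphD rmorphM; ring.
Qed.

Lemma coefS_le I f (B : R) : ccs f -> (forall z, `|f z| <= B) -> `|coefS I f| <= (M * B)%:C.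
Proof.
move=> cf fB; have B0 : 0 <= B := le_trans (normr_ge0 _) (fB 0).
apply: pairing_le => //; first exact: tform_scale.
move=> z J; rewrite !ffunE normrM normRC; case: eqP => _.
  by rewrite normr1 mulr1 lecR.
by rewrite normr0 mulr0; exact: geRC0.
Qed.

Lemma coefS_Re I : bfunctional (fun f => Re (coefS I f)).
Proof.
split=> [c f g cf cg|]; first by rewrite coefSDZ // ReDZ /= oppr0 mul0r add0r.
by exists M => // f B cf /(coefS_le I cf)/normC_le[].
Qed.

Lemma coefS_Im I : bfunctional (fun f => Im (coefS I f)).
Proof.
split=> [c f g cf cg|]; first by rewrite coefSDZ // ImDZ /= mul0r add0r.
by exists M => // f B cf /(coefS_le I cf)/normC_le[].
Qed.

Definition density I y : R[i] := coefS I (fun x => K (x - y)).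

Lemma density_smooth I : csmooth_on setT (density I).
Proof.
split; first exact: (bfunctional_smooth (coefS_Re I) cK).
exact: (bfunctional_smooth (coefS_Im I) cK).
Qed.

Lemma cccsM (f g : 'CV[R]_n -> R[i]) : cccs f -> csmooth_on setT g -> cccs (fun z => f z * g z).
Proof.
move=> [fr fi] [gr gi]; split.
  rewrite (_ : (fun z => _) = fun z => Re (f z) * Re (g z) +
    (-1) * (Im (f z) * Im (g z))).
    by apply: ccsD; [exact: ccsM | apply: ccsZ; exact: ccsM].
  by apply/funext => z; case: (f z) (g z) => a b [c d] /=; ring.
rewrite (_ : (fun z => _) = fun z => Re (f z) * Im (g z) +
  Im (f z) * Re (g z)).
  by apply: ccsD; exact: ccsM.
by apply/funext => z; case: (f z) (g z) => a b [c d] /=; ring.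
Qed.

Lemma vint_rlinear : rlinear (@vint R n).
Proof.
move=> c f g cf cg; have [_ [A bf]] := cf; have [_ [B bg]] := cg.
apply: (rapproxDZ (rapprox_vint n) (M := Num.max A B)); try exact: ccs_ucont.
  by apply: bsupp_le bf; rewrite le_max lexx.
by apply: bsupp_le bg; rewrite le_max lexx orbT.
Qed.

Lemma tform_sum (T : Type) (r : seq T) (c : T -> R[i]) (F : T -> dform R n) :
  (forall i, tform (F i)) -> tform (fun z => \sum_(i <- r) cscale (c i) (F i z)).
Proof.
move=> tF; elim: r => [|i r IH]; first by under eq_fun do rewrite big_nil; exact: tform0.
by under eq_fun do rewrite big_cons; exact: tformDZ.
Qed.

Lemma pairing_sum (T : Type) (r : seq T) (c : T -> R[i]) (F : T -> dform R n) :
  (forall i, tform (F i)) ->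
  pairing D S (fun z => \sum_(i <- r) cscale (c i) (F i z)) = \sum_(i <- r) c i * pairing D S (F i).
Proof.
move=> tF; elim: r => [|i r IH].
  rewrite big_nil; under eq_fun do rewrite big_nil.
  by rewrite (pairing_test (test_form0 D)) current0.
rewrite big_cons; under eq_fun do rewrite big_cons.
by rewrite pairingDZ ?IH //; exact: tform_sum.
Qed.

Lemma coefS_cnv I f : ccs f -> coefS I (cnv K f) =
  vint (fun y => f y * Re (density I y)) +i* vint (fun y => f y * Im (density I y)).
Proof.
move=> cf; rewrite -(bfunctional_cnv (coefS_Re I) cK Ks cf) -(bfunctional_cnv (coefS_Im I) cK Ks cf).
by case: coefS.
Qed.

(** The mollified form is expanded over the basis covectors and over real and imaginary parts, the
    index set being pairs (I, b); each term is a real convolution, to which [coefS_cnv] applies. *)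
Lemma mollifiedE phi : tform phi ->
  mollified phi = cint (fun y => \sum_I phi y I * density I y).
Proof.
move=> tp; have cr I := (tp I).1; have ci I := (tp I).2.
pose c (t : {set gen n} * bool) : R[i] := if t.2 then 'i else 1.
pose f (t : {set gen n} * bool) y := if t.2 then Im (phi y t.1) else Re (phi y t.1).
have cf t : ccs (f t) by case: t => I []; [exact: ci | exact: cr].
have cnvc g : ccs g -> ccs (cnv K g).
  by move=> cg; case: (cK) => _ [N bK]; exact: (cnv_ccs Kc bK).
rewrite /mollified (_ : fconv K phi = fun z => \sum_t cscale (c t)
    (cscale (cnv K (f t) z)%:C (bas t.1 : cov R n))).
  rewrite pairing_sum => [|t]; last by apply: tform_scale; exact: cnvc.
  have -> : cint (fun y => \sum_I phi y I * density I y) =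
      cpx (@vint R n) (fun y => \sum_I phi y I * density I y) by [].
  rewrite cpx_sum; [|exact: vint_rlinear|by move=> I _; exact: cccsM (tp I) (density_smooth I)].
  rewrite (eq_bigr (fun I => \sum_(b : bool) c (I, b) * coefS I (cnv K (f (I, b))))).
    by rewrite pair_bigA; apply: eq_bigr => -[I b].
  move=> I _; rewrite big_bool /= !coefS_cnv // mul1r /cpx.
  rewrite (_ : (fun z => Re _) = fun z => (-1) * (f (I, true) z * Im (density I z)) +
    f (I, false) z * Re (density I z)); last first.
    by apply/funext => z; rewrite /f /=; case: (phi z I) (density I z) => p q [r s] /=; ring.
  rewrite (_ : (fun z => Im _) = fun z => 1 * (f (I, true) z * Re (density I z)) +
    f (I, false) z * Im (density I z)); last first.
    by apply/funext => z; rewrite /f /=; case: (phi z I) (density I z) => p q [r s] /=; ring.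
  have [dr di] := density_smooth I.
  rewrite (vint_rlinear (-1) (ccsM (cf (I, true)) di) (ccsM (cf (I, false)) dr)).
  rewrite (vint_rlinear 1 (ccsM (cf (I, true)) dr) (ccsM (cf (I, false)) di)).
  by simpc; congr (_ +i* _); ring.
apply/funext => z; apply/ffunP => J; rewrite ffunE sum_ffunE.
rewrite (eq_bigr (fun t : {set gen n} * bool => (J == t.1)%:R * (c t * (cnv K (f t) z)%:C))); last first.
  by move=> t _; rewrite !ffunE mulrA mulrC.
rewrite -(pair_bigA _ (fun I b => (J == I)%:R * (c (I, b) * (cnv K (f (I, b)) z)%:C))) /=.
rewrite (bigD1 J) //= [X in _ + X]big1 ?addr0 => [|I /negPf IJ]; last first.
  by rewrite big_bool /= eq_sym IJ !mul0r addr0.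
by rewrite big_bool /= eqxx !mul1r /ccnv /cpx /c /f /=; simpc.
Qed.

Lemma csmoothZ (c : R[i]) (f : 'CV[R]_n -> R[i]) : csmooth_on setT f -> csmooth_on setT (fun z => c * f z).
Proof.
move=> [sr si]; split.
  rewrite (_ : (fun z => _) = fun z => Re c * Re (f z) - Im c * Im (f z)).
    exact: smoothB (smoothZ _ sr) (smoothZ _ si).
  by apply/funext => z; case: (f z) c => p q [a b].
rewrite (_ : (fun z => _) = fun z => Re c * Im (f z) + Im c * Re (f z)).
  exact: smoothDf (smoothZ _ si) (smoothZ _ sr).
by apply/funext => z; case: (f z) c => p q [a b].
Qed.

Lemma mollified_smooth : exists omega : dform R n, (forall U, smooth_form U omega) /\
  forall phi, tform phi -> mollified phi = form_int (fwedge omega phi).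
Proof.
pose c : R[i] := (- (2 * 'i)) ^+ n.
have c0 : c != 0 by rewrite expf_neq0 // oppr_eq0 mulf_neq0 ?neq0Ci // pnatr_eq0.
(* The coefficient on J meets that of phi on the complement of J. The sign is the one of that wedge,
   so the two cancel, and c^-1 cancels the factor in [form_int]. *)
pose omega : dform R n := fun z => [ffun J : {set gen n} =>
  (-1) ^+ inversions J (~: J)%SET * c^-1 * density (~: J)%SET z].
exists omega; split=> [U I|phi tp].
  have [sr si] : csmooth_on setT (fun z => omega z I).
    by under eq_fun do rewrite ffunE; apply: csmoothZ; exact: density_smooth.
  by split=> l z _; [exact: sr | exact: si].
have cp I : cccs (fun y => phi y I * density I y) by exact: cccsM (tp I) (density_smooth I).
rewrite mollifiedE // /form_int -/c.
transitivity (c * (c^-1 * cint (fun y => \sum_I phi y I * density I y))).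
  by rewrite mulVKf.
congr (c * _); transitivity (cint (fun y => c^-1 * \sum_I phi y I * density I y)).
  by apply/esym/(cpxZ _ vint_rlinear)/cccs_sum.
congr cint; apply/funext => y; rewrite mulr_sumr /fwedge ffunE.
rewrite (reindex_inj (@finset.setC_inj _)) /= [RHS](eq_bigl xpredT) => [|J]; last first.
  by rewrite powersetE finset.subsetT.
apply: eq_bigr => J _; rewrite ffunE finset.setTD.
set sg := (-1) ^+ _; rewrite [RHS](_ : _ = (sg * sg) * (c^-1 * (phi y (~: J)%SET * density (~: J)%SET y))).
  by rewrite -expr2 sqrr_sign mul1r.
ring.
Qed.

Lemma strongly_positiveZ p (c : R) (lam : cov R n) : 0 <= c -> strongly_positive p lam ->
  strongly_positive p (cscale c%:C lam).
Proof.
move=> c0 [m [d [alpha [d0 ->]]]]; exists m, (fun k => c * d k), alpha; split=> [k|].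
  exact: mulr_ge0.
apply/ffunP => I; rewrite ffunE !sum_ffunE mulr_sumr; apply: eq_bigr => k _.
by rewrite !ffunE rmorphM mulrA.
Qed.

(** A convolution is an integral of elements of the cone, and placing it in the cone would require
    closedness of the cone. Riemann sums avoid this: each term is a nonnegative function times one
    strongly positive covector, and so stays in the cone after multiplication by a cutoff. *)
Lemma mollified_ge0 s phi : positive_current D s S -> tform phi ->
  (forall z, strongly_positive (n - s) (phi z)) -> 0 <= mollified phi.
Proof.
move=> posS tp sp; apply: ge0_approx => e e0.
have M1 : 0 < M + 1 by rewrite ltr_wpDl.
have [L [L0 HL]] := fconv_riemann cK Ks tp (divr_gt0 e0 M1).
pose F (q : 'CV[R]_n * R) : dform R n := fun x => cscale (K (x - q.1))%:C (phi q.1).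
have tF q : tform (F q) by apply: tform_scale; exact: ccs_trans.
have F0 q : 0 <= pairing D S (F q).
  apply: pairing_ge0 => // rho k er; apply: posS; first exact: cutoff_test er (tF q).
  move=> z; apply: strongly_positiveZ; last exact: strongly_positiveZ.
  by case: er => /(_ k)[_ [/(_ z)/andP[]]].
exists (pairing D S (fun x => \sum_(q <- L) cscale (q.2)%:C (F q x))).
  rewrite pairing_sum //; elim: L L0 {HL} => [|q L IH]; first by rewrite big_nil.
  move=> /= /andP[q0 /IH L0]; rewrite big_cons; apply: addr_ge0 L0.
  by apply: mulr_ge0 => //; exact: geRC0.
have tL := tform_sum L (fun q => (q.2)%:C) tF.
rewrite distrC addrC -mulN1r -pairingDZ //; last exact: fconvt.
apply: (@le_trans _ _ (M * (e / (M + 1)))%:C); last first.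
  by rewrite lecR; apply: mul_divS_le => //; exact: ltW.
apply: pairing_le.
- by apply: tformDZ => //; exact: fconvt.
- by apply: divr_ge0; exact: ltW.
- move=> x I; have := HL x I; congr (`|_| <= _); rewrite [RHS]ffunE [RHS]addrC; congr (_ + _).
  rewrite ffunE mulN1r sum_ffunE; congr (- _); apply: eq_bigr => q _.
  by rewrite !ffunE rmorphM mulrA.
Qed.

Lemma fconv_eq0 phi I z (N : R) : tform phi -> bsupp N K ->
  (forall y, `|y| <= N -> phi (y + z) I = 0) -> fconv K phi z I = 0.
Proof.
move=> tp bK H; have : `|fconv K phi z I - 0| <= (0 + 0 : R)%:C.
  by apply: (fconv_close tp bK) => y /H ->; rewrite subrr normr0.
by rewrite subr0 addr0 (rmorph0 (real_complex R)) normr_le0 => /eqP.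
Qed.

(** Convolution acts coefficient by coefficient, so a nonzero coefficient of the result already
    occurs somewhere in phi. *)
Lemma mollified_bidegree s p q phi : current_bidegree D s S -> tform phi ->
  (forall z, of_bidegree p q (phi z)) -> ~ ((p + s = n)%N /\ (q + s = n)%N) -> mollified phi = 0.
Proof.
move=> bS tp bp pq; apply: pairing_eq0; first exact: fconvt.
move=> rho k er; apply: (bS p q) => //; first exact: cutoff_test er (fconvt tp).
move=> z I; rewrite ffunE => h; have [[w hw]|no] := pselect (exists w, phi w I != 0).
  exact: bp hw.
case: (cK) => _ [N bK]; move: h; rewrite (@fconv_eq0 phi I z N) // ?mulr0 ?eqxx //.
by move=> y _; apply/eqP/negP => h; apply: no; exists (y + z); apply/negP.
Qed.

(** With support at distance at least d from the complement and kernel radius at most d/2, the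
    convolution is still a test form on D. The pairing is then S itself, and convolution commutes
    with d. *)
Lemma mollified_closed (d N : R) phi (A : set 'CV[R]_n) : bounded_set D -> closed_current D S ->
  tform phi -> supported_in A phi -> 0 < d -> (forall z, A z -> d <= dst D z) ->
  bsupp N K -> N <= d / 2 -> mollified (dext phi) = 0.
Proof.
move=> bD clS tp sA d0 Ad bK Nd; have d2 : 0 < d / 2 by rewrite divr_gt0.
have cI := inner_compact bD d2.
have sc : supported_in (inner D (d / 2)) (fconv K phi).
  move=> z /negP; rewrite -ltNge => dz; apply/ffunP => I; rewrite [RHS]ffunE.
  apply: fconv_eq0 bK _ => // y yN; have [Ayz|/sA ->] := pselect (A (y + z)); last by rewrite ffunE.
  have h1 := Ad _ Ayz; have h2 := dst_lip D (y + z) z; rewrite addrK in h2; exfalso.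
  move: h1 h2 yN Nd dz; move: (dst D (y + z)) (dst D z) `|y| => u v t; lra.
rewrite /mollified -(dext_fconv Kc bK tp) pairing_test.
  by apply: clS; apply: tform_test_form sc => //; [exact: fconvt | exact: inner_sub].
apply: (tform_test_form _ cI); first by apply: tform_dext; exact: fconvt.
  exact: inner_sub.
apply: supported_dext sc; apply: compact_closed cI; exact: norm_hausdorff.
Qed.

Lemma mollified_close phi (N e : R) : test_form D phi -> bsupp N K -> 0 <= e ->
  (forall I x y, `|y| <= N -> `|Re (phi (y + x) I) - Re (phi x I)| <= e /\
    `|Im (phi (y + x) I) - Im (phi x I)| <= e) ->
  `|mollified phi - S phi| <= (M * (e + e))%:C.
Proof.
move=> tD bK e0 H; have tp := test_form_tform tD.
rewrite -(pairing_test tD) addrC -mulN1r -pairingDZ //; last exact: fconvt.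
apply: pairing_le; [by apply: tformDZ => //; exact: fconvt | exact: addr_ge0 |].
move=> z I; rewrite ffunE [cscale _ _ _]ffunE mulN1r addrC.
by apply: (fconv_close tp bK) => y /(H I z).
Qed.

End Pairing.

(** * The transform as a mollified current *)

Section TransformIsMollification.
Context {R : realType} {n : nat}.
Variables (chi : R -> R) (D : set 'CV[R]_n) (S : dform R n -> R[i]) (theta : R[i]).
Hypotheses (hchi : convexifier chi) (n0 : (0 < n)%N).
Local Notation K := (kern chi (logmod theta)).

Lemma pushforward_kernel (phi : dform R n) : tform phi ->
  pushforward1 (fwedge (pullback2 phi) (K_theta chi theta)) = fconv K phi.
Proof.
move=> tp; have cK := kern_ccs hchi n (logmod theta).
apply/funext => x; apply/ffunP => I; rewrite !ffunE.
pose c : R[i] := (- (2 * 'i)) ^+ n.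
have c0 : c != 0 by rewrite expf_neq0 // oppr_eq0 mulf_neq0 ?neq0Ci // pnatr_eq0.
pose G y : R[i] := (K (x - y))%:C * phi y I.
have cG : cccs G by apply: cccsMr (tp I); case: (ccs_refl x cK).
have -> : (fun y => fwedge (pullback2 phi) (K_theta chi theta) (pairCV x y)
    ((gl @: I) :|: (gr @: [set: gen n]))%SET) = fun y => c^-1 * G y.
  by apply/funext => y; rewrite /G -(conv_coef hchi n0) mulKf.
have -> : cint (fun y => c^-1 * G y) = c^-1 * cpx (@vint R n) G := cpxZ _ (@vint_rlinear R n) cG.
rewrite mulVKf // /ccnv /cpx; have [cr ci] := tp I.
rewrite !(cnvE x cK (kern_opp chi (logmod theta))) //.
by congr (_ +i* _); congr vint; apply/funext => y; rewrite /G; case: (phi y I) => a b /=; ring.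
Qed.

Lemma transformE (phi : dform R n) : tform phi ->
  transform chi D theta S phi = mollified D S K phi.
Proof. by move=> tp; rewrite /transform pushforward_kernel. Qed.

End TransformIsMollification.

Lemma near_kern_width {R : realType} (d : R) : 0 < d ->
  \forall theta \near (0 : R[i]^o)^', expR (logmod theta + 1) <= d.
Proof.
move=> d0; have e0 : 0 < d / expR 1 by rewrite divr_gt0 ?expR_gt0.
have eC : 0 < (d / expR 1)%:C :> R[i] by rewrite ltcE /= eqxx.
have tl : \forall t \near (0 : R[i]^o)^', `|t| < (d / expR 1)%:C.
  exact: (@dnbhs0_lt R[i] R[i]^o _ eC).
(* At theta = 0 the convention ln 0 = 0 would give radius e instead of e|theta|. *)
near=> theta; have t0 : theta != 0 by near: theta; exact: withinT.
have : `|theta : R[i]^o| < (d / expR 1)%:C.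
  by near: theta; exact: tl.
rewrite /logmod normc_def /= ltcR; set r := Num.sqrt _ => rd.
have r0 : 0 < r.
  have : 0 < `|theta| by rewrite normr_gt0.
  by rewrite normc_def -/r ltcE /= => /andP[].
by rewrite expRD lnK ?posrE // ltW // -ltr_pdivlMr ?expR_gt0.
Unshelve. all: by end_near. Qed.

Theorem proposition6p7 (R : realType) (n s : nat) (chi : R -> R)
    (D : set 'CV[R]_n) (S : dform R n -> R[i]) :
  (0 < n)%N -> (s <= n)%N -> convexifier chi ->
  is_domain D -> bounded_set D -> simply_connected D -> smooth_boundary D ->
  is_current D S -> current_bidegree D s S -> positive_current D s S ->
  closed_current D S -> bounded_mass D S ->
  [/\ (* for every theta, the transform is a smooth positive (s,s)-current *)
      forall theta : R[i], theta != 0 ->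
        [/\ is_current D (transform chi D theta S),
            smooth_current D (transform chi D theta S),
            positive_current D s (transform chi D theta S)
          & current_bidegree D s (transform chi D theta S)],
      (* weak convergence to S *)
      forall phi : dform R n, test_form D phi ->
        (transform chi D theta S phi : R[i]^o) @[theta --> (0 : R[i]^o)^']
          --> (S phi : R[i]^o)
    & (* closedness on relatively compact open subsets, for small theta *)
      forall D' : set 'CV[R]_n, open D' -> relatively_compact_in D' D ->
        \forall theta \near (0 : R[i]^o)^',
          [/\ is_current D' (transform chi D theta S),
              smooth_current D' (transform chi D theta S),
              positive_current D' s (transform chi D theta S),
              closed_current D' (transform chi D theta S)
            & current_bidegree D' s (transform chi D theta S)]].
Proof.
move=> n0 sn hchi [oD D0 cD] bD scD sbD [linS _] bidS posS clS [M massS].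
have exhD := exhausting_cutoffs_exist hchi n0 oD bD.
pose K t : 'CV[R]_n -> R := kern chi (logmod t).
have cK t : ccs (K t) by exact: kern_ccs.
have Ks t z : K t (- z) = K t z by exact: kern_opp.
have K0 t z : 0 <= K t z by exact: kern_ge0.
have K1 t : vint (K t) = 1 by exact: vint_kern.
have bK t : bsupp (expR (logmod t + 1)) (K t) by exact: kern_bsupp.
have TE t phi (U : set 'CV[R]_n) : test_form U phi ->
    transform chi D t S phi = mollified D S (K t) phi.
  by move=> /test_form_tform; exact: transformE.
have main t U : [/\ is_current U (transform chi D t S),
    smooth_current U (transform chi D t S),
    positive_current U s (transform chi D t S)
  & current_bidegree U s (transform chi D t S)].
  split.
  - split=> [c phi psi tp tq|A cA AU].
      rewrite !(TE t _ U) //; last exact: test_formDZ.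
      exact: (mollifiedDZ linS massS exhD (cK t) _ (test_form_tform tp) (test_form_tform tq)).
    (* No derivative enters: convolution respects sup bounds and S is bounded by its mass. The mass
       is doubled because [pB] bounds real and imaginary parts separately. *)
    exists (M + M), 0%N => phi B sp sA pB.
    have tU : test_form U phi by split=> //; exists A.
    rewrite (TE t _ U) // mulrDl -mulrDr.
    apply: (mollified_le linS massS exhD (cK t) (K0 t) (K1 t)); first exact: test_form_tform tU.
    by move=> z I; exact: (pB [::] z I).
  - have [omega [so Ho]] := mollified_smooth linS massS exhD (cK t) (Ks t).
    exists omega; split=> // phi tp; rewrite (TE t _ U) //.
    by apply: Ho; exact: test_form_tform tp.
  - move=> phi tp sp; rewrite (TE t _ U) //.
    by apply: (mollified_ge0 linS massS exhD (cK t) (Ks t) (K0 t) posS) => //; exact: test_form_tform tp.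
  - move=> p q phi tp bp pq; rewrite (TE t _ U) //.
    exact: (mollified_bidegree linS massS exhD (cK t) (K0 t) (K1 t) bidS (test_form_tform tp) bp pq).
split=> [t _|phi tD|D' oD' [cD' D'D]].
- exact: main.
- have M0 := mass_ge0 linS massS; have tp := test_form_tform tD.
  apply/cvgCP => e e0; have M1 : 0 < M + M + 1 by rewrite ltr_wpDl // addr_ge0.
  have e1 : 0 < e / (M + M + 1) by rewrite divr_gt0.
  have u (t : {set gen n} * bool) :
      ucont (fun y => if t.2 then Im (phi y t.1) else Re (phi y t.1)).
    by case: t => I []; apply: ccs_ucont; case: (tp I).
  (* One [d] serves both parts of all coefficients. The precision is scaled for the constant M (e +
     e) of [mollified_close], with 1 added as M may be 0. *)
  have [d d0 Hd] := equicont_fin (fun t => ucont_equicont (u t)) e1.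
  have d2 : 0 < d / 2 by rewrite divr_gt0.
  apply: filterS (near_kern_width d2) => t wd; rewrite (TE t _ D) //.
  have H c x y : `|y| <= expR (logmod t + 1) ->
      `|(if c.2 then Im (phi (y + x) c.1) else Re (phi (y + x) c.1)) -
        (if c.2 then Im (phi x c.1) else Re (phi x c.1))| <= e / (M + M + 1).
    move=> yN; apply: (Hd (existT (fun _ => unit) c tt)); rewrite addrK.
    by apply: le_lt_trans yN _; apply: le_lt_trans wd _; rewrite ltr_pdivrMr // mulr_natr mulr2n ltrDl.
  apply: (le_trans (mollified_close linS massS exhD (cK t) (K0 t) (K1 t) tD (bK t) (ltW e1) _)).
    by move=> I x y yN; split; [exact: (H (I, false)) | exact: (H (I, true))].
  rewrite lecR mulrDr -mulrDl; apply: mul_divS_le; [exact: addr_ge0 | exact: ltW].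
(* The smallness of theta depends on D' only: e|theta| is at most half of a lower bound for the
   capped distance on the closure of D', which contains the support of every test form on D'. *)
- have [d d0 Hd] := compact_dst oD cD' D'D.
  have d2 : 0 < d / 2 by rewrite divr_gt0.
  apply: filterS (near_kern_width d2) => t wd.
  have [m1 m2 m3 m4] := main t D'; split=> // phi tp.
  have [_ [A [cA AD' sA]]] := tp.
  rewrite transformE //; last exact: tform_dext (test_form_tform tp).
  apply: (mollified_closed linS massS exhD (cK t) (K0 t) (K1 t) bD clS
    (test_form_tform tp) sA d0 _ (bK t) wd).
  by move=> z /AD' /(@subset_closure _ _ z); exact: Hd.
Qed.
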